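(* For every $C_0\ge1$ there exists $C\ge1$, depending only on $C_0$, such that the following holds. Let $n\ge8$, $p\in\{1,2\}$, let $x^*$ be an arbitrary minimizer of $f(x)=\mathbb{E}_\xi[F(x,\xi)]$ on $\mathbb{R}^n$, let $\Theta_p$ satisfy $V[x_0](x^* )\le\Theta_p$, and assume $0<\Delta\le L_2\Theta_pn^3\rho_n^2/2$. Define $t(\Delta)=\sqrt{\Delta/L_2}$ and, for $p=1$, $$N(\Delta)=\min\Big\{\big(\tfrac{L_2\Theta_1n}{\Delta}\big)^{1/3},\big(\tfrac{L_2\Theta_1n}{\Delta}\big)^{1/4}\Big\},\quad m(\Delta)=\min\Big\{\tfrac{\sigma^2}{nL_2\Delta},\tfrac{\sigma^2}{(n^5L_2^5\Theta_1\Delta^3)^{1/4}}\Big\},\quad \varepsilon(\Delta)=\max\Big\{(L_2\Theta_1n\Delta^2)^{1/3},\sqrt{nL_2\Theta_1\Delta}\Big\},$$ and, for $p=2$, $$N(\Delta)=\min\Big\{\big(\tfrac{L_2\Theta_2n^2}{\Delta}\big)^{1/3},\big(\tfrac{L_2\Theta_2n^3}{\Delta}\big)^{1/4}\Big\},\quad m(\Delta)=\min\Big\{\tfrac{\sigma^2}{nL_2\Delta},\tfrac{\sigma^2}{(n^3L_2^5\Theta_2\Delta^3)^{1/4}}\Big\},\quad \varepsilon(\Delta)=\max\Big\{(L_2\Theta_2n^2\Delta^2)^{1/3},\sqrt{nL_2\Theta_2\Delta}\Big\}.$$ Let ARDFDS (defined in the context) be run from $x_0$ with positive integers $N,m$ and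 a smoothing parameter $t>0$ such that each of the ratios $N/N(\Delta)$, $m/m(\Delta)$, $t/t(\Delta)$ (with $m(\Delta)>0$) lies in $[C_0^{-1}(\ln n)^{-C_0},\,C_0(\ln n)^{C_0}]$. Then its output satisfies $$\mathbb{E}[f(y_N)]-f(x^* )\le C(\ln n)^C\,\varepsilon(\Delta).$$ Moreover, the overall number of oracle calls is $Nm$, which is at most $C(\ln n)^C$ times $$\min\Big\{\sigma^2\big(\tfrac{\Theta_1}{n^2L_2^2\Delta^4}\big)^{1/3},\tfrac{\sigma^2}{nL_2\Delta}\Big\}\ \text{ for } p=1,\qquad \min\Big\{\sigma^2\big(\tfrac{\Theta_2}{nL_2^2\Delta^4}\big)^{1/3},\tfrac{\sigma^2}{L_2\Delta}\Big\}\ \text{ for } p=2.$$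
   Context: Problem. $\xi$ is a random vector with distribution $P$ on $\mathcal{X}$; $f(x)=\mathbb{E}_\xi[F(x,\xi)]$ is a closed convex function on $\mathbb{R}^n$ having a minimizer ($F(\cdot,\xi)$ itself need not be convex). Almost surely in $\xi$, $F(\cdot,\xi)$ has a gradient $g(x,\xi)$ with $\|g(x,\xi)-g(y,\xi)\|_2\le L(\xi)\|x-y\|_2$ for all $x,y$. The constant $L_2>0$ satisfies $\sqrt{\mathbb{E}_\xi L(\xi)^2}\le L_2$; consequently $\mathbb{E}_\xi g(x,\xi)=\nabla f(x)$ and $\nabla f$ is $L_2$-Lipschitz in $\|\cdot\|_2$. For all $x$, $\mathbb{E}_\xi\|g(x,\xi)-\nabla f(x)\|_2^2\le\sigma^2$. Oracle. Given a pair of points $(x,y)$, an oracle call returns $(\widetilde f(x,\xi),\widetilde f(y,\xi))$ for one sample $\xi\sim P$ (the same for both points), where $\widetilde f(x,\xi)=F(x,\xi)+\eta(x,\xi)$ and $|\eta(x,\xi)|\le\Delta$ for all $x\in\mathbb{R}^n$, a.s. in $\xi$. All functions are measurable, so that expectations make sense. The noise level $\Delta$ is known but cannot be controlled. Proximal setup. $q$ is given by $\frac1p+\frac1q=1$ ($q=\infty$ for $p=1$, $q=2$ for $p=2$). The prox-function is $d(x)=\frac12\|x\|_2^2$ for $p=2$, and $d(x)=\frac12\,\exp(1)\,n^{(\kappa-1)(2-\kappa)/\kappa}\ln n\,\|x\|_\kappa^2$ with $\kappa=1+\frac1{\ln n}$ for $p=1$; it is $1$-strongly convex w.r.t. $\|\cdot\|_p$.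 $V[z](x)=d(x)-d(z)-\langle\nabla d(z),x-z\rangle$ is the Bregman divergence. $\rho_n=\min\{q-1,\,16\ln n-8\}\,n^{2/q-1}$, i.e. $\rho_n=(16\ln n-8)/n$ for $p=1$ and $\rho_n=1$ for $p=2$ (when $n\ge 8$). Gradient approximation. For $e$ in the unit Euclidean sphere and samples $\xi_1,\dots,\xi_m$, $\widetilde\nabla^m f^t(x)=\frac1m\sum_{i=1}^m\frac{\widetilde f(x+te,\xi_i)-\widetilde f(x,\xi_i)}{t}\,e$. ARDFDS. Input $x_0\in\mathbb{R}^n$, $N,m\ge1$, $t>0$. Set $y_0=z_0=x_0$ and $\alpha_k=\frac{k+1}{96n^2\rho_nL_2}$. For $k=0,\dots,N-1$: draw $e_{k+1}$ uniformly from the unit Euclidean sphere of $\mathbb{R}^n$ and $m$ independent copies $\xi_1^{k+1},\dots,\xi_m^{k+1}$ of $\xi$, all independent of each other and of previous iterations; set $\tau_k=\frac{2}{k+2}$ and $x_{k+1}=\tau_kz_k+(1-\tau_k)y_k$; compute $\widetilde\nabla^m f^t(x_{k+1})$ with $e=e_{k+1}$ and $\xi_i=\xi_i^{k+1}$; set $y_{k+1}=x_{k+1}-\frac1{2L_2}\widetilde\nabla^m f^t(x_{k+1})$ and $z_{k+1}=\arg\min_{z\in\mathbb{R}^n}\{\alpha_{k+1}n\langle\widetilde\nabla^m f^t(x_{k+1}),z-z_k\rangle+V[z_k](z)\}$. Output $y_N$. $\mathbb{E}$ is the expectation over all randomness of the algorithm. *)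

(* Defs.v *)
From HB Require Import structures.
From mathcomp Require Import all_boot all_order all_algebra.
From mathcomp Require Import all_classical all_reals all_analysis.
From mathcomp Require Import lra.

Set Implicit Arguments.
Unset Strict Implicit.
Unset Printing Implicit Defensive.

Import Order.TTheory GRing.Theory Num.Theory.
Import numFieldNormedType.Exports.

Local Open Scope classical_set_scope.
Local Open Scope ring_scope.

(* R^n carries its Borel sigma-algebra; the library topology of 'rV[R]_n comes
   from the sup norm, which is equivalent to the Euclidean one. *)
HB.instance Definition _ (R : realType) (n : nat) :=
  @isMeasurable.Build (sigma_display (@open 'rV[R]_n)) 'rV[R]_n
    <<s @open 'rV[R]_n >> (@sigma_algebra0 _ setT (@open 'rV[R]_n))
    (@sigma_algebraC _ (@open 'rV[R]_n))
    (@sigma_algebra_bigcup _ setT (@open 'rV[R]_n)).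

Section vectors.
Context {R : realType} {n : nat}.
Implicit Types (x y : 'rV[R]_n) (f : 'rV[R]_n -> R).

Definition dotv x y : R := \sum_i x 0 i * y 0 i.

Definition norm2 x : R := Num.sqrt (dotv x x).

Definition lpnorm (k : R) x : R := (\sum_i `|x 0 i| `^ k) `^ k^-1.

Definition grad f x : 'rV[R]_n := \row_i 'D_(delta_mx 0 i) f x.

Definition is_minimizer f x : Prop := forall y, f x <= f y.

Definition closed_function f : Prop :=
  closed [set p : 'rV[R]_n * R | f p.1 <= p.2].

(* The uniform distribution on the unit Euclidean sphere is the only Borel
   probability measure that is carried by the sphere and invariant under every
   orthogonal transformation. *)
Definition uniform_on_sphere (mu : set 'rV[R]_n -> \bar R) : Prop :=
  mu [set v | norm2 v = 1] = 1%E /\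
  forall Q : 'M[R]_n, Q *m Q^T = 1%:M ->
    forall A, measurable A -> mu ((fun v => v *m Q) @^-1` A) = mu A.

End vectors.

Section prox.
Context {R : realType}.
Variables p n : nat.

(* 1/p + 1/q = 1; in \bar R the inverse of 0 is +oo, so that q = +oo for p = 1
   and 2 / q = 0 in that case. *)
Definition conj_exponent : \bar R := ((1 - p%:R^-1)%:E^-1)%E.

Definition rho : R :=
  fine (mine (conj_exponent - 1) (16 * ln n%:R - 8)%:E)%E *
  n%:R `^ (fine (2%:E / conj_exponent)%E - 1).

Definition kappa : R := 1 + (ln n%:R)^-1.

(* Only used for p = 1 and p = 2. *)
Definition prox (x : 'rV[R]_n) : R :=
  if p == 1%N then
    2^-1 * expR 1 * n%:R `^ ((kappa - 1) * (2 - kappa) / kappa) * ln n%:R *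
    lpnorm kappa x ^+ 2
  else 2^-1 * norm2 x ^+ 2.

Definition bregman (z x : 'rV[R]_n) : R :=
  prox x - prox z - dotv (grad prox z) (x - z).

End prox.

Section prox_facts.
Context {R : realType}.

Lemma conj_exponent1 : conj_exponent 1 = +oo%E :> \bar R.
Proof. by rewrite /conj_exponent invr1 subrr inve0. Qed.

Lemma conj_exponent2 : conj_exponent 2 = 2%:E :> \bar R.
Proof.
have h : (1 - 2^-1 : R) = 2^-1 by rewrite [X in X - _](splitr 1) mul1r addrK.
by rewrite /conj_exponent h inver invr_eq0 pnatr_eq0/= invrK.
Qed.

Lemma rho1 n : rho 1 n = (16 * ln n%:R - 8) / n%:R :> R.
Proof.
rewrite /rho conj_exponent1 addye// minye/= mulr0 sub0r.
by rewrite powR_inv1.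
Qed.

Lemma rho2 n : (8 <= n)%N -> rho 2 n = 1 :> R.
Proof.
move=> n8; rewrite /rho conj_exponent2.
have n0 : (0 : R) < n%:R by rewrite ltr0n (leq_trans _ n8).
have ln1 : 3 / 4 <= ln n%:R :> R.
  rewrite -ler_expR lnK ?posrE// (@le_trans _ _ 8) ?ler_nat//.
  have := @expR_ge1Dx R (- (3 / 4)); rewrite expRN => h.
  have {h} : (1 / 4 : R) <= (expR (3 / 4))^-1 by apply: le_trans h; lra.
  have := expR_gt0 (3 / 4 : R); set u := expR _ => u0.
  rewrite -[_ <= u^-1](ler_pM2r u0) mulVf ?gt_eqF//; lra.
rewrite -EFinB -EFin_min/= min_l; last lra.
have -> : (2 - 1 : R) = 1 by lra.
rewrite inver pnatr_eq0/= divff ?pnatr_eq0// subrr powRr0 mulr1.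
by [].
Qed.

End prox_facts.

Section problem.
Context {R : realType} {d : measure_display} {X : measurableType d}.
Variables (n : nat) (P : probability X R).
Implicit Types (F eta : 'rV[R]_n -> X -> R) (g : 'rV[R]_n -> X -> 'rV[R]_n).

Definition objective F (x : 'rV[R]_n) : R := fine ('E_P[F x])%E.

(* The statements that E[g(x,xi)] = grad f(x) and that grad f is L2-Lipschitz
   follow from these fields. *)
Record stochastic_problem F g (L : X -> R) (L2 sigma : R) : Prop := {
  sp_measF : measurable_fun setT (fun u : 'rV[R]_n * X => F u.1 u.2) ;
  sp_measg : measurable_fun setT (fun u : 'rV[R]_n * X => g u.1 u.2) ;
  sp_measL : measurable_fun setT L ;
  sp_integrable : forall x, P.-integrable setT (EFin \o F x) ;
  sp_convex : convex_function [set: convex_lmodType 'rV[R]_n] (objective F) ;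
  sp_closed : closed_function (objective F) ;
  sp_smooth : {ae P, forall xi,
    (forall x, differentiable (F ^~ xi) x /\ grad (F ^~ xi) x = g x xi) /\
    (forall x y, norm2 (g x xi - g y xi) <= L xi * norm2 (x - y))} ;
  sp_L2gt0 : 0 < L2 ;
  sp_L2 : (sqrte 'E_P[fun xi => (L xi ^+ 2)%R] <= L2%:E)%E ;
  sp_variance : forall x,
    ('E_P[fun xi => (norm2 (g x xi - grad (objective F) x) ^+ 2)%R]
       <= (sigma ^+ 2)%:E)%E
}.

Record oracle_noise eta (Delta : R) : Prop := {
  on_meas : measurable_fun setT (fun u : 'rV[R]_n * X => eta u.1 u.2) ;
  on_bound : {ae P, forall xi, forall x, `|eta x xi| <= Delta}
}.

End problem.

Section algorithm.
Context {R : realType} {d : measure_display} {X : measurableType d}.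
Context {d' : measure_display} {Omega : measurableType d'}.
Variables (n p N m : nat).
Implicit Types (Ft : 'rV[R]_n -> X -> R) (e : 'I_N -> Omega -> 'rV[R]_n)
  (xi : 'I_N -> 'I_m -> Omega -> X) (x y z : nat -> Omega -> 'rV[R]_n).

(* Iteration k : 'I_N draws e k and xi k i (e_{k+1} and xi_i^{k+1} in the usual
   one-based numbering). In [sm_indep] the sets A k and B k i may be setT, so
   that the product rule over all indices is the mutual independence of the
   whole family. *)
Record ardfds_sampling (Pr : probability Omega R) (P : probability X R) e xi
  : Prop := {
  sm_meas_e : forall k, measurable_fun setT (e k) ;
  sm_meas_xi : forall k i, measurable_fun setT (xi k i) ;
  sm_law_e : forall k, uniform_on_sphere (pushforward Pr (e k)) ;
  sm_law_xi : forall k i A, measurable A -> pushforward Pr (xi k i) A = P A ;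
  sm_indep : forall (A : 'I_N -> set 'rV[R]_n) (B : 'I_N -> 'I_m -> set X),
    (forall k, measurable (A k)) -> (forall k i, measurable (B k i)) ->
    Pr [set w | (forall k, A k (e k w)) /\ (forall k i, B k i (xi k i w))] =
    ((\prod_k Pr (e k @^-1` A k)) *
     (\prod_k \prod_i Pr (xi k i @^-1` B k i)))%E
}.

Definition oracle Ft (x y : 'rV[R]_n) (s : X) : R * R := (Ft x s, Ft y s).

(* The gradient approximation is built from an explicit list of oracle answers,
   one per call, so that [oracle_calls] below can count the calls. *)
Definition oracle_answers Ft (t : R) (x e : 'rV[R]_n) (s : 'I_m -> X)
    : seq (R * R) :=
  [seq oracle Ft (x + t *: e) x (s i) | i <- enum 'I_m].

Definition grad_approx Ft (t : R) (x e : 'rV[R]_n) (s : 'I_m -> X)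
    : 'rV[R]_n :=
  (m%:R^-1 * \sum_(a <- oracle_answers Ft t x e s) (a.1 - a.2) / t) *: e.

Definition step_alpha (L2 : R) (k : nat) : R :=
  k.+1%:R / (96 * n%:R ^+ 2 * rho p n * L2).

Definition step_tau (k : nat) : R := 2 / k.+2%:R.

Definition ardfds_grad Ft (t : R) e xi x (k : 'I_N) (w : Omega) : 'rV[R]_n :=
  grad_approx Ft t (x k.+1 w) (e k w) (fun i => xi k i w).

Record ardfds_run Ft (L2 t : R) (x0 : 'rV[R]_n) e xi x y z : Prop := {
  run_init : forall w, [/\ x 0%N w = x0, y 0%N w = x0 & z 0%N w = x0] ;
  run_x : forall (k : 'I_N) w,
    x k.+1 w = step_tau k *: z k w + (1 - step_tau k) *: y k w ;
  run_y : forall (k : 'I_N) w,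
    y k.+1 w = x k.+1 w - (2 * L2)^-1 *: ardfds_grad Ft t e xi x k w ;
  run_z : forall (k : 'I_N) w,
    is_minimizer (fun v => step_alpha L2 k.+1 * n%:R *
                             dotv (ardfds_grad Ft t e xi x k w) (v - z k w) +
                           bregman p (z k w) v)
                 (z k.+1 w)
}.

Definition oracle_calls Ft (t : R) e xi x (w : Omega) : nat :=
  \sum_(k < N)
     size (oracle_answers Ft t (x k.+1 w) (e k w) (fun i => xi k i w)).

End algorithm.

Section rates.
Context {R : realType}.
Variables (p n : nat) (L2 Theta Delta sigma : R).

Definition t_Delta : R := Num.sqrt (Delta / L2).

Definition N_Delta : R :=
  if p == 1%N then
    Num.min ((L2 * Theta * n%:R / Delta) `^ 3^-1)
            ((L2 * Theta * n%:R / Delta) `^ 4^-1)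
  else
    Num.min ((L2 * Theta * n%:R ^+ 2 / Delta) `^ 3^-1)
            ((L2 * Theta * n%:R ^+ 3 / Delta) `^ 4^-1).

Definition m_Delta : R :=
  if p == 1%N then
    Num.min (sigma ^+ 2 / (n%:R * L2 * Delta))
      (sigma ^+ 2 / (n%:R ^+ 5 * L2 ^+ 5 * Theta * Delta ^+ 3) `^ 4^-1)
  else
    Num.min (sigma ^+ 2 / (n%:R * L2 * Delta))
      (sigma ^+ 2 / (n%:R ^+ 3 * L2 ^+ 5 * Theta * Delta ^+ 3) `^ 4^-1).

Definition eps_Delta : R :=
  if p == 1%N then
    Num.max ((L2 * Theta * n%:R * Delta ^+ 2) `^ 3^-1)
            (Num.sqrt (n%:R * L2 * Theta * Delta))
  else
    Num.max ((L2 * Theta * n%:R ^+ 2 * Delta ^+ 2) `^ 3^-1)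
            (Num.sqrt (n%:R * L2 * Theta * Delta)).

Definition calls_Delta : R :=
  if p == 1%N then
    Num.min (sigma ^+ 2 * (Theta / (n%:R ^+ 2 * L2 ^+ 2 * Delta ^+ 4)) `^ 3^-1)
            (sigma ^+ 2 / (n%:R * L2 * Delta))
  else
    Num.min (sigma ^+ 2 * (Theta / (n%:R * L2 ^+ 2 * Delta ^+ 4)) `^ 3^-1)
            (sigma ^+ 2 / (L2 * Delta)).

End rates.

(* r is of order 1 up to a factor polynomial in ln n. *)
Definition polylog_close (R : realType) (C0 : R) (n : nat) (r : R) : Prop :=
  C0^-1 * ln n%:R `^ (- C0) <= r <= C0 * ln n%:R `^ C0.

(* Main.v *)
(* Write the approximate gradient along the direction [e] as
   [(<grad f, e> + b + th) e], where [b] is the centred sampling error and [th]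
   the finite-difference bias, [E th^2 <= 8 Delta^2/t^2 + 2 t^2 L2^2]. For [e]
   uniform on the sphere, [E <u, e>^2 = |u|^2 / n], and invariance under
   coordinate reflections and transpositions gives
   [E (<u, e>^2 |e|_q^2) = |u|^2 / n * E |e|_q^2], where [E |e|_q^2 = O(rho_n)]
   follows from a sub-Gaussian bound for [max_i |e_i|] when p = 1. With these
   moments, the descent inequality for [f] along [e] and the mirror-descent
   inequality couple as in accelerated coordinate descent. The step sizes leave
   room for a prox function that is only 2/9-strongly convex, which is what is
   shown for p = 1.

   The bias term [th <z_k - x*, e>] is split by Young's inequality with a
   parameter [gamma] of the order of the sum of the step sizes, so that it
   multiplies the Bregman distance by [1 + 1/(2N)] per step, a bounded factor
   over N steps. This yields
     [E f(y_N) - f* = O (n^2 rho_n L2 Theta / N^2 + N^2 th2 / (n rho_n L2)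
                         + N (sigma^2 / (n m) + th2) / L2)]
   with [th2] the above bound on [E th^2], and the prescribed N, m, t balance the
   three terms. *)

Require Import Defs.
From HB Require Import structures.
From mathcomp Require Import all_boot all_order all_algebra perm.
From mathcomp Require Import all_classical all_reals all_analysis.
From mathcomp Require Import measurable_realfun ring lra.

Set Implicit Arguments.
Unset Strict Implicit.
Unset Printing Implicit Defensive.

Import Order.TTheory GRing.Theory Num.Theory.
Import numFieldNormedType.Exports.

Local Open Scope classical_set_scope.
Local Open Scope ring_scope.

(** * Euclidean vectors *)

(** Two obstacles lie outside the inequalities. A run specifies [z] only as a minimizer, so its
    measurability has to be proved: the optimality condition gives the mirror image of [z]
    explicitly, and the gradient of the prox function has a measurable left inverse. Integrability
    is not given either; it is carried through the iterations for the Bregman distance and for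
    [|y - x*|^2], which together control the gaps and the gradients.

    Averaging happens in two different orders. Freezing everything except the direction [e k] gives
    the second moments; freezing everything except one sample makes the sampling error centred,
    although it is multiplied by quantities that involve [e k]. Independence is therefore formulated
    with the sigma-algebra of all draws but one rather than with a filtration. The finite-difference
    bias is neither centred nor independent of [e k]; it is handled through a bound on its square by
    a function of the samples alone. *)

Section dotv.
Context {R : realType} {n : nat}.
Implicit Types (x y z v : 'rV[R]_n) (a : R).

Lemma dotvC x y : dotv x y = dotv y x.
Proof. by apply: eq_bigr => i _; rewrite mulrC. Qed.

Lemma dotvDl x y v : dotv (x + y) v = dotv x v + dotv y v.
Proof. by rewrite -big_split; apply: eq_bigr => i _; rewrite !mxE mulrDl. Qed.

Lemma dotvZl a x v : dotv (a *: x) v = a * dotv x v.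
Proof. by rewrite mulr_sumr; apply: eq_bigr => i _; rewrite !mxE mulrA. Qed.

Lemma dotvNl x v : dotv (- x) v = - dotv x v.
Proof. by rewrite -scaleN1r dotvZl mulN1r. Qed.

Lemma dotvBl x y v : dotv (x - y) v = dotv x v - dotv y v.
Proof. by rewrite dotvDl dotvNl. Qed.

Lemma dotvDr x y v : dotv v (x + y) = dotv v x + dotv v y.
Proof. by rewrite dotvC dotvDl !(dotvC v). Qed.

Lemma dotvZr a x v : dotv v (a *: x) = a * dotv v x.
Proof. by rewrite dotvC dotvZl (dotvC v). Qed.

Lemma dotvNr x v : dotv v (- x) = - dotv v x.
Proof. by rewrite dotvC dotvNl (dotvC v). Qed.

Lemma dotvBr x y v : dotv v (x - y) = dotv v x - dotv v y.
Proof. by rewrite dotvDr dotvNr. Qed.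

Lemma dotv_ge0 x : 0 <= dotv x x.
Proof. by apply: sumr_ge0 => i _; rewrite -expr2 sqr_ge0. Qed.

Lemma dotv_delta x i : dotv x (delta_mx 0 i) = x 0 i.
Proof.
rewrite /dotv (bigD1 i)//= big1 ?addr0 => [|j ji].
  by rewrite mxE !eqxx mulr1.
by rewrite mxE (negPf ji) andbF mulr0.
Qed.

Lemma norm2_ge0 x : 0 <= norm2 x.
Proof. exact: sqrtr_ge0. Qed.

Lemma norm2_sqr x : norm2 x ^+ 2 = dotv x x.
Proof. by rewrite sqr_sqrtr// dotv_ge0. Qed.

Lemma norm2Z a x : norm2 (a *: x) = `|a| * norm2 x.
Proof.
by rewrite /norm2 dotvZl dotvZr mulrA -expr2 sqrtrM ?sqr_ge0// sqrtr_sqr.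
Qed.

Lemma norm2_eq0 x : norm2 x = 0 -> x = 0.
Proof.
move=> x0; have : dotv x x = 0 by rewrite -norm2_sqr x0 expr0n.
move/eqP; rewrite psumr_eq0 => [/allP h|i _]; last by rewrite -expr2 sqr_ge0.
apply/rowP => i; rewrite mxE; apply/eqP.
by rewrite -sqrf_eq0 expr2; apply: h; rewrite mem_index_enum.
Qed.

Lemma cauchy_schwarz_sqr x y : dotv x y ^+ 2 <= dotv x x * dotv y y.
Proof.
have [x0|/eqP x0] := eqVneq (norm2 x) 0.
  by rewrite (norm2_eq0 x0) -(scale0r 0) !dotvZl !mul0r expr0n.
have xx : 0 < dotv x x.
  by rewrite -norm2_sqr exprn_gt0// lt0r norm2_ge0 andbT; apply/eqP.
have := dotv_ge0 (dotv x x *: y - dotv x y *: x).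
rewrite !(dotvBl, dotvBr, dotvZl, dotvZr) (dotvC y x) => h.
rewrite -(ler_pM2l xx) -subr_ge0; apply: le_trans h _.
by rewrite le_eqVlt; apply/orP; left; apply/eqP; ring.
Qed.

Lemma cauchy_schwarz x y : `|dotv x y| <= norm2 x * norm2 y.
Proof.
rewrite -ler_sqr ?nnegrE ?mulr_ge0 ?norm2_ge0//.
by rewrite exprMn !norm2_sqr real_normK ?num_real// cauchy_schwarz_sqr.
Qed.

End dotv.

(** * Borel measurability of vector-valued maps *)

Section borel_vectors.
Context {R : realType} {n : nat}.

Let qbox (c : 'rV[rat]_n * rat) : set 'rV[R]_n :=
  [set v | forall i, ratr (c.1 0 i) - ratr c.2 < v 0 i < ratr (c.1 0 i) + ratr c.2].

(** Second countability, by cubes with rational centre and radius. The sigma-algebra is generated by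
    all open sets, and only a countable union reduces measurability of a map to that of its
    coordinates. *)
Lemma open_rV_bigcup_box (U : set 'rV[R]_n) : open U ->
  exists D : set ('rV[rat]_n * rat),
    U = \bigcup_(c in D) qbox c.
Proof.
move=> oU; exists [set c | qbox c `<=` U]; apply/seteqP; split; last first.
  by move=> v [c cU cv]; exact: cU.
move=> v Uv; have /nbhs_ballP[e /= e0 eU] := open_nbhs_nbhs (conj oU Uv).
(* The rational centre will lie within [r] of [v], so every point of the cube is within [2 r < e] of
   [v]. *)
have [r /andP[r0 re]] : exists r : rat, 0 < (ratr r : R) < e / 2.
  have := @rat_in_itvoo R 0 (e / 2); rewrite divr_gt0// => /(_ isT)[r].
  by rewrite in_itv/= => h; exists r.
have /choice[q hq] : forall i, exists q : rat,
    v 0 i - ratr r < (ratr q : R) < v 0 i + ratr r.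
  move=> i; have := @rat_in_itvoo R (v 0 i - ratr r) (v 0 i + ratr r).
  have -> : v 0 i - ratr r < v 0 i + ratr r by lra.
  by move=> /(_ isT)[q]; rewrite in_itv/= => h; exists q.
exists (\row_i q i, r).
  move=> w /= hw; apply: eU; split => // i j; rewrite ord1 /=.
  have := hw j; have := hq j; rewrite mxE /ball/= => /andP[? ?] /andP[? ?].
  by rewrite ltr_distl; apply/andP; split; lra.
by move=> i /=; rewrite mxE; have /andP[? ?] := hq i; apply/andP; split; lra.
Qed.

Lemma measurable_coord (i : 'I_n) :
  measurable_fun setT (fun v : 'rV[R]_n => v 0 i).
Proof.
apply: (measurability _ (measurable_realfun.RGenOpens.measurableE R)).
move=> _ [_ [a [b ->] <-]]; rewrite setTI; apply: sub_sigma_algebra.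
apply: open_comp; last exact: interval_open.
by move=> v _; exact: coord_continuous.
Qed.

Lemma measurable_fun_rV d (T : measurableType d) (f : T -> 'rV[R]_n) :
  (forall i, measurable_fun setT (fun w => f w 0 i)) -> measurable_fun setT f.
Proof.
move=> mf; apply: (@measurability _ _ _ _ _ _ (@open 'rV[R]_n)).
  by [].
move=> _ [U oU <-]; have [D ->] := open_rV_bigcup_box oU.
rewrite setTI preimage_bigcup bigcup_mkcond.
apply: countable_bigcupT_measurable => [|c]; first exact: countableP.
case: ifP => // _.
have -> : f @^-1` qbox c = \bigcap_(i in [set: 'I_n]) ((fun w => f w 0 i) @^-1`
    `](ratr (c.1 0 i) - ratr c.2), (ratr (c.1 0 i) + ratr c.2)[%classic).
  apply/seteqP; split => w /= h i; first by move=> _; rewrite /= in_itv/=; exact: h.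
  by have := h i I; rewrite /= in_itv/=.
apply: fin_bigcap_measurable => [|i _]; first exact: finite_finset.
rewrite -[X in measurable X]setTI; exact: mf.
Qed.

End borel_vectors.

Section measurable_vector_ops.
Context {R : realType} {n : nat} {d : measure_display} {T : measurableType d}.
Implicit Types (f g : T -> 'rV[R]_n) (a : T -> R).

Lemma measurable_fun_coord f i :
  measurable_fun setT f -> measurable_fun setT (fun w => f w 0 i).
Proof. by move=> mf; apply: (measurableT_comp (measurable_coord i) mf). Qed.

Lemma measurable_fun_addv f g : measurable_fun setT f -> measurable_fun setT g ->
  measurable_fun setT (fun w => f w + g w).
Proof.
move=> mf mg; apply: measurable_fun_rV => i.
under eq_fun do rewrite mxE.
by apply: measurable_funD; exact: measurable_fun_coord.
Qed.

Lemma measurable_fun_scalev a f : measurable_fun setT a -> measurable_fun setT f ->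
  measurable_fun setT (fun w => a w *: f w).
Proof.
move=> ma mf; apply: measurable_fun_rV => i.
under eq_fun do rewrite mxE.
by apply: measurable_funM => //; exact: measurable_fun_coord.
Qed.

Lemma measurable_fun_subv f g : measurable_fun setT f -> measurable_fun setT g ->
  measurable_fun setT (fun w => f w - g w).
Proof.
move=> mf mg; apply: measurable_fun_rV => i.
under eq_fun do rewrite !mxE.
by apply: measurable_funB; exact: measurable_fun_coord.
Qed.

Lemma measurable_fun_dotv f g : measurable_fun setT f -> measurable_fun setT g ->
  measurable_fun setT (fun w => dotv (f w) (g w)).
Proof.
move=> mf mg; apply: measurable_sum => i.
by apply: measurable_funM; exact: measurable_fun_coord.
Qed.

End measurable_vector_ops.

(** * Powers and l_k norms *)

Section powers.
Context {R : realType}.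
Implicit Types (a b u s r q x y M k : R).

Lemma powRV x r : 0 <= x -> x^-1 `^ r = (x `^ r)^-1.
Proof. by move=> x0; rewrite -powR_inv1// -powRrM mulN1r powRN. Qed.

Lemma powR_le_base r a b : 0 <= r -> 0 <= a -> a <= b -> a `^ r <= b `^ r.
Proof.
by move=> r0 a0 ab; apply: ge0_ler_powR => //; rewrite nnegrE ?(le_trans a0).
Qed.

(** Bernoulli's inequality. With [u = e^l], bounding [e^((1 - r) l)] and [e^(- r l)] below by their
    tangents at 0 gives [h3] and [h4]; in their combination with weights [r] and [1 - r] the terms
    in [l] cancel. *)
Lemma powR_le_tangent r u : 0 < r <= 1 -> 0 <= u -> u `^ r <= 1 + r * (u - 1).
Proof.
move=> /andP[r0 r1]; rewrite le_eqVlt => /predU1P[<-|u0].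
  by rewrite powR0 ?gt_eqF//; lra.
have uE : u = expR (ln u) by rewrite lnK.
have -> : u `^ r = expR (r * ln u) by rewrite /powR gt_eqF.
set l := ln u in uE *; rewrite {1}uE.
have e1 : expR l = expR (r * l) * expR ((1 - r) * l).
  by rewrite -expRD; congr expR; ring.
have h1 := expR_ge1Dx ((1 - r) * l); have h2 := expR_ge1Dx (- (r * l)).
have e2 : expR (r * l) * expR (- (r * l)) = 1 by rewrite -expRD subrr expR0.
have p := expR_gt0 (r * l).
have h3 : expR (r * l) * (1 + (1 - r) * l) <= expR l.
  by rewrite e1 ler_pM2l.
have h4 : expR (r * l) * (1 - r * l) <= 1 by rewrite -[leRHS]e2 ler_pM2l.
nra.
Qed.

Lemma powR_ge_tangent q u : 1 <= q -> 0 <= u -> 1 + q * (u - 1) <= u `^ q.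
Proof.
move=> q1 u0; have q0 : 0 < q by lra.
have := @powR_le_tangent q^-1 (u `^ q) _ (powR_ge0 _ _).
rewrite -powRrM divff ?gt_eqF// powRr1// invr_gt0 q0 invf_le1// q1 => /(_ isT) h.
have : q * (u - 1) <= q * (q^-1 * (u `^ q - 1)).
  by rewrite ler_pM2l//; lra.
by rewrite mulrA divff ?gt_eqF//; lra.
Qed.

Lemma powR_convex_tangent q s u : 1 <= q -> 0 < s -> 0 <= u ->
  s `^ q + q * s `^ (q - 1) * (u - s) <= u `^ q.
Proof.
move=> q1 s0 u0; have q0 : 0 < q by lra.
have us : 0 <= u / s by rewrite divr_ge0// ltW.
have := powR_ge_tangent q1 us.
rewrite -(ler_pM2l (powR_gt0 q s0)) -powRM ?(ltW s0)//.
rewrite [s * _]mulrC divfK ?gt_eqF// -(mulr_powRB1 (ltW s0) q0).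
apply: le_trans; rewrite le_eqVlt; apply/orP; left; apply/eqP.
by field; rewrite gt_eqF.
Qed.

(** Bernoulli's inequality at [a / b], multiplied by [b]. *)
Lemma weighted_am_gm r a b : 0 < r < 1 -> 0 <= a -> 0 <= b ->
  a `^ r * b `^ (1 - r) <= r * a + (1 - r) * b.
Proof.
move=> /andP[r0 r1] a0; rewrite le_eqVlt => /predU1P[<-|b0].
  by rewrite powR0 ?mulr0 ?addr0 ?mulr_ge0//; lra.
have ab : 0 <= a / b by rewrite divr_ge0// ltW.
have := @powR_le_tangent r (a / b) _ ab; rewrite r0 ltW// => /(_ isT).
rewrite -(ler_pM2l b0) => h.
suff -> : a `^ r * b `^ (1 - r) = b * (a / b) `^ r.
  by apply: le_trans h _; rewrite mulrDr mulr1 le_eqVlt; apply/orP; left;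
    apply/eqP; field; rewrite gt_eqF.
rewrite powRM// ?invr_ge0 ?ltW// -powR_inv1 ?ltW// -powRrM powRD; last first.
  by rewrite (gt_eqF b0) implybT.
by rewrite powRr1 ?ltW// mulN1r; ring.
Qed.

(** Weighted AM-GM term by term, after dividing both families by their sums; a family with sum zero
    vanishes and is treated apart. *)
Lemma hoelder_sum (I : finType) r (a b : I -> R) : 0 < r < 1 ->
  (forall i, 0 <= a i) -> (forall i, 0 <= b i) ->
  \sum_i a i `^ r * b i `^ (1 - r) <=
    (\sum_i a i) `^ r * (\sum_i b i) `^ (1 - r).
Proof.
move=> r01 a0 b0; have /andP[r0 r1] := r01; have r1' : 0 < 1 - r by lra.
have sum0 (c : I -> R) q : 0 < q -> (forall i, 0 <= c i) -> \sum_i c i = 0 ->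
    forall i, c i `^ q = 0.
  move=> q0 c0 /eqP; rewrite psumr_eq0// => /allP h i.
  by have /eqP -> := h i (mem_index_enum _); rewrite powR0// gt_eqF.
have : 0 <= \sum_i a i by apply: sumr_ge0.
rewrite le_eqVlt => /predU1P[A0|A0].
  rewrite big1 ?mulr_ge0 ?powR_ge0// => i _.
  by rewrite (sum0 a r)// mul0r.
have : 0 <= \sum_i b i by apply: sumr_ge0.
rewrite le_eqVlt => /predU1P[B0|B0].
  rewrite big1 ?mulr_ge0 ?powR_ge0// => i _.
  by rewrite (sum0 b (1 - r))// mulr0.
set A := \sum_i a i in A0 *; set B := \sum_i b i in B0 *.
have pA := powR_gt0 r A0; have pB := powR_gt0 (1 - r) B0.
rewrite -[leRHS]mulr1 -ler_pdivrMl ?mulr_gt0// mulr_sumr.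
apply: (@le_trans _ _ (\sum_i (r * (a i / A) + (1 - r) * (b i / B)))).
  apply: ler_sum => i _.
  apply: le_trans (weighted_am_gm r01 _ _); rewrite ?divr_ge0 ?(ltW A0) ?(ltW B0)//.
  rewrite (@powRM _ (a i) A^-1) ?invr_ge0 ?(ltW A0)//.
  rewrite (@powRM _ (b i) B^-1) ?invr_ge0 ?(ltW B0)//.
  rewrite (powRV _ (ltW A0)) (powRV _ (ltW B0)) invfM.
  by rewrite le_eqVlt; apply/orP; left; apply/eqP; ring.
rewrite big_split/= -!mulr_sumr -!mulr_suml -/A -/B !divff ?gt_eqF//.
by lra.
Qed.

(** For [0 <= c <= a + b] the ratio [c / (a + b)] is at most its [r]-th power; add the cases [c = a]
    and [c = b]. *)
Lemma powR_subadd r a b : 0 < r <= 1 -> 0 <= a -> 0 <= b ->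
  (a + b) `^ r <= a `^ r + b `^ r.
Proof.
move=> /andP[r0 r1] a0 b0; have [->|/eqP ab] := eqVneq (a + b) 0.
  by rewrite powR0 ?gt_eqF// addr_ge0 ?powR_ge0.
have ab0 : 0 < a + b by rewrite lt0r addr_ge0// andbT; exact/eqP.
have key c : 0 <= c <= a + b -> c / (a + b) * (a + b) `^ r <= c `^ r.
  move=> /andP[]; rewrite le_eqVlt => /predU1P[<-|c0 cab].
    by rewrite !mul0r powR_ge0.
  have -> : c `^ r = (c / (a + b)) `^ r * (a + b) `^ r.
    by rewrite -powRM ?(ltW ab0) ?divfK ?gt_eqF// divr_ge0 ?ltW.
  rewrite ler_pM2r ?powR_gt0//.
  by apply: ger1_powR => //; rewrite divr_gt0// ler_pdivrMr// mul1r.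
have := key a; have := key b; rewrite a0 b0 lerDl lerDr a0 b0.
move=> /(_ isT) h1 /(_ isT) h2; apply: le_trans (lerD h2 h1).
by rewrite -mulrDl -mulrDl divff ?gt_eqF// mul1r.
Qed.

(* [k * spow k] is the derivative of [|.|^k]. *)
Definition spow k a := Num.sg a * `|a| `^ (k - 1).

Lemma spowN k a : spow k (- a) = - spow k a.
Proof. by rewrite /spow sgrN normrN mulNr. Qed.

Lemma spow_mul k a : 0 < k -> spow k a * a = `|a| `^ k.
Proof. by move=> k0; rewrite /spow mulrAC -normrEsg mulr_powRB1. Qed.

Lemma spow_ge0 k a : 1 < k -> 0 <= a -> spow k a = a `^ (k - 1).
Proof.
move=> k1; rewrite le_eqVlt => /predU1P[<-|a0].
  by rewrite /spow sgr0 mul0r powR0// subr_eq0 gt_eqF.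
by rewrite /spow gtr0_sg// mul1r gtr0_norm.
Qed.

Lemma norm_spow k a : 1 < k -> `|spow k a| = `|a| `^ (k - 1).
Proof.
move=> k1; have [a0|a0] := leP 0 a.
  by rewrite spow_ge0// ger0_norm ?powR_ge0// ger0_norm.
rewrite -[in LHS](opprK a) spowN normrN spow_ge0 ?oppr_ge0 ?ltW//.
by rewrite ger0_norm ?powR_ge0// ltr0_norm.
Qed.

Section bregman_power.
Variables (k M : R).
Hypotheses (k12 : 1 < k <= 2) (M0 : 0 < M).
Let c := k * (k - 1) / 2 * M `^ (k - 2).

Let Mpow : 0 < M `^ (k - 2). Proof. exact: powR_gt0. Qed.

(** Replaces a second derivative: Bernoulli's inequality with exponent [k - 1] at [x / y] shows
    directly that the derivative of [x^k - c x^2] is nondecreasing on (0, M]. *)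
Let pow_deriv_diff x y : 0 < x <= M -> 0 < y <= M -> x <= y ->
  k * x `^ (k - 1) - c * (2 * x) <= k * y `^ (k - 1) - c * (2 * y).
Proof.
move=> /andP[x0 xM] /andP[y0 yM] xy; have /andP[k1 k2] := k12.
have xy0 : 0 <= x / y by rewrite divr_ge0 ?ltW.
have := @powR_le_tangent (k - 1) (x / y) _ xy0.
have -> : 0 < k - 1 <= 1 by lra.
move=> /(_ isT); rewrite powRM ?invr_ge0 ?(ltW x0) ?(ltW y0)// powRV ?(ltW y0)//.
have py := powR_gt0 (k - 1) y0.
rewrite ler_pdivrMr// => h.
have yE : y `^ (k - 1) = y `^ (k - 2) * y.
  by rewrite mulrC -[k - 2](_ : (k - 1) - 1 = _) ?mulr_powRB1 ?ltW//; lra.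
have hM : M `^ (k - 2) <= y `^ (k - 2).
  rewrite -[k - 2]opprB 2!powRN lef_pV2 ?posrE ?powR_gt0//.
  by apply: ge0_ler_powR; rewrite ?nnegrE; lra.
have h2 : x `^ (k - 1) <= y `^ (k - 1) - (k - 1) * (y `^ (k - 2) * (y - x)).
  apply: le_trans h _; rewrite yE le_eqVlt; apply/orP; left; apply/eqP.
  by field; rewrite gt_eqF.
have h3 : M `^ (k - 2) * (y - x) <= y `^ (k - 2) * (y - x).
  by apply: ler_wpM2r => //; lra.
have h4 : (k - 1) * (M `^ (k - 2) * (y - x)) <= (k - 1) * (y `^ (k - 2) * (y - x)).
  by apply: ler_wpM2l => //; lra.
have h5 : k * ((k - 1) * (M `^ (k - 2) * (y - x))) <=
    k * (y `^ (k - 1) - x `^ (k - 1)).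
  by apply: ler_wpM2l; lra.
have -> : k * x `^ (k - 1) - c * (2 * x) = k * x `^ (k - 1) +
   k * ((k - 1) * (M `^ (k - 2) * (y - x))) - c * (2 * y).
  by rewrite /c; field.
by rewrite mulrBr in h5; lra.
Qed.

(** Convexity of [x^k - c x^2], through the mean value theorem and the monotone derivative; the
    endpoint 0 is added in [bregman_power_ge0]. *)
Let bregman_power_gt0 a b : 0 < a <= M -> 0 < b <= M ->
  a `^ k + k * a `^ (k - 1) * (b - a) + c * (b - a) ^+ 2 <= b `^ k.
Proof.
move=> aM bM; pose f x := x `^ k - c * x ^+ 2.
pose df x := k * x `^ (k - 1) - c * (2 * x).
have dfE x : 0 < x -> is_derive x 1 f (df x).
  move=> x0.
  have -> : df x = k * x `^ (k - 1) - c *: ((2%:R * x ^+ 1) *: 1).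
    by rewrite /df /GRing.scale/= expr1 mulr1.
  exact: (is_deriveB (is_derive1_powR k x0)
    (is_deriveZ c (is_deriveX 2 (is_derive_id x 1)))).
have cf u v : 0 < u -> {within `[u, v], continuous f}.
  move=> u0; apply: derivable_within_continuous => x; rewrite in_itv/= => /andP[ux _].
  by have [] := dfE x (lt_le_trans u0 ux).
suff h : f a + df a * (b - a) <= f b.
  rewrite /f /df in h; set Pa := a `^ k in h *; set Pb := b `^ k in h *.
  set Qa := a `^ (k - 1) in h *; nra.
have /andP[a0 aM'] := aM; have /andP[b0 bM'] := bM.
have [ab|ba|->] := ltgtP a b.
- have dab x : x \in `]a, b[ -> is_derive x 1 f (df x).
    by rewrite in_itv/= => /andP[ax _]; apply: dfE; exact: lt_trans ax.
  have [x] := MVT ab dab (cf _ _ a0).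
  rewrite in_itv/= => /andP[ax xb] E.
  have : df a <= df x by apply: pow_deriv_diff; rewrite ?(ltW ax)//; lra.
  by move=> h; nra.
- have dba x : x \in `]b, a[ -> is_derive x 1 f (df x).
    by rewrite in_itv/= => /andP[ax _]; apply: dfE; exact: lt_trans ax.
  have [x] := MVT ba dba (cf _ _ b0).
  rewrite in_itv/= => /andP[ax xb] E.
  have : df x <= df a by apply: pow_deriv_diff; rewrite ?(ltW xb)//; lra.
  by move=> h; nra.
- by rewrite subrr mulr0 addr0.
Qed.

Let Mpow_le a : 0 < a <= M -> M `^ (k - 2) * a ^+ 2 <= a `^ k.
Proof.
move=> /andP[a0 aM]; have /andP[k1 k2] := k12.
have -> : a `^ k = a `^ (k - 2) * a ^+ 2.
  rewrite -powR_mulrn ?(ltW a0)// -powRD ?subrK//.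
  by rewrite (gt_eqF a0) implybT.
apply: ler_wpM2r; first exact: sqr_ge0.
rewrite -[k - 2]opprB 2!powRN lef_pV2 ?posrE ?powR_gt0//.
by apply: ge0_ler_powR; rewrite ?nnegrE; lra.
Qed.

Let bregman_power_ge0 a b : 0 <= a <= M -> 0 <= b <= M ->
  a `^ k + k * a `^ (k - 1) * (b - a) + c * (b - a) ^+ 2 <= b `^ k.
Proof.
move=> /andP[a0 aM] /andP[b0 bM]; have /andP[k1 k2] := k12.
have k0 : k != 0 by rewrite gt_eqF//; lra.
have k10 : k - 1 != 0 by rewrite gt_eqF//; lra.
rewrite le_eqVlt in a0; rewrite le_eqVlt in b0.
move: a0 b0 => /predU1P[<-|a0] /predU1P[<-|b0].
- by rewrite !powR0//; lra.
- rewrite !powR0// subr0 mulr0 mul0r !add0r.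
  have := @Mpow_le b; rewrite b0 bM => /(_ isT).
  have : 0 <= M `^ (k - 2) * b ^+ 2 by rewrite mulr_ge0 ?sqr_ge0 ?ltW.
  have kk : k * (k - 1) / 2 <= 1 by nra.
  move=> h0 h1; apply: le_trans h1; rewrite /c -mulrA.
  by apply: ler_piMl.
- rewrite (@powR0 _ k)//.
  have := @Mpow_le a; rewrite a0 aM => /(_ isT).
  have : 0 <= M `^ (k - 2) * a ^+ 2 by rewrite mulr_ge0 ?sqr_ge0 ?ltW.
  have := mulr_powRB1 (ltW a0) (lt_trans ltr01 k1).
  rewrite sub0r sqrrN /c -mulrA => <-.
  set u := M `^ _ * a ^+ 2; set v := a `^ (k - 1) => h1 h2.
  have : (k - 1) * (k / 2 * u) <= (k - 1) * (a * v).
    by apply: ler_wpM2l; nra.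
  by rewrite -[_ * _ * a ^+ 2]mulrA -/u; nra.
- by apply: bregman_power_gt0; apply/andP.
Qed.

(* The second derivative of |.|^k is at least k (k - 1) M^(k - 2) on [-M, M]. *)
Lemma bregman_power a b : `|a| <= M -> `|b| <= M ->
  `|a| `^ k + k * spow k a * (b - a) + c * (b - a) ^+ 2 <= `|b| `^ k.
Proof.
have /andP[k1 k2] := k12.
wlog a0 : a b / 0 <= a => [wl|] aM bM.
  have [/wl|a0] := leP 0 a; first exact.
  have := @wl (- a) (- b); rewrite oppr_ge0 !normrN ltW// => /(_ isT aM bM).
  rewrite spowN; apply: le_trans; rewrite le_eqVlt; apply/orP; left; apply/eqP.
  by ring.
rewrite spow_ge0// ger0_norm//.
have aM' : 0 <= a <= M by rewrite a0 -(ger0_norm a0).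
have := @bregman_power_ge0 a `|b| aM'; rewrite normr_ge0 bM => /(_ isT).
apply: le_trans; have [b0|b0] := leP 0 b; first by rewrite (ger0_norm b0).
rewrite (ltr0_norm b0).
(* For [b < 0 <= a], passing from [|b|] to [b] raises the quadratic term by
   [2 k (k - 1) M^(k - 2) a |b|] and lowers the linear one by [2 k a^(k - 1) |b|], so that [h2]
   suffices. *)
have h : M `^ (k - 2) * a <= a `^ (k - 1).
  have := a0; rewrite le_eqVlt => /predU1P[<-|a0'].
    by rewrite mulr0 powR_ge0.
  have := @Mpow_le a; rewrite a0' (andP aM').2 => /(_ isT).
  rewrite -(mulr_powRB1 a0 (lt_trans ltr01 k1)) expr2 mulrA [leRHS]mulrC.
  by rewrite ler_pM2r.
have h1 : 0 <= M `^ (k - 2) * a by rewrite mulr_ge0// ltW.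
have h2 : (k - 1) * (M `^ (k - 2) * a) <= a `^ (k - 1).
  by apply: le_trans h; nra.
have h3 : (k * - b) * ((k - 1) * (M `^ (k - 2) * a)) <= (k * - b) * a `^ (k - 1).
  by apply: ler_wpM2l => //; nra.
rewrite /c; set u := M `^ _ in h3 *; set v := a `^ (k - 1) in h3 *.
by nra.
Qed.

End bregman_power.

End powers.

Section lp_norm.
Context {R : realType} {n : nat}.
Variable k : R.
Hypothesis k12 : 1 < k <= 2.
Implicit Types x y : 'rV[R]_n.

Let k1 : 1 < k. Proof. by case/andP: k12. Qed.
Let kle2 : k <= 2. Proof. by case/andP: k12. Qed.
Let k0 : 0 < k. Proof. exact: lt_trans k1. Qed.
Let kn0 : k != 0. Proof. by rewrite gt_eqF. Qed.

Definition powsum x : R := \sum_i `|x 0 i| `^ k.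

Lemma powsum_ge0 x : 0 <= powsum x.
Proof. by apply: sumr_ge0 => i _; exact: powR_ge0. Qed.

Lemma lpnorm_ge0 x : 0 <= lpnorm k x.
Proof. exact: powR_ge0. Qed.

Lemma lpnorm_powR x : lpnorm k x `^ k = powsum x.
Proof. by rewrite -powRrM mulVf// powRr1// powsum_ge0. Qed.

Lemma lpnormN x : lpnorm k (- x) = lpnorm k x.
Proof. by congr powR; apply: eq_bigr => i _; rewrite mxE normrN. Qed.

Section abstract_norm.
Variable N : 'rV[R]_n -> R.
Hypotheses (N_ge0 : forall x, 0 <= N x) (N_powR : forall x, N x `^ k = powsum x)
  (N_opp : forall x, N (- x) = N x).

(** The gradient of [N^2 / 2]. [N] stands for [lpnorm k], and the argument uses no other property of
    it than the three hypotheses. *)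
Let gN x : 'rV[R]_n := \row_i (N x `^ (2 - k) * spow k (x 0 i)).

Let N_powsum x : N x = powsum x `^ k^-1.
Proof. by rewrite -N_powR -powRrM divff// powRr1. Qed.

Let powsum_powR x q : powsum x `^ q = N x `^ (k * q).
Proof. by rewrite -N_powR powRrM. Qed.

Let N_sqr_powR x : N x `^ (2 - k) * N x `^ k = N x ^+ 2.
Proof.
by rewrite -powRD ?subrK ?powR_mulrn ?N_ge0// pnatr_eq0 implyFb.
Qed.

Let dotv_gN_self x : dotv (gN x) x = N x ^+ 2.
Proof.
rewrite -N_sqr_powR N_powR mulr_sumr; apply: eq_bigr => i _.
by rewrite mxE -mulrA spow_mul.
Qed.

(** Hoelder's inequality with exponents [k / (k - 1)] and [k]; the dual norm of [gN x] is [N x]. *)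
Let dotv_gN_le x y : dotv (gN x) y <= N x * N y.
Proof.
have k1' := k1.
have [x0|x0] := eqVneq (N x) 0.
  rewrite x0 mul0r /dotv big1// => i _.
  have /eqP := powsum_powR x 1; rewrite x0 mulr1 powR0// powRr1 ?powsum_ge0//.
  rewrite psumr_eq0 => [/allP/(_ i (mem_index_enum _))/=|j _]; last exact: powR_ge0.
  rewrite powR_eq0 kn0 andbT normr_eq0 => /eqP xi0.
  by rewrite mxE xi0 /spow sgr0 mul0r mulr0 mul0r.
have Nx0 : 0 < N x by rewrite lt0r x0 N_ge0.
have r01 : 0 < (k - 1) / k < 1.
  by rewrite divr_gt0 ?subr_gt0// ltr_pdivrMr// mul1r; lra.
have := hoelder_sum r01 (fun i => powR_ge0 `|x 0 i| k) (fun i => powR_ge0 `|y 0 i| k).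
rewrite -!/(powsum _) !powsum_powR.
have e1 : k * ((k - 1) / k) = k - 1 by field.
have e2 : k * (1 - (k - 1) / k) = 1 by field.
rewrite e1 e2.
have -> : N y `^ 1 = N y by apply: powRr1; exact: N_ge0.
move=> h.
apply: (@le_trans _ _ (N x `^ (2 - k) *
    \sum_i (`|x 0 i| `^ (k - 1) * `|y 0 i|))).
  rewrite mulr_sumr; apply: ler_sum => i _; rewrite mxE -mulrA.
  apply: ler_wpM2l; first exact: powR_ge0.
  by rewrite -norm_spow// -normrM ler_norm.
have -> : N x * N y =
    N x `^ (2 - k) * (N x `^ (k - 1) * N y).
  rewrite mulrA -powRD ?x0 ?implybT//.
  by rewrite (_ : 2 - k + (k - 1) = 1) ?powRr1 ?N_ge0//; ring.
apply: ler_wpM2l; first exact: powR_ge0.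
apply: le_trans h; rewrite le_eqVlt; apply/orP; left; apply/eqP.
by apply: eq_bigr => i _; rewrite -!powRrM e1 e2 powRr1.
Qed.

Let ND x y : N (x + y) <= N x + N y.
Proof.
have := dotv_gN_self (x + y); rewrite dotvDr.
have hx := dotv_gN_le (x + y) x; have hy := dotv_gN_le (x + y) y.
have [->|n0 E] := eqVneq (N (x + y)) 0.
  by rewrite addr_ge0 ?N_ge0.
have p : 0 < N (x + y) by rewrite lt0r n0 N_ge0.
rewrite -(ler_pM2l p).
move: hx hy E; set a := N (x + y); set b := N x; set c := N y.
move: a b c => a b c hx hy E.
by lra.
Qed.

(** In coordinate [i], [bregman_power] is applied on the interval of radius [w x y i]; [Q] is the
    quadratic form in [y - x] that results. *)
Let w x y (i : 'I_n) := Num.max `|x 0 i| `|y 0 i|.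
Let Q x y := \sum_i w x y i `^ (k - 2) * (y 0 i - x 0 i) ^+ 2.

Let w0_eq x y i : w x y i = 0 -> x 0 i = 0 /\ y 0 i = 0.
Proof.
move=> h; have : w x y i <= 0 by rewrite h.
by rewrite /w ge_max !normr_le0 => /andP[/eqP -> /eqP ->].
Qed.

Let w_ge0 x y i : 0 <= w x y i. Proof. by rewrite le_max normr_ge0. Qed.

Let powsum_bregman x y : powsum x + k * \sum_i spow k (x 0 i) * (y 0 i - x 0 i) +
  k * (k - 1) / 2 * Q x y <= powsum y.
Proof.
rewrite /powsum /Q !mulr_sumr -!big_split/=; apply: ler_sum => i _.
have [/w0_eq[-> ->]|w0] := eqVneq (w x y i) 0.
  by rewrite subr0 expr0n !mulr0 !addr0.
have wp : 0 < w x y i by rewrite lt0r w0 w_ge0.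
have := @bregman_power _ k _ k12 wp (x 0 i) (y 0 i).
by rewrite !mulrA; apply; rewrite /w le_max lexx ?orbT.
Qed.

(** With [d = y - x], Hoelder's inequality is applied to [|d_i|^k = (w_i^(k - 2) d_i^2)^(k/2)
    (w_i^k)^(1 - k/2)]; for [k = 2] the second exponent degenerates, hence the separate case. The
    sum of the [w_i^k] is at most [powsum x + powsum y], and subadditivity of the power [1/k] brings
    back the two norms. *)
Let N_Q x y : N (y - x) ^+ 2 <=
  Q x y * (N x + N y) `^ (2 - k).
Proof.
have k1' := k1; have k0' := k0; have kle2' := kle2.
have Q0 : 0 <= Q x y.
  by apply: sumr_ge0 => i _; rewrite mulr_ge0 ?powR_ge0 ?sqr_ge0.
have [k2|k2] := eqVneq k 2.
  have -> : N (y - x) ^+ 2 = powsum (y - x).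
    by rewrite -N_powR k2 powR_mulrn ?N_ge0.
  rewrite k2 subrr powRr0 mulr1 le_eqVlt; apply/orP; left; apply/eqP.
  apply: eq_bigr => i _; rewrite !mxE ?k2 subrr powRr0 mul1r.
  by rewrite ?k2 powR_mulrn// real_normK ?num_real.
have r01 : 0 < k / 2 < 1 by rewrite divr_gt0//= ltr_pdivrMr//; lra.
have := hoelder_sum r01 (fun i => mulr_ge0 (powR_ge0 (w x y i) (k - 2))
  (sqr_ge0 (y 0 i - x 0 i))) (fun i => powR_ge0 (w x y i) k).
rewrite -/(Q x y).
have -> : \sum_i (w x y i `^ (k - 2) * (y 0 i - x 0 i) ^+ 2) `^ (k / 2) *
    (w x y i `^ k) `^ (1 - k / 2) = powsum (y - x).
  apply: eq_bigr => i _; rewrite !mxE.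
  have [/[dup] w0 /w0_eq[-> ->]|w0] := eqVneq (w x y i) 0.
    rewrite w0 subr0 normr0 (@powR0 _ k)// expr0n mulr0 powR0 ?mul0r//.
    by rewrite gt_eqF// divr_gt0.
  rewrite powRM ?powR_ge0 ?sqr_ge0// -!powRrM mulrAC -powRD ?w0 ?implybT//.
  have -> : (k - 2) * (k / 2) + k * (1 - k / 2) = 0 by field.
  rewrite powRr0 mul1r -real_normK ?num_real// -powR_mulrn//.
  by rewrite -powRrM; congr powR; field.
move=> h.
have h2 : powsum (y - x) `^ (2 / k) <=
   (Q x y `^ (k / 2) * (\sum_i w x y i `^ k) `^ (1 - k / 2)) `^ (2 / k).
  by apply: powR_le_base h; rewrite ?powsum_ge0// divr_ge0// ltW.
have e1 : k * (2 / k) = 2 by field.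
move: h2; rewrite powsum_powR e1 powR_mulrn ?N_ge0//.
rewrite powRM ?powR_ge0// -!powRrM.
have -> : k / 2 * (2 / k) = 1 by field.
have -> : (1 - k / 2) * (2 / k) = k^-1 * (2 - k) by field.
rewrite powRr1// [X in _ * X]powRrM => h2; apply: le_trans h2 _.
rewrite (N_powsum x) (N_powsum y).
apply: ler_wpM2l; first exact: Q0.
have sumw0 : 0 <= \sum_i w x y i `^ k.
  by apply: sumr_ge0 => i _; exact: powR_ge0.
have ki : 0 < k^-1 <= 1 by rewrite invr_gt0 k0 invf_le1//; lra.
have ki0 : 0 <= k^-1 by rewrite invr_ge0; exact: ltW.
apply: powR_le_base; [by lra|exact: powR_ge0|].
apply: le_trans (powR_subadd ki (powsum_ge0 x) (powsum_ge0 y)).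
apply: (powR_le_base ki0 sumw0).
rewrite /powsum -big_split/=; apply: ler_sum => i _.
by rewrite /w; case: (leP `|x 0 i| `|y 0 i|) => _; rewrite ?lerDr ?lerDl powR_ge0.
Qed.

(* If [N y <= 2 N x], Hoelder turns the coordinatewise second-order
   bound into one in the norm; otherwise [half (N y - N x)^2] suffices. *)
Lemma abstract_norm_sqr_strongly_convex x y : k <= 3 / 2 ->
  2^-1 * N x ^+ 2 + dotv (gN x) (y - x) +
    (k - 1) / 9 * N (y - x) ^+ 2 <= 2^-1 * N y ^+ 2.
Proof.
move=> k32; have k1' : 0 < k - 1 by rewrite subr_gt0.
have k1'' := k1; have k0' := k0; have kle2' := kle2.
have Nx0 := N_ge0 x; have Ny0 := N_ge0 y.
have Nd0 := N_ge0 (y - x).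
have [yx|yx] := leP (N y) (2 * N x); last first.
  have tri : N (y - x) <= N y + N x.
    by rewrite -(N_opp x) ND.
  have d := dotv_gN_le x y.
  rewrite dotvBr dotv_gN_self.
  move: Nx0 Ny0 Nd0 yx tri d; set a := N x; set b := N y.
  set c := N (y - x); set e := dotv _ _ => a0 b0 c0 yx tri d.
  (* Source of the constant 9: here [(b - a)^2 / 2 >= b^2 / 8], while
     [(k - 1) / 9 * c^2 <= (k - 1) / 4 * b^2], and [k - 1 <= 1/2]. *)
  have : c ^+ 2 <= (3 / 2 * b) ^+ 2 by apply: lerXn2r; rewrite ?nnegrE; lra.
  have : (k - 1) / 9 * c ^+ 2 <= 18^-1 * c ^+ 2 by rewrite ler_wpM2r ?sqr_ge0//; lra.
  by nra.
have [x0|x0] := eqVneq (N x) 0.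
  have y0 : N y = 0 by lra.
  have d0 : N (y - x) = 0.
    have : N (y - x) <= N y + N x by rewrite -(N_opp x) ND.
    by lra.
  have := dotv_gN_le x (y - x); rewrite x0 y0 d0; lra.
have Nx : 0 < N x by rewrite lt0r x0.
have Sx : 0 < powsum x by rewrite -N_powR powR_gt0.
have q1 : 1 <= 2 / k by rewrite ler_pdivlMr// mul1r; lra.
(* [N^2] is the power [2 / k] of [powsum], so a tangent at [powsum x] passes from squared norms to
   power sums. *)
have := powR_convex_tangent q1 Sx (powsum_ge0 y).
rewrite !powsum_powR.
have -> : k * (2 / k) = 2 by field.
have -> : k * (2 / k - 1) = 2 - k by field.
rewrite !powR_mulrn// => h1.
have h2 := powsum_bregman x y.
have h3 := N_Q x y.
have Q0 : 0 <= Q x y.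
  by apply: sumr_ge0 => i _; rewrite mulr_ge0 ?powR_ge0 ?sqr_ge0.
have -> : dotv (gN x) (y - x) =
    N x `^ (2 - k) * \sum_i spow k (x 0 i) * (y 0 i - x 0 i).
  by rewrite mulr_sumr; apply: eq_bigr => i _; rewrite !mxE -mulrA.
set T := \sum_i _ in h2 *; set P := N x `^ (2 - k) in h1 *.
have P0 : 0 < P by rewrite powR_gt0.
(* [N x + N y <= 3 N x] and [3^(2 - k) <= 3]. This leaves the coefficient [(k - 1) / 6], more than
   is asked for. *)
have h4 : (N x + N y) `^ (2 - k) <= 3 * P.
  apply: (@le_trans _ _ ((3 * N x) `^ (2 - k))).
    by apply: powR_le_base; lra.
  rewrite powRM// ler_wpM2r ?powR_ge0//.
  by apply: ler1_powR; lra.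
have h5 : N (y - x) ^+ 2 <= Q x y * (3 * P).
  by apply: le_trans h3 _; exact: ler_wpM2l.
have h6 : 2 / k * P * (k * T + k * (k - 1) / 2 * Q x y) <=
    2 / k * P * (powsum y - powsum x).
  by apply: ler_wpM2l; [rewrite mulr_ge0 ?divr_ge0 ?ltW|lra].
have h7 : 2 / k * P * (k * T + k * (k - 1) / 2 * Q x y) =
   2 * (P * T) + (k - 1) * (Q x y * P) by field.
have h8 : (k - 1) * N (y - x) ^+ 2 <= (k - 1) * (Q x y * (3 * P)).
  by apply: ler_wpM2l => //; exact: ltW.
have h9 : 0 <= (k - 1) * N (y - x) ^+ 2 by rewrite mulr_ge0 ?sqr_ge0 ?ltW.
by lra.
Qed.

End abstract_norm.

(* The gradient of half the squared l_k norm. *)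
Definition lpgrad x : 'rV[R]_n :=
  \row_i (lpnorm k x `^ (2 - k) * spow k (x 0 i)).

Lemma lpnorm_sqr_strongly_convex x y : k <= 3 / 2 ->
  2^-1 * lpnorm k x ^+ 2 + dotv (lpgrad x) (y - x) +
    (k - 1) / 9 * lpnorm k (y - x) ^+ 2 <= 2^-1 * lpnorm k y ^+ 2.
Proof.
exact: (abstract_norm_sqr_strongly_convex lpnorm_ge0 lpnorm_powR lpnormN).
Qed.

End lp_norm.

(** * The proximal setup *)

Section subgradient.
Context {R : realType} {n : nat}.
Variables (f : 'rV[R]_n -> R) (G : 'rV[R]_n -> 'rV[R]_n).
Hypothesis subgrad : forall x y, f x + dotv (G x) (y - x) <= f y.
Hypothesis coord_cont : forall x i,
  G (x + h *: delta_mx 0 i) 0 i @[h --> (0 : R)] --> G x 0 i.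

Let step_le x i h : f (x + h *: delta_mx 0 i) - f x <=
  G (x + h *: delta_mx 0 i) 0 i * h.
Proof.
have := subgrad (x + h *: delta_mx 0 i) x.
by rewrite opprD addrA subrr sub0r dotvNr dotvZr dotv_delta; lra.
Qed.

Let step_ge x i h : G x 0 i * h <= f (x + h *: delta_mx 0 i) - f x.
Proof.
have := subgrad x (x + h *: delta_mx 0 i).
by rewrite addrAC subrr add0r dotvZr dotv_delta; lra.
Qed.

(** The difference quotient along axis [i] lies between the [i]-th entries of [G] at the two ends of
    the step. The prox function is thus differentiated from its convexity inequality alone. *)
Lemma grad_subgradient x : grad f x = G x.
Proof.
apply/rowP => i; rewrite mxE; apply: cvg_lim => //.
have /cvgrPdist_le c := @coord_cont x i.
apply/cvgrPdist_le => e e0; rewrite near_withinE; near=> h => h0.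
have : `|G x 0 i - G (x + h *: delta_mx 0 i) 0 i| <= e by near: h; exact: c.
apply: le_trans; rewrite /= (addrC _ x).
have := step_le x i h; have := step_ge x i h.
set D := f _ - f x; set g := G x 0 i; set g' := G (x + _) 0 i => d1 d2.
have -> : h^-1 *: D = D / h by rewrite mulrC.
have [hp|hn] : 0 < h \/ h < 0.
- by move: h0; rewrite neq_lt => /orP[]; [right|left].
- have a1 : g <= D / h by rewrite ler_pdivlMr.
  have a2 : D / h <= g' by rewrite ler_pdivrMr.
  by rewrite distrC [leRHS]distrC !ger0_norm ?subr_ge0 ?lerB// (le_trans a1).
- have a1 : D / h <= g by rewrite ler_ndivrMr.
  have a2 : g' <= D / h by rewrite ler_ndivlMr.
  by rewrite !ger0_norm ?subr_ge0 ?lerB// (le_trans a2).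
Unshelve. all: by end_near.
Qed.

(** If [c = w_i + G_i] were nonzero, a short step along axis [i] against its sign would lower the
    function: by continuity [w_i + G_i] keeps its sign at the end of the step, and the subgradient
    there bounds the change of [f]. *)
Lemma minimizer_subgradient w x :
  is_minimizer (fun v => dotv w v + f v) x -> G x = - w.
Proof.
move=> xmin; apply/rowP => i; rewrite mxE; apply/eqP; rewrite -addr_eq0.
apply/negPn/negP => c0; set c := _ + _ in c0.
have /cvgrPdist_lt/(_ `|c|) := @coord_cont x i; rewrite normr_gt0 => /(_ c0).
move=> /nbhs_ballP[e /= e0 he].
pose h := - Num.sg c * (e / 2).
have hh : `|h| = e / 2.
  by rewrite normrM normrN normr_sg c0 mul1r ger0_norm// divr_ge0// ltW.
have hball : ball 0 e h by rewrite /ball/= sub0r normrN hh; lra.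
have /= := he h hball.
set g' := G (x + _) 0 i => gg.
have := xmin (x + h *: delta_mx 0 i); rewrite /= dotvDr dotvZr dotv_delta => m.
have st := step_le x i h; rewrite -/g' in st.
have : 0 <= (w 0 i + g') * h by lra.
rewrite /h mulNr mulrN oppr_ge0 mulrA pmulr_lle0 ?divr_gt0//.
have cE : `|c| = c * Num.sg c by rewrite mulrC normrEsg.
have e2 : c - (w 0 i + g') = G x 0 i - g' by rewrite /c; ring.
have sc : `|c| - (w 0 i + g') * Num.sg c <= `|G x 0 i - g'|.
  rewrite -e2 {1}cE -mulrBl; apply: le_trans (ler_norm _) _.
  by rewrite normrM normr_sg c0 mulr1.
by lra.
Qed.

End subgradient.

Section convex_quadratic.
Context {R : realType}.

Lemma powR_norm_continuous (c : R) : 0 < c -> continuous (fun a : R => `|a| `^ c).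
Proof.
move=> c0 a; have [->|a0] := eqVneq a 0.
  apply/cvgrPdist_le => e e0; rewrite normr0 powR0 ?gt_eqF//.
  have d0 : 0 < e `^ c^-1 by exact: powR_gt0.
  apply: filterS (@nbhs0_le _ R^o _ d0) => b hb.
  rewrite sub0r normrN ger0_norm ?powR_ge0//.
  apply: le_trans (powR_le_base (ltW c0) (normr_ge0 _) hb) _.
  by rewrite -powRrM mulVf ?gt_eqF// powRr1// ltW.
apply: (@continuous_comp _ _ _ (fun b : R => `|b|) (@powR R ^~ c)).
  exact: norm_continuous.
apply: differentiable_continuous; apply/derivable1_diffP.
by apply: derivable_powR; rewrite in_itv/= andbT normr_gt0.
Qed.

Lemma cvg_powR_norm {T : Type} {F : set_system T} {FF : Filter F} (f : T -> R)
    (l c : R) : 0 < c -> f x @[x --> F] --> l ->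
  `|f x| `^ c @[x --> F] --> `|l| `^ c.
Proof.
move=> c0 fl; apply: (cvg_comp f (fun a : R => `|a| `^ c) fl).
exact: powR_norm_continuous.
Qed.

Lemma cvg_powR_ge0 {T : Type} {F : set_system T} {FF : Filter F} (f : T -> R)
    (l c : R) : 0 < c -> (forall x, 0 <= f x) -> 0 <= l -> f x @[x --> F] --> l ->
  f x `^ c @[x --> F] --> l `^ c.
Proof.
move=> c0 f0 l0 /(cvg_powR_norm c0); rewrite (ger0_norm l0).
by rewrite (_ : (fun x => `|f x| `^ c) = (fun x => f x `^ c))//; apply/funext => x;
  rewrite ger0_norm.
Qed.

(** Splitting into positive and negative parts gives a formula in which continuity at 0 needs no
    case on the sign. *)
Lemma spowE (k a : R) : 1 < k ->
  spow k a = `|(`|a| + a) / 2| `^ (k - 1) - `|(`|a| - a) / 2| `^ (k - 1).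
Proof.
move=> k1; have kn : k - 1 != 0 by rewrite subr_eq0 gt_eqF.
have [a0|a0] := leP 0 a.
  rewrite spow_ge0// (ger0_norm a0) subrr mul0r normr0 powR0// subr0.
  by congr powR; rewrite ger0_norm; lra.
rewrite -(opprK a) spowN spow_ge0 ?oppr_ge0 ?ltW// opprK (ltr0_norm a0).
rewrite addNr mul0r normr0 powR0// sub0r; congr (- powR _ _).
by rewrite ger0_norm; lra.
Qed.

Lemma spow_continuous (k : R) : 1 < k -> continuous (spow k).
Proof.
move=> k1 a; have k0 : 0 < k - 1 by rewrite subr_gt0.
rewrite (_ : spow k = (fun a => `|(`|a| + a) / 2| `^ (k - 1) -
    `|(`|a| - a) / 2| `^ (k - 1))); last by apply/funext => b; exact: spowE.
have nc := @norm_continuous _ R a.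
apply: cvgB.
  apply: (@continuous_comp _ _ _ (fun a : R => (`|a| + a) / 2)
    (fun b : R => `|b| `^ (k - 1))); last exact: powR_norm_continuous.
  by apply: cvgM; [apply: cvgD => //; exact: cvg_id|exact: cvg_cst].
apply: (@continuous_comp _ _ _ (fun a : R => (`|a| - a) / 2)
  (fun b : R => `|b| `^ (k - 1))); last exact: powR_norm_continuous.
by apply: cvgM; [apply: cvgB => //; exact: cvg_id|exact: cvg_cst].
Qed.

End convex_quadratic.

Lemma scaled_strong_convexity (R : realFieldType) (a cx cy g d u q : R) :
  a * (2^-1 * cx + g + (q - 1) / 9 * d) <= a * (2^-1 * cy) ->
  u <= a * (q - 1) * d -> a * (2^-1 * cx) + a * g + 9^-1 * u <= a * (2^-1 * cy).
Proof. lra. Qed.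

Section proximal_setup.
Context {R : realType} {n : nat}.
Hypothesis n8 : (8 <= n)%N.
Implicit Types (x y z v h G : 'rV[R]_n) (p : nat).

Let n_gt0 : 0 < n%:R :> R. Proof. by rewrite ltr0n (leq_trans _ n8). Qed.

Lemma ln_dim_ge2 : 2 <= ln n%:R :> R.
Proof.
have n8' : 8 <= n%:R :> R by rewrite ler_nat.
rewrite -ler_expR lnK ?posrE//; apply: le_trans n8'.
(* The claim is [e^2 <= 8]. From [1 - 1/16 <= e^(-1/16)] follows [e^(1/16) <= 16/15], and five
   squarings, rounded upwards, reach [e^2]. *)
have := @expR_ge1Dx R (- 16^-1); rewrite expRN => h.
have e0 := expR_gt0 (16^-1 : R).
have {h} : expR 16^-1 <= 16 / 15 :> R.
  by have := ler_wpM2r (ltW e0) h; rewrite mulVf ?gt_eqF//; lra.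
have sq (a b : R) : expR a <= b -> expR (a + a) <= b ^+ 2.
  by move=> ab; rewrite expRD -expr2 lerXn2r ?nnegrE ?expR_ge0 ?(le_trans _ ab)// expR_ge0.
move=> /sq; rewrite [_ + _](_ : _ = 8^-1); last by field.
move=> /sq; rewrite [_ + _](_ : _ = 4^-1); last by field.
move=> h; have {h} : expR 4^-1 <= 1296 / 1000 :> R by apply: le_trans h _; lra.
move=> /sq; rewrite [_ + _](_ : _ = 2^-1); last by field.
move=> h; have {h} : expR 2^-1 <= 168 / 100 :> R by apply: le_trans h _; lra.
move=> /sq; rewrite [_ + _](_ : _ = 1); last by field.
move=> h; have {h} : expR 1 <= 2823 / 1000 :> R by apply: le_trans h _; lra.
move=> /sq; rewrite [_ + _](_ : _ = 2); last by field.
by move=> h; apply: le_trans h _; lra.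
Qed.

Let k : R := kappa n.

Lemma kappa_bounds : 1 < k <= 3 / 2.
Proof.
have l2 := ln_dim_ge2; have l0 : 0 < ln n%:R :> R by lra.
rewrite /k /kappa ltrDl invr_gt0 l0/=.
have : (ln n%:R)^-1 <= 2^-1 :> R by rewrite lef_pV2 ?posrE.
by lra.
Qed.

Let k1 : 1 < k. Proof. by case/andP: kappa_bounds. Qed.
Let k32 : k <= 3 / 2. Proof. by case/andP: kappa_bounds. Qed.
Let k0 : 0 < k. Proof. exact: lt_trans k1. Qed.
Let k12 : 1 < k <= 2. Proof. by rewrite k1/= (le_trans k32)//; lra. Qed.

Let A : R := expR 1 * n%:R `^ ((k - 1) * (2 - k) / k) * ln n%:R.

Let l0 : 0 < ln n%:R :> R. Proof. exact: lt_le_trans ln_dim_ge2. Qed.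

Let A_gt0 : 0 < A.
Proof. by rewrite !mulr_gt0 ?expR_gt0 ?powR_gt0. Qed.

Lemma prox1E x : prox 1 x = A * (2^-1 * lpnorm k x ^+ 2).
Proof. by rewrite /prox eqxx /A /k; ring. Qed.

Lemma prox2E x : prox 2 x = 2^-1 * dotv x x.
Proof. by rewrite /prox/= norm2_sqr. Qed.

Definition pgrad p x : 'rV[R]_n := if p == 1%N then A *: lpgrad k x else x.

(* The squares of the dual norm and of the norm itself, for p = 1 and p = 2. *)
Definition dualsq p v : R :=
  if p == 1%N then \big[Num.max/0]_i (v 0 i ^+ 2) else dotv v v.

Definition primsq p v : R :=
  if p == 1%N then (\sum_i `|v 0 i|) ^+ 2 else dotv v v.

Lemma dualsqZ p a v : dualsq p (a *: v) = a ^+ 2 * dualsq p v.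
Proof.
rewrite /dualsq; case: ifP => _; last by rewrite dotvZl dotvZr expr2 mulrA.
rewrite (big_endo ( *%R (a ^+ 2))) ?mulr0//; last first.
  by move=> u w; rewrite maxr_pMr// sqr_ge0.
by apply: eq_bigr => i _; rewrite mxE exprMn.
Qed.

Lemma dualsq_ge0 p v : 0 <= dualsq p v.
Proof.
rewrite /dualsq; case: ifP => _; last exact: dotv_ge0.
by elim/big_ind: _ => // [u w u0 w0|i _]; rewrite ?le_max ?u0// sqr_ge0.
Qed.

Lemma primsqN p v : primsq p (- v) = primsq p v.
Proof.
rewrite /primsq; case: ifP => _; last by rewrite dotvNl dotvNr opprK.
by congr (_ ^+ 2); apply: eq_bigr => i _; rewrite mxE normrN.
Qed.

Lemma dotv_le_primsq p v : dotv v v <= primsq p v.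
Proof.
rewrite /primsq; case: ifP => // _; rewrite expr2 mulr_suml.
apply: ler_sum => i _; rewrite -expr2 -real_normK ?num_real// expr2.
apply: ler_wpM2l => //; rewrite (bigD1 i)//= lerDl.
by apply: sumr_ge0.
Qed.

(** Hoelder's inequality for the two dual norms, then Young's inequality with parameter [c]. *)
Lemma dotv_dual p G h c : 0 < c -> dotv G h <= c * dualsq p G + (4 * c)^-1 * primsq p h.
Proof.
move=> c0.
have sq (a b : R) : a * b <= c * a ^+ 2 + (4 * c)^-1 * b ^+ 2.
  rewrite -subr_ge0.
  have -> : c * a ^+ 2 + (4 * c)^-1 * b ^+ 2 - a * b = c * (a - (2 * c)^-1 * b) ^+ 2.
    by field; rewrite gt_eqF.
  by rewrite mulr_ge0 ?sqr_ge0// ltW.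
rewrite /dualsq /primsq; case: ifP => _; last first.
  rewrite -!norm2_sqr; apply: le_trans (sq _ _).
  exact: le_trans (ler_norm _) (cauchy_schwarz _ _).
set M := \big[_/_]_i _.
have M0 : 0 <= M.
  by rewrite /M; elim/big_ind: _ => // [u w u0 w0|i _]; rewrite ?le_max ?u0// sqr_ge0.
rewrite -(sqr_sqrtr M0); apply: le_trans (sq _ _).
rewrite mulr_sumr; apply: ler_sum => i _.
apply: le_trans (ler_norm _) _; rewrite normrM; apply: ler_wpM2r => //.
by rewrite -sqrtr_sqr ler_wsqrtr// /M; apply: (le_bigmax _ (fun i => G 0 i ^+ 2)).
Qed.

(** The scaling of the prox function is made for this. Hoelder gives
    [||h||_1 <= n^(1 - 1/k) ||h||_k]; as [ln n = 1 / (k - 1)] and [e = n^(k - 1)], the number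
    [A (k - 1)] is exactly the square of [n^(1 - 1/k)]. *)
Let sum_norm_le h : (\sum_i `|h 0 i|) ^+ 2 <= A * (k - 1) * lpnorm k h ^+ 2.
Proof.
have ki : 0 < k^-1 < 1 by rewrite invr_gt0 k0 invf_lt1.
have := hoelder_sum ki (fun i => powR_ge0 `|h 0 i| k) (fun i : 'I_n => ler01 : 0 <= 1 :> R).
under eq_bigr do rewrite powR1 mulr1 -powRrM divff ?gt_eqF// powRr1//.
rewrite sumr_const card_ord -[X in _ <= X]/(lpnorm k h * _) => hh.
have S0 : 0 <= \sum_i `|h 0 i| by apply: sumr_ge0.
have -> : A * (k - 1) = (n%:R `^ (1 - k^-1)) ^+ 2.
  rewrite -powR_mulrn ?powR_ge0// -powRrM.
  have lE : ln n%:R = (k - 1)^-1 by rewrite /k /kappa addrAC subrr add0r invrK.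
  have eE : expR 1 = n%:R `^ (k - 1).
    by rewrite /powR gt_eqF// lE mulfV// subr_eq0 gt_eqF.
  rewrite /A eE lE -powRD ?(gt_eqF n_gt0) ?implybT// mulfVK ?subr_eq0 ?gt_eqF//.
  by congr powR; field; rewrite gt_eqF.
by rewrite -exprMn mulrC lerXn2r ?nnegrE// mulr_ge0 ?powR_ge0.
Qed.

Lemma prox_strongly_convex p x y : p \in [:: 1%N; 2%N] ->
  prox p x + dotv (pgrad p x) (y - x) + 9^-1 * primsq p (y - x) <= prox p y.
Proof.
rewrite !inE => /orP[/eqP ->|/eqP ->]; last first.
  rewrite !prox2E /pgrad /primsq/=.
  rewrite !(dotvBl, dotvBr) (dotvC y x).
  have := dotv_ge0 (x - y); rewrite !(dotvBl, dotvBr) (dotvC y x).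
  by lra.
rewrite !prox1E /pgrad /primsq eqxx dotvZl.
have h := lpnorm_sqr_strongly_convex k12 x y k32.
have s := sum_norm_le (y - x).
exact: scaled_strong_convexity (ler_wpM2l (ltW A_gt0) h) s.
Qed.

Let coord_continuous_step x i j :
  (x + h *: delta_mx 0 i) 0 j @[h --> (0 : R)] --> x 0 j.
Proof.
rewrite (_ : (fun h : R => _) = (fun h : R => x 0 j + h * (j == i)%:R)); last first.
  by apply/funext => h; rewrite !mxE.
rewrite -[X in _ --> X]addr0 -[X in _ + X](mul0r (j == i)%:R).
by apply: cvgD; [exact: cvg_cst|apply: cvgM; [exact: cvg_id|exact: cvg_cst]].
Qed.

Let lpnorm_continuous x i :
  lpnorm k (x + h *: delta_mx 0 i) @[h --> (0 : R)] --> lpnorm k x.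
Proof.
have c : powsum k (x + h *: delta_mx 0 i) @[h --> (0 : R)] --> powsum k x.
  apply: cvg_big => [|j _]; first exact: add_continuous.
  by apply: cvg_powR_norm k0 _; exact: coord_continuous_step.
have ki : 0 < k^-1 by rewrite invr_gt0.
exact: (cvg_powR_ge0 ki (fun=> powsum_ge0 _ _) (powsum_ge0 _ _) c).
Qed.

Lemma pgrad_coord_continuous p x i :
  pgrad p (x + h *: delta_mx 0 i) 0 i @[h --> (0 : R)] --> pgrad p x 0 i.
Proof.
have lin := @coord_continuous_step x i i.
rewrite /pgrad; case: ifP => // _.
have E v : (A *: lpgrad k v) 0 i = A * (lpnorm k v `^ (2 - k) * spow k (v 0 i)).
  by rewrite mxE [lpgrad _ _ _ _]mxE.
rewrite E; under eq_fun do rewrite E.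
apply: cvgM; first exact: cvg_cst.
apply: cvgM; last first.
  apply: (cvg_comp (fun h : R => (x + h *: delta_mx 0 i) 0 i) (spow k) lin).
  exact: spow_continuous.
have k2 : 0 < 2 - k by move: k32; lra.
exact: (cvg_powR_ge0 k2 (fun=> lpnorm_ge0 _ _) (lpnorm_ge0 _ _)
  (@lpnorm_continuous x i)).
Qed.

Lemma prox_subgradient p x y : p \in [:: 1%N; 2%N] ->
  prox p x + dotv (pgrad p x) (y - x) <= prox p y.
Proof.
move=> hp; apply: le_trans (prox_strongly_convex x y hp).
by rewrite lerDl mulr_ge0// (le_trans _ (dotv_le_primsq _ _))// dotv_ge0.
Qed.

Lemma grad_prox p x : p \in [:: 1%N; 2%N] -> grad (@prox R p n) x = pgrad p x.
Proof.
move=> hp; apply: grad_subgradient; first by move=> *; exact: prox_subgradient.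
exact: pgrad_coord_continuous.
Qed.

Lemma primsq_le_bregman p z v : p \in [:: 1%N; 2%N] ->
  9^-1 * primsq p (v - z) <= bregman p z v.
Proof.
move=> hp; have := prox_strongly_convex z v hp.
by rewrite /bregman grad_prox//; lra.
Qed.

Lemma dotv_le_bregman p z v : p \in [:: 1%N; 2%N] ->
  dotv (z - v) (z - v) <= 9 * bregman p z v.
Proof.
move=> hp; have := primsq_le_bregman z v hp; have := dotv_le_primsq p (v - z).
by rewrite -[z - v]opprB dotvNl dotvNr opprK; lra.
Qed.

Lemma bregman_ge0 p z v : p \in [:: 1%N; 2%N] -> 0 <= bregman p z v.
Proof.
by move=> hp; have := dotv_le_bregman z v hp; have := dotv_ge0 (z - v); lra.
Qed.

Section mirror_step.
Variables (p : nat) (hp : p \in [:: 1%N; 2%N]) (b : R) (G z z' : 'rV[R]_n).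
Hypothesis zmin : is_minimizer (fun v => b * dotv G (v - z) + bregman p z v) z'.

(** The optimality condition of the mirror step. Besides the descent inequality it yields the
    measurability of [z], since its right-hand side is explicit. *)
Lemma mirror_pgrad : pgrad p z' = pgrad p z - b *: G.
Proof.
have -> : pgrad p z' = - (b *: G - pgrad p z).
  apply: (@minimizer_subgradient _ _ (@prox R p n)).
  - by move=> *; exact: prox_subgradient.
  - exact: pgrad_coord_continuous.
  move=> v; have := zmin v; rewrite /= /bregman grad_prox//.
  by rewrite !dotvBr !dotvBl !dotvZl; lra.
by rewrite opprB.
Qed.

(** The part [b <G, z' - v>] is settled by the three-point identity. For [b <G, z - z'>], Young's
    constant [9/4] leaves [1/9] of the squared norm of [z - z'], which is what [primsq_le_bregman]
    pays. *)
Lemma mirror_descent v : b * dotv G (z - v) <=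
  bregman p z v - bregman p z' v + 9 / 4 * b ^+ 2 * dualsq p G.
Proof.
have := primsq_le_bregman z z' hp.
have := @dotv_dual p (b *: G) (z - z') (9 / 4); rewrite divr_gt0// => /(_ isT).
have -> : 4 * (9 / 4) = 9 :> R by field.
rewrite -[z - z']opprB primsqN dotvNr dualsqZ dotvZl.
rewrite /bregman !grad_prox// mirror_pgrad !dotvBr !dotvBl !dotvZl.
by lra.
Qed.

End mirror_step.
End proximal_setup.

(** * Measurability of the proximal setup *)

Section spow_inverse.
Context {R : realType}.
Implicit Types a x k c : R.

Lemma spowMl c a x : 0 < a -> spow c (a * x) = a `^ (c - 1) * spow c x.
Proof.
move=> a0; rewrite /spow sgrM gtr0_sg// mul1r normrM gtr0_norm//.
by rewrite powRM ?(ltW a0)// mulrCA.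
Qed.

Lemma spow_spow k c x : 1 < k -> (c - 1) * (k - 1) = 1 -> spow c (spow k x) = x.
Proof.
move=> k1 ck; have [->|x0] := eqVneq x 0.
  by rewrite /spow sgr0 mul0r sgr0 mul0r.
rewrite {1}/spow norm_spow// -powRrM mulrC mulrC [(k - 1) * _]mulrC ck powRr1//.
rewrite /spow sgrM (@gtr0_sg _ (_ `^ _)) ?powR_gt0 ?normr_gt0// mulr1.
by rewrite sgr_id -numEsg.
Qed.

Lemma measurable_spow c : 1 < c -> measurable_fun setT (spow c).
Proof. by move=> c1; apply: continuous_measurable_fun; exact: spow_continuous. Qed.

End spow_inverse.

Section prox_measurable.
Context {R : realType} {n : nat}.
Hypothesis n8 : (8 <= n)%N.
Implicit Types (x : 'rV[R]_n) (p : nat).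

Let k : R := kappa n.
Let k1 : 1 < k. Proof. by have /andP[] := @kappa_bounds R n n8. Qed.
Let k12 : 1 < k <= 2.
Proof. by have /andP[a b] := @kappa_bounds R n n8; rewrite a (le_trans b)//; lra. Qed.
Let km : k - 1 != 0. Proof. by rewrite subr_eq0 gt_eqF. Qed.
Let k0 : 0 < k. Proof. exact: lt_trans k1. Qed.

(** The gradient of half the squared norm with the conjugate exponent [k / (k - 1)]; convex duality
    makes it inverse to [lpgrad k]. *)
Let lpgrad_inv (g : 'rV[R]_n) : 'rV[R]_n := \row_i (spow (1 + (k - 1)^-1) (g 0 i) *
  (\sum_j `|g 0 j| `^ (k / (k - 1))) `^ ((k - 2) / k)).

Let abstract_lpgradK (N : R) x : 0 <= N -> N `^ k = \sum_i `|x 0 i| `^ k ->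
  lpgrad_inv (\row_i (N `^ (2 - k) * spow k (x 0 i))) = x.
Proof.
move=> N0 NE; apply/rowP => i; rewrite !mxE.
have [N00|Nn0] := eqVneq N 0.
  have : \sum_i `|x 0 i| `^ k = 0 by rewrite -NE N00 powR0// gt_eqF.
  move/eqP; rewrite psumr_eq0 => [/allP/(_ i (mem_index_enum _))/=|j _]; last exact: powR_ge0.
  rewrite powR_eq0 (gt_eqF k0) andbT normr_eq0 => /eqP ->.
  by rewrite /spow sgr0 mul0r mulr0 sgr0 !mul0r.
have Np : 0 < N by rewrite lt0r Nn0.
have -> : \sum_j `|(\row_i (N `^ (2 - k) * spow k (x 0 i))) 0 j| `^ (k / (k - 1)) =
    N `^ (k / (k - 1)).
  transitivity (N `^ ((2 - k) * (k / (k - 1))) * N `^ k); last first.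
    by rewrite -powRD ?Nn0 ?implybT//; congr powR; field.
  rewrite NE mulr_sumr; apply: eq_bigr => j _; rewrite mxE normrM norm_spow//.
  rewrite powRM ?normr_ge0 ?powR_ge0// (ger0_norm (powR_ge0 _ _)) -!powRrM.
  by congr (_ * powR _ _); field.
rewrite spowMl ?powR_gt0// spow_spow//; last by field.
rewrite -!powRrM mulrAC -powRD ?Nn0 ?implybT//.
have -> : (2 - k) * (1 + (k - 1)^-1 - 1) + k / (k - 1) * ((k - 2) / k) = 0.
  by field; rewrite gt_eqF.
by rewrite powRr0 mul1r.
Qed.

Let measurable_lpgrad_inv : measurable_fun setT lpgrad_inv.
Proof.
apply: measurable_fun_rV => i; under eq_fun do rewrite mxE.
apply: measurable_funM.
  apply: (measurableT_comp (measurable_spow _)); last exact: measurable_coord.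
  by rewrite ltrDl invr_gt0 subr_gt0.
apply: (measurableT_comp (measurable_powR _)); apply: measurable_sum => j.
apply: (measurableT_comp (measurable_powR _)).
by apply: measurableT_comp; [exact: normr_measurable|exact: measurable_coord].
Qed.

(** Recovers [z], given only as a minimizer, measurably from its mirror image [pgrad p z]. *)
Lemma pgrad_measurable_inverse p : exists2 J : 'rV[R]_n -> 'rV[R]_n,
  measurable_fun setT J & forall x, J (pgrad p x) = x.
Proof.
rewrite /pgrad; case: (p == 1%N); last by exists id.
set a : R := expR 1 * n%:R `^ ((kappa n - 1) * (2 - kappa n) / kappa n) * ln n%:R; have a0 : a != 0.
  have l2 := @ln_dim_ge2 R n n8.
  rewrite gt_eqF// /a !mulr_gt0 ?expR_gt0 ?powR_gt0 ?ltr0n ?(leq_trans _ n8)//.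
  by lra.
exists (fun u => lpgrad_inv (a^-1 *: u)).
  apply: measurableT_comp measurable_lpgrad_inv _.
  by apply: measurable_fun_scalev; [exact: measurable_cst|exact: measurable_id].
move=> x; rewrite scalerA mulVf// scale1r.
by apply: abstract_lpgradK; [exact: lpnorm_ge0|exact: (lpnorm_powR k12)].
Qed.

Lemma measurable_prox p : measurable_fun setT (@prox R p n).
Proof.
rewrite /prox; case: (p == 1%N); apply: measurable_funM => //;
  apply: measurable_funX.
  apply: (measurableT_comp (measurable_powR _)); apply: measurable_sum => j.
  apply: (measurableT_comp (measurable_powR _)).
  by apply: measurableT_comp; [exact: normr_measurable|exact: measurable_coord].
apply: (measurableT_comp (f := @Num.sqrt R)); last exact: measurable_fun_dotv.
by apply: continuous_measurable_fun; exact: sqrt_continuous.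
Qed.

End prox_measurable.

(** * Real-valued expectations *)

Section real_expectation.
Context {d} {T : measurableType d} {R : realType} (P : probability T R).
Implicit Types f g : T -> R.

Definition rint f := P.-integrable setT (EFin \o f).

(** Real-valued, so that expectations enter linear arithmetic. It is meaningful together with
    [rint f], since an infinite integral is sent to 0. *)
Definition Er f : R := \int[P]_x f x.

Lemma ErE f : rint f -> (Er f)%:E = (\int[P]_x (f x)%:E)%E.
Proof. by move=> /integrable_fin_num fin; rewrite /Er fineK// fin. Qed.

Lemma rint_measurable f : rint f -> measurable_fun setT f.
Proof. by move=> /measurable_int/measurable_EFinP. Qed.

Lemma rint_cst c : rint (fun=> c).
Proof. exact: finite_measure_integrable_cst. Qed.

Lemma rintD f g : rint f -> rint g -> rint (fun x => f x + g x).
Proof. by move=> rf rg; exact: (integrableD measurableT rf rg). Qed.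

Lemma rintB f g : rint f -> rint g -> rint (fun x => f x - g x).
Proof. by move=> rf rg; exact: (integrableB measurableT rf rg). Qed.

Lemma rintZ c f : rint f -> rint (fun x => c * f x).
Proof. by move=> rf; exact: (integrableZl measurableT c rf). Qed.

Lemma rint_sum I (s : seq I) (h : I -> T -> R) : (forall i, rint (h i)) ->
  rint (fun x => \sum_(i <- s) h i x).
Proof.
move=> rh; elim: s => [|i s ih].
  by under eq_fun do rewrite big_nil; exact: rint_cst.
by under eq_fun do rewrite big_cons; exact: rintD.
Qed.

Lemma ErD f g : rint f -> rint g -> Er (fun x => f x + g x) = Er f + Er g.
Proof. exact: RintegralD. Qed.

Lemma ErB f g : rint f -> rint g -> Er (fun x => f x - g x) = Er f - Er g.
Proof. exact: RintegralB. Qed.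

Lemma ErZ c f : rint f -> Er (fun x => c * f x) = c * Er f.
Proof. exact: RintegralZl. Qed.

Lemma Er_cst c : Er (fun=> c) = c.
Proof. by rewrite /Er Rintegral_cst//= probability_setT mulr1. Qed.

Lemma Er_sum I (s : seq I) (h : I -> T -> R) : (forall i, rint (h i)) ->
  Er (fun x => \sum_(i <- s) h i x) = \sum_(i <- s) Er (h i).
Proof.
move=> rh; elim: s => [|i s ih].
  by under eq_fun do rewrite big_nil; rewrite Er_cst big_nil.
under eq_fun do rewrite big_cons; rewrite big_cons ErD// ?ih//.
exact: rint_sum.
Qed.

Lemma Er_ge0 f : (forall x, 0 <= f x) -> 0 <= Er f.
Proof. by move=> f0; exact: Rintegral_ge0. Qed.

Lemma Er_ae_eq f g : measurable_fun setT f -> measurable_fun setT g ->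
  {ae P, forall x, f x = g x} -> Er f = Er g.
Proof.
move=> mf mg fg; rewrite /Er /Rintegral; congr fine.
apply: ae_eq_integral; [by []|exact/measurable_EFinP|exact/measurable_EFinP|].
by apply: filterS fg => x /= ->.
Qed.

Lemma rint_ae_le f g : measurable_fun setT f -> rint g ->
  {ae P, forall x, `|f x| <= g x} -> rint f.
Proof.
move=> mf rg fg; have mg := rint_measurable rg.
apply/integrableP; split; first exact/measurable_EFinP.
have /integrableP[_] := rg; apply: le_lt_trans.
apply: ae_ge0_le_integral => //.
- by apply/measurable_EFinP; apply: measurableT_comp => //.
- by apply/measurable_EFinP; apply: measurableT_comp => //.
apply: filterS fg => x fgx _ /=; rewrite lee_fin.
by rewrite (le_trans fgx)// ler_norm.
Qed.

Lemma rint_le f g : measurable_fun setT f -> rint g ->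
  (forall x, `|f x| <= g x) -> rint f.
Proof. by move=> mf rg fg; apply: (rint_ae_le mf rg); exact: aeW. Qed.

Lemma Er_ae_le f g : rint f -> rint g -> {ae P, forall x, f x <= g x} -> Er f <= Er g.
Proof.
move=> rf rg fg; rewrite -subr_ge0 -ErB//.
have mh : measurable_fun setT (fun x => g x - f x) by exact/rint_measurable/rintB.
rewrite (@Er_ae_eq _ (fun x => `|g x - f x|)) ?Er_ge0//.
  exact: measurableT_comp.
by apply: filterS fg => x fgx; rewrite ger0_norm// subr_ge0.
Qed.

Lemma Er_le f g : rint f -> rint g -> (forall x, f x <= g x) -> Er f <= Er g.
Proof. by move=> rf rg fg; apply: Er_ae_le => //; exact: aeW. Qed.

Lemma rint_norm f : rint f -> rint (fun x => `|f x|).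
Proof.
move=> rf; apply/integrableP; split.
  by apply/measurable_EFinP/measurableT_comp => //; exact: rint_measurable.
have /integrableP[_] := rf; apply: le_lt_trans; rewrite le_eqVlt; apply/orP; left.
by apply/eqP/eq_integral => x _ /=; rewrite normr_id.
Qed.

Lemma rint_fin f : measurable_fun setT f -> (forall x, 0 <= f x) ->
  (\int[P]_x (f x)%:E < +oo)%E -> rint f.
Proof.
move=> mf f0 fi; apply/integrableP; split; first exact/measurable_EFinP.
by under eq_integral do rewrite /= ger0_norm ?f0//.
Qed.

Lemma Er_le_fin f c : measurable_fun setT f -> (forall x, 0 <= f x) ->
  (\int[P]_x (f x)%:E <= c%:E)%E -> rint f /\ Er f <= c.
Proof.
move=> mf f0 fc; have rf : rint f.
  by apply: rint_fin => //; apply: le_lt_trans fc _; rewrite ltry.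
by split=> //; rewrite -lee_fin ErE.
Qed.

Lemma rintM f g : measurable_fun setT f -> measurable_fun setT g ->
  rint (fun x => f x ^+ 2) -> rint (fun x => g x ^+ 2) -> rint (fun x => f x * g x).
Proof.
move=> mf mg rf rg; apply: (@rint_le _ (fun x => f x ^+ 2 + g x ^+ 2)).
- exact: measurable_funM.
- exact: rintD.
move=> x; rewrite -(real_normK (num_real (f x))) -(real_normK (num_real (g x))) normrM.
by have := sqr_ge0 (`|f x| - `|g x|); have := normr_ge0 (f x); have := normr_ge0 (g x); nra.
Qed.

Lemma rint_sqrD f g : measurable_fun setT f -> measurable_fun setT g ->
  rint (fun x => f x ^+ 2) -> rint (fun x => g x ^+ 2) -> rint (fun x => (f x + g x) ^+ 2).
Proof.
move=> mf mg rf rg.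
apply: (@rint_le _ (fun x => 2 * f x ^+ 2 + 2 * g x ^+ 2)).
- by apply: measurable_funX; exact: measurable_funD.
- by apply: rintD; exact: rintZ.
move=> x; rewrite ger0_norm ?sqr_ge0//.
by have := sqr_ge0 (f x - g x); nra.
Qed.

Lemma rint_sqr f : measurable_fun setT f -> rint (fun x => f x ^+ 2) -> rint f.
Proof.
move=> mf rf; apply: (@rint_le _ (fun x => f x ^+ 2 + 1)) => //.
  by apply: rintD => //; exact: rint_cst.
move=> x; rewrite -(real_normK (num_real (f x))).
by have := sqr_ge0 (`|f x| - 1); nra.
Qed.

(** Jensen's inequality, from the tangent of the square at [Er f]. *)
Lemma Er_sqr_le f c : 0 <= c -> measurable_fun setT f -> rint (fun x => f x ^+ 2) ->
  Er (fun x => f x ^+ 2) <= c ^+ 2 -> Er f <= c.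
Proof.
move=> c0 mf rf Ec; have rf1 := rint_sqr mf rf.
have rs : rint (fun x => f x ^+ 2 - Er f ^+ 2) by apply: rintB => //; exact: rint_cst.
have r2 : rint (fun x => 2 * Er f * (f x - Er f)).
  by apply: rintZ; apply: rintB => //; exact: rint_cst.
have : Er (fun x => 2 * Er f * (f x - Er f)) <= Er (fun x => f x ^+ 2 - Er f ^+ 2).
  by apply: Er_le => // x; have := sqr_ge0 (f x - Er f); nra.
rewrite ErZ ?ErB ?Er_cst ?subrr ?mulr0 ?subr_ge0//; try exact: rint_cst.
  move=> h; have {h} : Er f ^+ 2 <= c ^+ 2 by exact: le_trans h Ec.
  by have [//|cE] := leP (Er f) c; nra.
by apply: rintB => //; exact: rint_cst.
Qed.

End real_expectation.

(** * The uniform distribution on the sphere *)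

Section reflection.
Context {R : realType} {n : nat}.
Implicit Types u v w : 'rV[R]_n.

(** Householder reflection. All orthogonal maps used below are of this kind: [w = e_i] flips a sign,
    [w = e_i - e_j] transposes two coordinates, [w = a - b] exchanges the unit vectors [a] and
    [b]. *)
Definition reflect w v := v - (2 / dotv w w * dotv v w) *: w.

Let reflect_mx w : 'M[R]_n := 1%:M - (2 / dotv w w) *: (w^T *m w).

Let mul_trmx u v : u *m v^T = (dotv u v)%:M.
Proof.
apply/matrixP => i j; rewrite !ord1 !mxE mulr1n.
by apply: eq_bigr => l _; rewrite mxE.
Qed.

Let mulmx_reflect w v : v *m reflect_mx w = reflect w v.
Proof.
rewrite /reflect_mx mulmxBr mulmx1 -scalemxAr mulmxA mul_trmx mul_scalar_mx.
by rewrite scalerA.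
Qed.

Lemma dotv_reflect w v : 0 < dotv w w -> dotv (reflect w v) (reflect w v) = dotv v v.
Proof.
move=> w0; rewrite !(dotvBl, dotvBr, dotvZl, dotvZr) (dotvC w v).
by field; rewrite gt_eqF.
Qed.

Lemma measurable_reflect w : measurable_fun setT (reflect w).
Proof.
apply: measurable_fun_subv; first exact: measurable_id.
apply: measurable_fun_scalev => //; apply: measurable_funM => //.
by apply: measurable_fun_dotv => //; exact: measurable_id.
Qed.

Lemma reflect_preserves (mu : set 'rV[R]_n -> \bar R) w A : 0 < dotv w w ->
  uniform_on_sphere mu -> measurable A -> mu (reflect w @^-1` A) = mu A.
Proof.
move=> w0 [_ inv] mA; rewrite -[in RHS](inv (reflect_mx w))//.
  by congr (mu _); apply/seteqP; split => v; rewrite /preimage/= mulmx_reflect.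
set M := w^T *m w; set c := 2 / dotv w w.
have MM : M *m M = dotv w w *: M.
  by rewrite mulmxA -[M *m w^T]mulmxA mul_trmx mul_mx_scalar -scalemxAl.
have HT : (reflect_mx w)^T = reflect_mx w.
  by rewrite /reflect_mx linearB/= trmx1 linearZ/= trmx_mul trmxK.
rewrite HT /reflect_mx -/M -/c mulmxBl mul1mx mulmxBr mulmx1 -scalemxAl -scalemxAr MM.
rewrite !scalerA -mulrA divfK ?gt_eqF// mulr_natr mulr2n scalerDl.
have -> : c *: M - (c *: M + c *: M) = - (c *: M) by rewrite opprD addrA subrr sub0r.
by rewrite opprK subrK.
Qed.

Lemma reflect_delta v (i j : 'I_n) :
  reflect (delta_mx 0 i) v 0 j = if j == i then - v 0 j else v 0 j.
Proof.
rewrite !mxE dotv_delta !dotv_delta mxE !eqxx divr1/=.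
by case: eqP => [->|_]; rewrite ?mulr1 ?mulr0 ?subr0//; ring.
Qed.

Lemma reflect_swap v (i j l : 'I_n) : i != j ->
  reflect (delta_mx 0 i - delta_mx 0 j) v 0 l = v 0 (tperm i j l).
Proof.
move=> ij; rewrite !mxE !eqxx/= !(dotvBl, dotvBr) !dotv_delta !mxE !eqxx/=.
rewrite [j == i]eq_sym (negPf ij) subr0 sub0r opprK.
have -> : 2 / (1 + 1) = 1 :> R by field.
rewrite mul1r; case: tpermP => [->|->|/eqP li /eqP lj].
- by rewrite eqxx (negPf ij) /=; ring.
- by rewrite eqxx [j == i]eq_sym (negPf ij) /=; ring.
- by rewrite (negPf li) (negPf lj) /=; ring.
Qed.

Lemma dualsq_reflect_delta p v (i : 'I_n) :
  dualsq p (reflect (delta_mx 0 i) v) = dualsq p v.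
Proof.
have w0 : 0 < dotv (delta_mx 0 i) (delta_mx 0 i) :> R.
  by rewrite dotv_delta mxE !eqxx.
rewrite /dualsq; case: ifP => _; last exact: dotv_reflect.
by apply: eq_bigr => j _; rewrite reflect_delta; case: ifP; rewrite ?sqrrN.
Qed.

Lemma dotv_swap_gt0 (i j : 'I_n) : i != j ->
  0 < dotv (delta_mx 0 i - delta_mx 0 j) (delta_mx 0 i - delta_mx 0 j) :> R.
Proof.
move=> ij; rewrite !(dotvBl, dotvBr) !dotv_delta !mxE !eqxx/=.
by rewrite [j == i]eq_sym (negPf ij) subr0 sub0r opprK addr_gt0.
Qed.

Lemma dualsq_reflect_swap p v (i j : 'I_n) : i != j ->
  dualsq p (reflect (delta_mx 0 i - delta_mx 0 j) v) = dualsq p v.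
Proof.
move=> ij; rewrite /dualsq; case: ifP => _.
  rewrite [RHS](reindex_inj (@perm_inj _ (tperm i j))).
  by apply: eq_bigr => l _; rewrite reflect_swap.
exact: dotv_reflect (dotv_swap_gt0 ij).
Qed.

Lemma dualsq_le_dotv p v : dualsq p v <= dotv v v.
Proof.
rewrite /dualsq; case: ifP => // _; apply: bigmax_le => [|i _]; first exact: dotv_ge0.
rewrite /dotv (bigD1 i)//= -expr2 lerDl; apply: sumr_ge0 => j _.
by rewrite -expr2 sqr_ge0.
Qed.

Lemma measurable_dualsq p : measurable_fun setT (@dualsq R n p).
Proof.
rewrite /dualsq; case: (p == 1%N); last exact: measurable_fun_dotv.
have : forall s : seq 'I_n, measurable_fun setT
    (fun v : 'rV[R]_n => \big[Num.max/0]_(i <- s) (v 0 i ^+ 2)).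
  elim=> [|i s ih]; first by under eq_fun do rewrite big_nil; exact: measurable_cst.
  under eq_fun do rewrite big_cons; apply: measurable_maxr => //.
  by apply: measurable_funX; exact: measurable_coord.
exact.
Qed.

End reflection.

Section sphere.
Context {R : realType} {n : nat} (mu : probability 'rV[R]_n R).
Hypothesis mu_unif : uniform_on_sphere mu.
Implicit Types (u v w : 'rV[R]_n) (h : 'rV[R]_n -> R).

Lemma sphere_ae : {ae mu, forall v, dotv v v = 1}.
Proof.
have E : [set v : 'rV[R]_n | norm2 v = 1] = (fun v => dotv v v) @^-1` [set 1].
  apply/seteqP; split => v /= v1; first by rewrite -norm2_sqr v1 expr1n.
  by rewrite /norm2 v1 sqrtr1.
have m : measurable [set v : 'rV[R]_n | norm2 v = 1].
  rewrite E -[X in measurable X]setTI.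
  by apply: measurable_fun_dotv => //; exact: measurable_id.
exists (~` [set v : 'rV[R]_n | norm2 v = 1]); split.
- exact: measurableC.
- by rewrite probability_setC// (proj1 mu_unif) subee.
- by move=> v /= nv v1; apply: nv; rewrite -norm2_sqr v1 expr1n.
Qed.

Lemma rint_sphere h (C : R) : measurable_fun setT h ->
  (forall v, dotv v v = 1 -> `|h v| <= C) -> rint mu h.
Proof.
move=> mh hC; apply: (rint_ae_le mh (rint_cst mu C)).
by apply: filterS sphere_ae => v /hC.
Qed.

Lemma Er_sphere_eq h1 h2 : measurable_fun setT h1 -> measurable_fun setT h2 ->
  (forall v, dotv v v = 1 -> h1 v = h2 v) -> Er mu h1 = Er mu h2.
Proof.
move=> m1 m2 h12; apply: Er_ae_eq => //.
by apply: filterS sphere_ae => v /h12.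
Qed.

Lemma Er_reflect w h (C : R) : 0 < dotv w w -> measurable_fun setT h ->
  (forall v, dotv v v = 1 -> `|h v| <= C) ->
  Er mu (fun v => h (reflect w v)) = Er mu h.
Proof.
move=> w0 mh hC; have mr := @measurable_reflect R n w.
have rh : rint mu (fun v => h (reflect w v)).
  apply: (@rint_sphere _ C); first exact: measurableT_comp.
  by move=> v v1; apply: hC; rewrite dotv_reflect.
rewrite /Er /Rintegral; congr fine.
rewrite -[LHS](@integral_pushforward _ _ _ _ R _ mr mu setT (EFin \o h))//.
  by apply: eq_measure_integral => A mA _; exact: (reflect_preserves w0 mu_unif mA).
exact/measurable_EFinP.
Qed.

Section weighted_moments.
Variable W : 'rV[R]_n -> R.
Hypotheses (mW : measurable_fun setT W) (W1 : forall v, dotv v v = 1 -> `|W v| <= 1).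
Hypothesis W_flip : forall v i, W (reflect (delta_mx 0 i) v) = W v.
Hypothesis W_swap : forall v (i j : 'I_n), i != j ->
  W (reflect (delta_mx 0 i - delta_mx 0 j) v) = W v.

Let coord_le1 v i : dotv v v = 1 -> `|v 0 i| <= 1.
Proof.
move=> v1; rewrite -(@ler_pXn2r _ 2)// ?nnegrE//.
rewrite real_normK ?num_real// expr1n -v1 /dotv (bigD1 i)//= -expr2 lerDl.
by apply: sumr_ge0 => j _; rewrite -expr2 sqr_ge0.
Qed.

Let mono i j v := v 0 i * v 0 j * W v.

Let mmono i j : measurable_fun setT (mono i j).
Proof. by apply: measurable_funM => //; apply: measurable_funM; exact: measurable_coord. Qed.

Let mono_le1 i j v : dotv v v = 1 -> `|mono i j v| <= 1.
Proof.
move=> v1; rewrite !normrM -[leRHS]mulr1; apply: ler_pM => //; last exact: W1.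
by rewrite -[leRHS]mulr1; apply: ler_pM => //; exact: coord_le1.
Qed.

Let rmono i j : rint mu (mono i j).
Proof. exact: (rint_sphere (mmono i j) (mono_le1 i j)). Qed.

Let mono_off i j : i != j -> Er mu (mono i j) = 0.
Proof.
move=> ij; have w0 : 0 < dotv (delta_mx 0 i) (delta_mx 0 i) :> R.
  by rewrite dotv_delta mxE !eqxx.
have := Er_reflect w0 (mmono i j) (mono_le1 i j).
have -> : (fun v => mono i j (reflect (delta_mx 0 i) v)) = (fun v => -1 * mono i j v).
  apply/funext => v; rewrite /mono W_flip !reflect_delta eqxx.
  by rewrite [j == i]eq_sym (negPf ij); ring.
by rewrite ErZ//; lra.
Qed.

Let mono_diag i j : Er mu (mono i i) = Er mu (mono j j).
Proof.
have [->//|ij] := eqVneq i j.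
rewrite -(Er_reflect (dotv_swap_gt0 ij) (mmono i i) (mono_le1 i i)).
by congr Er; apply/funext => v; rewrite /mono W_swap// reflect_swap// tpermL.
Qed.

Let mono_diagE i : n%:R * Er mu (mono i i) = Er mu W.
Proof.
transitivity (\sum_(j < n) Er mu (mono j j)).
  by rewrite (eq_bigr (fun=> Er mu (mono i i))) ?sumr_const ?card_ord ?mulr_natl.
rewrite -Er_sum//; apply: Er_sphere_eq => //.
  by apply: measurable_sum => j.
by move=> v v1; rewrite /mono -mulr_suml -[X in X * _]/(dotv v v) v1 mul1r.
Qed.

(** In the weighted second-moment matrix the off-diagonal entries change sign under a flip, hence
    vanish; the diagonal ones agree by transposition, and on the sphere they add up to [Er mu W].
    The weight is later [dualsq p] or the constant 1. *)
Lemma sphere_bilinear_moment u w :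
  rint mu (fun v => dotv u v * dotv w v * W v) /\
  Er mu (fun v => dotv u v * dotv w v * W v) = dotv u w / n%:R * Er mu W.
Proof.
have E : (fun v => dotv u v * dotv w v * W v) =
    (fun v => \sum_i \sum_j u 0 i * w 0 j * mono i j v).
  apply/funext => v; rewrite /dotv mulr_suml mulr_suml; apply: eq_bigr => i _.
  rewrite mulr_sumr mulr_suml; apply: eq_bigr => j _.
  by rewrite /mono; ring.
have rt i j : rint mu (fun v => u 0 i * w 0 j * mono i j v) by exact: rintZ.
have rs i : rint mu (fun v => \sum_j u 0 i * w 0 j * mono i j v) by exact: rint_sum.
rewrite E; split; first exact: rint_sum.
rewrite Er_sum// /dotv mulr_suml mulr_suml; apply: eq_bigr => i _.
rewrite Er_sum// (bigD1 i)//= big1 ?addr0 => [|j ji]; last first.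
  by rewrite ErZ// mono_off ?mulr0// eq_sym.
rewrite ErZ// -(mono_diagE i); field.
by rewrite pnatr_eq0 -lt0n (leq_ltn_trans _ (ltn_ord i)).
Qed.

End weighted_moments.

Lemma sphere_dualsq_moment p u : rint mu (fun v => dotv u v ^+ 2 * dualsq p v) /\
  Er mu (fun v => dotv u v ^+ 2 * dualsq p v) =
    dotv u u / n%:R * Er mu (@dualsq R n p).
Proof.
have W1 v : dotv v v = 1 -> `|dualsq p v| <= 1.
  by move=> <-; rewrite ger0_norm ?dualsq_ge0 ?dualsq_le_dotv.
exact: (sphere_bilinear_moment (@measurable_dualsq R n p) W1
  (fun v i => dualsq_reflect_delta p v i) (fun v i j => @dualsq_reflect_swap R n p v i j)
  u u).
Qed.

Lemma sphere_moment u w : rint mu (fun v => dotv u v * dotv w v) /\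
  Er mu (fun v => dotv u v * dotv w v) = dotv u w / n%:R.
Proof.
have W1 v : dotv v v = 1 -> `|1 : R| <= 1 by rewrite normr1.
have [] := @sphere_bilinear_moment (fun=> 1) (@measurable_cst _ _ _ _ _ _) W1
  (fun _ _ => erefl) (fun _ _ _ _ => erefl) u w.
by rewrite Er_cst mulr1; under eq_fun do rewrite mulr1.
Qed.

End sphere.

(** * Tail of the largest coordinate on the sphere *)

Section exponential_bounds.
Context {R : realType}.
Implicit Types x y a l : R.

Let expR_le_inv x : x < 1 -> expR x <= (1 - x)^-1.
Proof.
move=> x1; have := @expR_ge1Dx R (- x); rewrite expRN => h.
rewrite -[expR x]invrK lef_pV2 ?posrE ?subr_gt0 ?invr_gt0 ?expR_gt0//.
Qed.

(** The crude exponent [2 x^2] is enough. For [1 <= |x|] it exceeds [|x|]; for [|x| < 1], squaring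
    [e^(y/2) <= 1 / (1 - y/2)] reduces the claim to a rational inequality. *)
Lemma cosh_le x : expR x + expR (- x) <= 2 * expR (2 * x ^+ 2).
Proof.
have [x1|x1] := leP 1 `|x|.
  have h : `|x| <= 2 * x ^+ 2.
    by rewrite -real_normK ?num_real//; nra.
  have a1 : expR x <= expR (2 * x ^+ 2) by rewrite ler_expR (le_trans (ler_norm _)).
  have a2 : expR (- x) <= expR (2 * x ^+ 2).
    by rewrite ler_expR (le_trans (ler_norm _))// normrN.
  by lra.
have /andP[xl xu] : -1 < x < 1 by rewrite -ltr_norml.
have h : 1 + 2 * x ^+ 2 <= expR (2 * x ^+ 2) by exact: expR_ge1Dx.
have sq y : -1 < y < 1 -> expR y <= (1 - y / 2) ^- 2.
  move=> /andP[yl yu]; have -> : expR y = expR (y / 2) ^+ 2.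
    by rewrite expr2 -expRD; congr expR; field.
  rewrite -exprVn lerXn2r ?nnegrE ?expR_ge0 ?invr_ge0//; first lra.
  by apply: expR_le_inv; lra.
have b1 := sq x; rewrite xl xu in b1; have {}b1 := b1 isT.
have b2 := sq (- x); rewrite ltrNl opprK xu ltrNl xl in b2; have {}b2 := b2 isT.
have c1 : 0 < 1 - x / 2 by lra.
have c2 : 0 < 1 - - x / 2 by lra.
have : (1 - x / 2) ^- 2 + (1 - - x / 2) ^- 2 <= 2 * (1 + 2 * x ^+ 2).
  have -> : (1 - x / 2) ^- 2 + (1 - - x / 2) ^- 2 =
      ((1 - x / 2) ^+ 2 + (1 + x / 2) ^+ 2) / ((1 - x / 2) ^+ 2 * (1 + x / 2) ^+ 2).
    by field; rewrite !gt_eqF; lra.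
  rewrite ler_pdivrMr; last by rewrite mulr_gt0 ?exprn_gt0//; lra.
  have [u [u0 u1 uE]] : exists u, [/\ 0 <= u, u <= 1 / 4 & x ^+ 2 = 4 * u].
    by exists (x ^+ 2 / 4); split; nra.
  have -> : (1 - x / 2) ^+ 2 + (1 + x / 2) ^+ 2 = 2 * (1 + x ^+ 2 / 4) by field.
  have -> : (1 - x / 2) ^+ 2 * (1 + x / 2) ^+ 2 = (1 - x ^+ 2 / 4) ^+ 2 by field.
  by rewrite uE; nra.
by lra.
Qed.

(** Serves to replace a maximum of squares by a sum of exponentials. Beyond [a] one has
    [y / a <= e^(y/a - 1)], whose square grows at the rate [2 / a <= l]. *)
Lemma sqr_le_exp a l y : 0 < a -> 2 <= l * a -> 0 <= y ->
  y ^+ 2 <= a ^+ 2 * (1 + expR (l * (y - a))).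
Proof.
move=> a0 la y0; have e0 := expR_gt0 (l * (y - a)).
have [ya|ya] := leP y a.
  have : y ^+ 2 <= a ^+ 2 by rewrite lerXn2r// nnegrE ltW.
  by have := sqr_ge0 a; nra.
have h : y / a <= expR (y / a - 1).
  by have := @expR_ge1Dx R (y / a - 1); lra.
have h2 : (y / a) ^+ 2 <= expR (l * (y - a)).
  apply: (@le_trans _ _ (expR (y / a - 1) ^+ 2)).
    by rewrite lerXn2r// nnegrE ?expR_ge0// divr_ge0// ltW.
  rewrite expr2 -expRD ler_expR.
  have -> : y / a - 1 + (y / a - 1) = 2 * (y - a) / a by field; rewrite gt_eqF.
  by rewrite ler_pdivrMr//; nra.
have -> : y ^+ 2 = a ^+ 2 * (y / a) ^+ 2 by field; rewrite gt_eqF.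
by apply: ler_wpM2l; [exact: sqr_ge0|lra].
Qed.

End exponential_bounds.

Section sphere_tail.
Context {R : realType} {n : nat} (mu : probability 'rV[R]_n R).
Hypothesis mu_unif : uniform_on_sphere mu.
Hypothesis n8 : (8 <= n)%N.
Implicit Types (a b u v w : 'rV[R]_n) (l : R).

Let n_gt0 : 0 < n%:R :> R. Proof. by rewrite ltr0n (leq_trans _ n8). Qed.

Let mexp l b : measurable_fun setT (fun v : 'rV[R]_n => expR (l * dotv v b)).
Proof.
apply: (measurableT_comp (@measurable_expR R)); apply: measurable_funM => //.
by apply: measurable_fun_dotv => //; exact: measurable_id.
Qed.

Let exp_le l b v : dotv b b = 1 -> dotv v v = 1 -> `|expR (l * dotv v b)| <= expR `|l|.
Proof.
move=> b1 v1; rewrite ger0_norm ?expR_ge0// ler_expR.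
apply: le_trans (ler_norm _) _; rewrite normrM -[leRHS]mulr1 ler_wpM2l//.
by apply: le_trans (cauchy_schwarz _ _) _; rewrite /norm2 b1 v1 sqrtr1 mulr1.
Qed.

Let rexp l b : dotv b b = 1 -> rint mu (fun v => expR (l * dotv v b)).
Proof.
by move=> b1; apply: (rint_sphere mu_unif (mexp l b)) => v v1; exact: exp_le.
Qed.

Let Er_exp_rotate l a b : dotv a a = 1 -> dotv b b = 1 ->
  Er mu (fun v => expR (l * dotv v a)) = Er mu (fun v => expR (l * dotv v b)).
Proof.
move=> a1 b1; have [->//|ab] := eqVneq a b.
have w0 : 0 < dotv (a - b) (a - b).
  rewrite lt0r dotv_ge0 andbT; apply/eqP => h.
  have : norm2 (a - b) = 0 by rewrite /norm2 h sqrtr0.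
  by move/norm2_eq0/eqP; rewrite subr_eq0 (negPf ab).
rewrite -(Er_reflect mu_unif w0 (mexp l b) (fun v => exp_le l b1)).
congr Er; apply/funext => v; congr (expR (l * _)).
have ww : dotv (a - b) (a - b) = 2 - 2 * dotv a b.
  by rewrite !(dotvBl, dotvBr) (dotvC b a) a1 b1; ring.
rewrite ww in w0; rewrite /reflect ww dotvBl dotvZl !(dotvBl, dotvBr) b1.
by field; rewrite gt_eqF.
Qed.

(* By rotation invariance b may be replaced by any of the 2^n vectors with
   entries +-1/sqrt n; averaging over them turns the exponential into a product
   of hyperbolic cosines. *)
Lemma sphere_mgf l b : dotv b b = 1 ->
  Er mu (fun v => expR (l * dotv v b)) <= expR (2 * l ^+ 2 / n%:R).
Proof.
move=> b1; pose s (x : bool) : R := if x then 1 else -1.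
pose r : R := (Num.sqrt n%:R)^-1.
have rr : r ^+ 2 = n%:R^-1 by rewrite exprVn sqr_sqrtr// ltW.
pose a (f : {ffun 'I_n -> bool}) : 'rV[R]_n := \row_i (s (f i) * r).
have a1 f : dotv (a f) (a f) = 1.
  transitivity (\sum_(i < n) (n%:R^-1 : R)).
    by apply: eq_bigr => i _; rewrite mxE -rr; case: (f i); rewrite /s; ring.
  by rewrite sumr_const card_ord -[LHS]mulr_natl mulfV// gt_eqF.
have E : (fun v => \sum_f expR (l * dotv v (a f))) =
   (fun v => \prod_i (expR (l * r * v 0 i) + expR (- (l * r * v 0 i)))).
  apply/funext => v.
  transitivity (\prod_i \sum_(x : bool) expR (l * r * v 0 i * s x)).
    rewrite bigA_distr_bigA; apply: eq_bigr => f _.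
    rewrite -expR_sum /dotv mulr_sumr; congr expR; apply: eq_bigr => i _.
    by rewrite mxE; ring.
  by apply: eq_bigr => i _; rewrite big_bool/= mulr1 mulrN1.
have h : Er mu (fun v => \sum_f expR (l * dotv v (a f))) <=
    2 ^+ n * expR (2 * l ^+ 2 / n%:R).
  rewrite -[leRHS](Er_cst mu); apply: Er_ae_le.
  - by apply: rint_sum => f; exact: rexp.
  - exact: rint_cst.
  apply: filterS (sphere_ae mu_unif) => v v1; have /= -> := congr1 (fun F => F v) E.
  apply: (@le_trans _ _ (\prod_(i < n) (2 * expR (2 * (l * r * v 0 i) ^+ 2)))).
    apply: ler_prod => i _; rewrite addr_ge0 ?expR_ge0//.
    exact: cosh_le.
  rewrite big_split/= prodr_const card_ord -expR_sum ler_pM2l ?exprn_gt0// ler_expR.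
  rewrite (eq_bigr (fun i => 2 * l ^+ 2 / n%:R * (v 0 i * v 0 i))) => [|i _]; last first.
    by rewrite !exprMn rr; ring.
  by rewrite -mulr_sumr -[X in _ * X]/(dotv v v) v1 mulr1.
move: h; rewrite Er_sum => [|f]; last exact: rexp.
rewrite (eq_bigr (fun=> Er mu (fun v => expR (l * dotv v b)))) => [|f _]; last first.
  exact: Er_exp_rotate.
rewrite sumr_const card_ffun card_bool card_ord -[X in X <= _]mulr_natl natrX.
by rewrite ler_pM2l// exprn_gt0.
Qed.

Lemma Er_dualsq_le p : p \in [:: 1%N; 2%N] ->
  rint mu (@dualsq R n p) /\ Er mu (@dualsq R n p) <= 8 / 3 * rho p n.
Proof.
move=> hp; have md := @measurable_dualsq R n p.
have d1 v : dotv v v = 1 -> `|dualsq p v| <= 1.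
  by move=> <-; rewrite ger0_norm ?dualsq_ge0 ?dualsq_le_dotv.
have rd := rint_sphere mu_unif md d1; split => //.
move: hp rd {md d1}; rewrite !inE => /orP[/eqP ->|/eqP ->] rd; last first.
  rewrite rho2// mulr1; apply: (@le_trans _ _ 1); last lra.
  rewrite -[leRHS](Er_cst mu); apply: Er_ae_le => //; first exact: rint_cst.
  by apply: filterS (sphere_ae mu_unif) => v v1; rewrite /dualsq/= v1.
rewrite rho1; set L := ln n%:R; have L2 : 2 <= L := @ln_dim_ge2 R n n8.
(* With [n = e^L], [l a = 2 L] and [2 l^2 / n = L / 2], the sum over the coordinates costs
   [e^(-2L) e^L 2 e^(L/2) = 2 e^(-L/2) <= 1]. The mean is then at most [2 a^2 = 32 L / n], and
   [32 L <= 8/3 (16 L - 8)] holds exactly when [L >= 2], whence the factor [8/3]. *)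
pose l := Num.sqrt (n%:R * L) / 2; pose a := 2 * L / l.
have L0 : 0 < L by lra.
have nL : 0 < n%:R * L by rewrite mulr_gt0.
have l0 : 0 < l by rewrite divr_gt0// sqrtr_gt0.
have ll : l ^+ 2 = n%:R * L / 4 by rewrite exprMn sqr_sqrtr ?ltW// exprVn; field.
have a0 : 0 < a by apply: divr_gt0 => //; apply: mulr_gt0.
have la : l * a = 2 * L by rewrite /a; field; rewrite gt_eqF.
have aa : a ^+ 2 = 16 * L / n%:R.
  by rewrite /a exprMn exprVn ll; field; rewrite (gt_eqF n_gt0) (gt_eqF L0).
have la2 : 2 <= l * a by lra.
pose G (v : 'rV[R]_n) := a ^+ 2 * (1 + expR (- (2 * L)) *
   \sum_i (expR (l * dotv v (delta_mx 0 i)) + expR (- l * dotv v (delta_mx 0 i)))).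
have dd i : dotv (delta_mx 0 i : 'rV[R]_n) (delta_mx 0 i) = 1.
  by rewrite dotv_delta mxE !eqxx.
have rs : forall i, rint mu (fun v => expR (l * dotv v (delta_mx 0 i)) +
    expR (- l * dotv v (delta_mx 0 i))).
  by move=> i; apply: rintD; exact: rexp.
have rs2 := rint_sum (index_enum 'I_n) rs.
have rG1 : rint mu (fun v => 1 + expR (- (2 * L)) *
   \sum_i (expR (l * dotv v (delta_mx 0 i)) + expR (- l * dotv v (delta_mx 0 i)))).
  by apply: rintD; [exact: rint_cst|exact: rintZ].
have rG : rint mu G by exact: rintZ.
have dG v : dualsq 1 v <= G v.
  have e0 := expR_gt0 (- (2 * L)).
  have base : 0 <= G v.
    apply: mulr_ge0; [exact: sqr_ge0|apply: addr_ge0 => //; apply: mulr_ge0; first exact: ltW].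
    by apply: sumr_ge0 => i _; rewrite addr_ge0// expR_ge0.
  rewrite /dualsq eqxx; apply: bigmax_le => // i _.
  rewrite -real_normK ?num_real//; apply: le_trans (sqr_le_exp a0 la2 (normr_ge0 _)) _.
  apply: ler_wpM2l; first exact: sqr_ge0.
  rewrite lerD2l mulrBr la -[_ - 2 * L]addrC expRD ler_pM2l//.
  rewrite (bigD1 i)//= -[leLHS]addr0; apply: lerD; last first.
    by apply: sumr_ge0 => j _; rewrite addr_ge0// expR_ge0.
  rewrite !dotv_delta; have [vi|vi] := leP 0 (v 0 i).
    by rewrite (ger0_norm vi) lerDl expR_ge0.
  by rewrite (ltr0_norm vi) mulrN -mulNr lerDr expR_ge0.
apply: (@le_trans _ _ (Er mu G)); first exact: Er_le.
rewrite /G ErZ// ErD//; last 2 first.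
- exact: rint_cst.
- exact: rintZ.
rewrite Er_cst ErZ// Er_sum// aa.
have : \sum_i Er mu (fun v => expR (l * dotv v (delta_mx 0 i)) +
    expR (- l * dotv v (delta_mx 0 i))) <= n%:R * (2 * expR (L / 2)).
  rewrite mulr_natl -[X in _ *+ X]card_ord -sumr_const; apply: ler_sum => i _.
  rewrite ErD; [|exact: rexp|exact: rexp].
  have := sphere_mgf l (dd i); have := sphere_mgf (- l) (dd i).
  rewrite sqrrN ll.
  have -> : 2 * (n%:R * L / 4) / n%:R = L / 2 by field; rewrite gt_eqF.
  by lra.
set S := \sum_i _ => hS.
have e1 : expR (- (2 * L)) * (n%:R * (2 * expR (L / 2))) = 2 * expR (- (L / 2)).
  have -> : n%:R = expR L :> R by rewrite lnK.
  transitivity (2 * (expR (- (2 * L)) * expR L * expR (L / 2))); first by ring.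
  by rewrite -!expRD; congr (_ * expR _); field.
have e2 : expR (- (L / 2)) <= 2^-1.
  rewrite expRN lef_pV2 ?posrE ?expR_gt0//.
  by apply: le_trans (expR_ge1Dx _); lra.
have h3 : expR (- (2 * L)) * S <= 1.
  apply: (@le_trans _ _ (2 * expR (- (L / 2)))); last lra.
  by rewrite -e1 ler_pM2l ?expR_gt0.
apply: (@le_trans _ _ (16 * L / n%:R * 2)).
    by apply: ler_wpM2l; [apply: divr_ge0; [lra|exact: ltW]|lra].
by rewrite mulrAC [leRHS]mulrA ler_pM2r ?invr_gt0//; lra.
Qed.

End sphere_tail.

(** * The smooth objective *)

Section gradient_lipschitz.
Context {R : realType} {n : nat}.
Implicit Types (f : 'rV[R]_n -> R) (x y h : 'rV[R]_n).

Lemma derive_grad f x h : differentiable f x -> 'D_h f x = dotv (grad f x) h.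
Proof.
move=> df; rewrite deriveE// {1}(row_sum_delta h) linear_sum /dotv.
by apply: eq_bigr => i _; rewrite linearZ/= mxE deriveE// mulrC.
Qed.

Lemma is_derive_line f x h (s : R) : (forall v, differentiable f v) ->
  is_derive s 1 (fun s : R => f (x + s *: h)) (dotv (grad f (x + s *: h)) h).
Proof.
move=> df; have E : (fun t : R => t^-1 *: (((fun s : R => f (x + s *: h)) \o shift s) (t *: 1) -
    f (x + s *: h))) =
    (fun t : R => t^-1 *: ((f \o shift (x + s *: h)) (t *: h) - f (x + s *: h))).
  apply/funext => t /=; congr (_ *: (f _ - _)).
  by rewrite [t *: 1]mulr1 scalerDl addrCA.
have d := @diff_derivable _ _ _ f (x + s *: h) h (df _).
apply: DeriveDef; first by rewrite /derivable E.
by rewrite -derive_grad// /derive E.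
Qed.

(** The mean value theorem along the segment gives the constant [L], twice that of an integral
    remainder. The step [1 / (2 L2)] of the algorithm minimizes the quadratic upper bound with this
    constant. *)
Lemma lipschitz_grad_taylor f (G : 'rV[R]_n -> 'rV[R]_n) (L : R) x y :
  (forall v, differentiable f v /\ grad f v = G v) ->
  (forall u v, norm2 (G u - G v) <= L * norm2 (u - v)) ->
  `|f y - f x - dotv (G x) (y - x)| <= L * dotv (y - x) (y - x).
Proof.
move=> dG lip; have df v : differentiable f v by have [] := dG v.
have gE v : grad f v = G v by have [] := dG v.
set h := y - x; pose phi := fun s : R => f (x + s *: h).
have dphi (s : R) : is_derive s 1 phi (dotv (G (x + s *: h)) h).
  by rewrite -gE; exact: is_derive_line.
have cphi : {within `[0, 1], continuous phi}.
  apply: derivable_within_continuous => s _.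
  by have [] := dphi s.
have [c] := @MVT R _ _ 0 1 ltr01 (fun s _ => dphi s) cphi.
rewrite in_itv/= => /andP[c0 c1]; rewrite /phi scale1r scale0r addr0 subr0 mulr1.
rewrite (addrC x) subrK => ->; rewrite -dotvBl -norm2_sqr.
apply: le_trans (cauchy_schwarz _ _) _; rewrite expr2 mulrA.
apply: ler_wpM2r; first exact: norm2_ge0.
apply: le_trans (lip _ _) _; rewrite addrAC subrr add0r norm2Z (ger0_norm (ltW c0)).
(* The Lipschitz inequality itself yields [0 <= L * norm2 h], so no sign of [L] is assumed. *)
have := lip y x; have := norm2_ge0 (G y - G x); rewrite -/h => a b.
have Lh : 0 <= L * norm2 h by exact: le_trans b.
by rewrite mulrCA; apply: ler_piMl => //; exact: ltW.
Qed.

End gradient_lipschitz.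

Section parametric_expectation.
Context {d1 d2} {T1 : measurableType d1} {T2 : measurableType d2} {R : realType}.

(** Integrability in [y] is not assumed: the integrals of the positive and negative parts are
    measurable by Tonelli, and [fine] is measurable even where their difference is infinite. *)
Lemma measurable_Er (P : probability T2 R) (h : T1 * T2 -> R) :
  measurable_fun setT h -> measurable_fun setT (fun x => Er P (fun y => h (x, y))).
Proof.
move=> mh; rewrite /Er /Rintegral.
apply: (measurableT_comp (@fine_measurable R setT _)) => //.
rewrite (_ : (fun x => _) = fubini_F P (EFin \o h)); last by [].
have E : fubini_F P (EFin \o h) = ((fun x => \int[P]_y ((EFin \o h)^\+ (x, y))) \-
    (fun x => \int[P]_y ((EFin \o h)^\- (x, y))))%E.
  apply/funext => x; rewrite [LHS]integralE.
  under eq_integral do rewrite funepos_comp/=.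
  by under [X in (_ - X)%E = _]eq_integral do rewrite funeneg_comp/=.
rewrite E.
have me : measurable_fun setT (EFin \o h) by exact/measurable_EFinP.
apply: emeasurable_funB.
  by apply: measurable_fun_fubini_tonelli_F => //; exact: measurable_funepos.
by apply: measurable_fun_fubini_tonelli_F => //; exact: measurable_funeneg.
Qed.

End parametric_expectation.

Lemma sqrte_le (R : realType) (x : \bar R) (y : R) : (0 <= x)%E -> 0 < y ->
  (sqrte x <= y%:E)%E -> (x <= (y ^+ 2)%:E)%E.
Proof.
case: x => [x| |] //= x0 y0; rewrite ?lee_fin ?leye_eq// => h.
rewrite -(sqr_sqrtr (x0 : 0 <= x)).
by rewrite lerXn2r ?nnegrE ?sqrtr_ge0// ltW.
Qed.

Section smooth_objective.
Context {R : realType} {d : measure_display} {X : measurableType d} {n : nat}.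
Variables (P : probability X R) (F : 'rV[R]_n -> X -> R) (g : 'rV[R]_n -> X -> 'rV[R]_n).
Variables (L : X -> R) (L2 sigma : R).
Hypothesis hprob : stochastic_problem P F g L L2 sigma.
Implicit Types x y h : 'rV[R]_n.

Let f := objective P F.

Lemma objectiveE x : f x = Er P (F x).
Proof. by rewrite /f /objective unlock. Qed.

Let rF x : rint P (F x). Proof. exact: sp_integrable hprob x. Qed.

Let L2_gt0 : 0 < L2. Proof. exact: sp_L2gt0 hprob. Qed.

Let mL : measurable_fun setT L. Proof. exact: sp_measL hprob. Qed.

Lemma lipschitz_sqr : rint P (fun xi => L xi ^+ 2) /\ Er P (fun xi => L xi ^+ 2) <= L2 ^+ 2.
Proof.
apply: Er_le_fin; first exact: measurable_funX.
  by move=> xi; exact: sqr_ge0.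
have := sp_L2 hprob; rewrite unlock; apply: sqrte_le => //.
by apply: integral_ge0 => xi _; rewrite lee_fin sqr_ge0.
Qed.

Lemma rint_lipschitz : rint P L.
Proof. exact: rint_sqr mL (proj1 lipschitz_sqr). Qed.

Let ErL : Er P L <= L2.
Proof. by have [r e] := lipschitz_sqr; exact: Er_sqr_le (ltW L2_gt0) mL r e. Qed.

Lemma sample_taylor : {ae P, forall xi, forall x y,
  `|F y xi - F x xi - dotv (g x xi) (y - x)| <= L xi * dotv (y - x) (y - x)}.
Proof.
apply: filterS (sp_smooth hprob) => xi [dg lip] x y.
exact: (lipschitz_grad_taylor x y dg lip).
Qed.

Lemma measurable_sample_grad x : measurable_fun setT (g x).
Proof.
exact: (@measurable_fun_pair2 _ _ _ _ _ _ (fun u => g u.1 u.2) x (sp_measg hprob)).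
Qed.

(** Along a unit step on axis [i], Taylor's bound says that this entry differs from an increment of
    [F] by at most [L], and both are integrable. *)
Lemma rint_sample_grad x i : rint P (fun xi => g x xi 0 i).
Proof.
apply: (@rint_ae_le _ _ _ _ _
  (fun xi => `|F (x + delta_mx 0 i) xi - F x xi| + L xi)).
- exact/measurable_fun_coord/measurable_sample_grad.
- by apply: rintD rint_lipschitz; apply: rint_norm; exact: rintB.
apply: filterS sample_taylor => xi /(_ x (x + delta_mx 0 i)).
rewrite [x + _ - x]addrAC subrr add0r !dotv_delta mxE !eqxx mulr1.
set a := F _ xi - F x xi; set b := g x xi 0 i => h.
have -> : b = a - (a - b) by ring.
by apply: le_trans (ler_normB _ _) _; rewrite lerD2l.
Qed.

Definition mean_grad x : 'rV[R]_n := \row_i Er P (fun xi => g x xi 0 i).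

Lemma Er_dotv_sample_grad x h : rint P (fun xi => dotv (g x xi) h) /\
  Er P (fun xi => dotv (g x xi) h) = dotv (mean_grad x) h.
Proof.
have r i : rint P (fun xi => g x xi 0 i * h 0 i).
  under eq_fun do rewrite mulrC; exact/rintZ/rint_sample_grad.
split; first exact: rint_sum.
rewrite Er_sum//; apply: eq_bigr => i _; rewrite mxE.
rewrite (_ : (fun xi => _) = (fun xi => h 0 i * g x xi 0 i)); last first.
  by apply/funext => xi; rewrite mulrC.
by rewrite ErZ; [rewrite mulrC|exact: rint_sample_grad].
Qed.

Let objective_taylor_mean x y :
  `|f y - f x - dotv (mean_grad x) (y - x)| <= L2 * dotv (y - x) (y - x).
Proof.
have [rg Eg] := Er_dotv_sample_grad x (y - x).
have rFF := rintB (rF y) (rF x).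
have r := rintB rFF rg.
have E : Er P (fun xi => F y xi - F x xi - dotv (g x xi) (y - x)) =
    f y - f x - dotv (mean_grad x) (y - x).
  by rewrite (ErB rFF rg) (ErB (rF y) (rF x)) Eg !objectiveE.
have rL := rintZ (dotv (y - x) (y - x)) rint_lipschitz.
have up : Er P (fun xi => F y xi - F x xi - dotv (g x xi) (y - x)) <=
    Er P (fun xi => dotv (y - x) (y - x) * L xi).
  apply: Er_ae_le => //; apply: filterS sample_taylor => xi /(_ x y).
  by rewrite mulrC; exact: le_trans (ler_norm _).
have lo : Er P (fun xi => - 1 * (dotv (y - x) (y - x) * L xi)) <=
    Er P (fun xi => F y xi - F x xi - dotv (g x xi) (y - x)).
  apply: Er_ae_le => //; first exact: rintZ.
  apply: filterS sample_taylor => xi /(_ x y).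
  by rewrite mulrC ler_norml mulN1r => /andP[].
rewrite E in up lo; rewrite ErZ// in lo; rewrite (ErZ _ rint_lipschitz) in up lo.
have h : dotv (y - x) (y - x) * Er P L <= L2 * dotv (y - x) (y - x).
  by rewrite mulrC ler_wpM2r ?dotv_ge0.
by rewrite ler_norml; apply/andP; split; lra.
Qed.

(** Differentiation under the expectation: averaging the Taylor bound over the samples leaves a
    quadratic remainder, which determines the partial derivatives. *)
Lemma grad_objective x : grad f x = mean_grad x.
Proof.
apply/rowP => i; rewrite mxE; apply: cvg_lim => //; apply/cvgrPdist_le => e e0.
rewrite near_withinE.
have d0 : 0 < e / L2 by exact: divr_gt0.
apply: filterS (@nbhs0_le _ R^o _ d0) => h hb h0.
have := objective_taylor_mean x (x + h *: delta_mx 0 i).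
rewrite [x + _ - x]addrAC subrr add0r !dotvZr dotvZl !dotv_delta [delta_mx _ _ _ _]mxE !eqxx.
rewrite /= (addrC _ x) !mxE mulr1; set D := f _ - f x; set b := Er _ _ => hD.
have -> : h^-1 *: D = D / h by rewrite mulrC.
have hp : 0 < `|h| by rewrite normr_gt0.
rewrite distrC -(ler_pM2r hp) -normrM mulrBl divfK// [b * h]mulrC.
apply: le_trans hD _; rewrite -expr2 -real_normK ?num_real// expr2 mulrA ler_pM2r//.
by rewrite mulrC -ler_pdivlMr.
Qed.

Lemma objective_taylor x y :
  `|f y - f x - dotv (grad f x) (y - x)| <= L2 * dotv (y - x) (y - x).
Proof. by rewrite grad_objective; exact: objective_taylor_mean. Qed.

Lemma objective_convex x y : f x + dotv (grad f x) (y - x) <= f y.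
Proof.
set h := y - x; set D := dotv (grad f x) h; rewrite leNgt; apply/negP => lt.
pose c := f x + D - f y; have c0 : 0 < c by rewrite /c; lra.
have hh := dotv_ge0 h; set q := dotv h h in hh.
have s0 : 0 < c + L2 * q + 1 by have := mulr_ge0 (ltW L2_gt0) hh; lra.
(* At most 1, to stay on the segment, and so small that the Taylor error [t L2 q] is below the
   supposed gap [c]. *)
pose t := c / (c + L2 * q + 1).
have t0 : 0 < t by exact: divr_gt0.
have t1 : t <= 1 by rewrite ler_pdivrMr// mul1r; have := mulr_ge0 (ltW L2_gt0) hh; lra.
have tE : t * (c + L2 * q + 1) = c by rewrite divfK// gt_eqF.
have cv : f (t *: y + (1 - t) *: x) <= t * f y + (1 - t) * f x.
  exact: (sp_convex hprob (Itv01 (ltW t0) t1) (in_setT y) (in_setT x)).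
have xE : t *: y + (1 - t) *: x = x + t *: h.
  by rewrite scalerBl scale1r scalerBr addrCA.
rewrite xE in cv.
have := objective_taylor x (x + t *: h).
rewrite [x + _ - x]addrAC subrr add0r !dotvZr dotvZl -/D -/q ler_norml => /andP[lo _].
have : t * c <= t * (t * (L2 * q)) by rewrite /c; lra.
rewrite ler_pM2l// => h1; have : t * (c + 1) <= 0 by lra.
by rewrite leNgt mulr_gt0//; lra.
Qed.

Lemma measurable_objective : measurable_fun setT f.
Proof.
rewrite (_ : f = (fun x => Er P (fun xi => F (x, xi).1 (x, xi).2))).
  exact: measurable_Er (sp_measF hprob).
by apply/funext => x; rewrite objectiveE.
Qed.

Lemma measurable_grad_objective : measurable_fun setT (grad f).
Proof.
apply: measurable_fun_rV => i.
rewrite (_ : (fun x => _) = (fun x => Er P (fun xi => g (x, xi).1 (x, xi).2 0 i))).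
  apply: (@measurable_Er _ _ _ _ _ P (fun u => g u.1 u.2 0 i)).
  by apply: measurable_fun_coord; exact: sp_measg hprob.
by apply/funext => x; rewrite grad_objective mxE.
Qed.

Lemma sample_grad_variance x :
  rint P (fun xi => dotv (g x xi - grad f x) (g x xi - grad f x)) /\
  Er P (fun xi => dotv (g x xi - grad f x) (g x xi - grad f x)) <= sigma ^+ 2.
Proof.
apply: Er_le_fin.
- by apply: measurable_fun_dotv; apply: measurable_fun_subv => //;
    exact: measurable_sample_grad.
- by move=> xi; exact: dotv_ge0.
have := sp_variance hprob x; rewrite unlock; congr (_ <= _)%E.
by apply: eq_integral => xi _; rewrite norm2_sqr.
Qed.

Lemma Er_centered_sample_grad x h :
  rint P (fun xi => dotv (g x xi - grad f x) h) /\ Er P (fun xi => dotv (g x xi - grad f x) h) = 0.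
Proof.
have [r e] := Er_dotv_sample_grad x h.
under eq_fun do rewrite dotvBl; have rc := rint_cst P (dotv (grad f x) h).
by split; [exact: rintB|rewrite ErB// Er_cst e grad_objective subrr].
Qed.

Section minimizer.
Variable xs : 'rV[R]_n.
Hypothesis xs_min : is_minimizer f xs.

(** A gradient step of length [1 / (2 L2)] lowers [f] by at least [|grad f|^2 / (4 L2)], yet not
    below the minimum. *)
Lemma grad_sqr_le_gap x : dotv (grad f x) (grad f x) <= 4 * L2 * (f x - f xs).
Proof.
have := objective_taylor x (x - (2 * L2)^-1 *: grad f x).
have := xs_min (x - (2 * L2)^-1 *: grad f x).
rewrite [x - _ - x]addrAC subrr add0r -scaleNr !dotvZr dotvZl ler_norml.
set G := dotv _ _ => m /andP[_ hi].
have e1 : L2 * (- (2 * L2)^-1 * (- (2 * L2)^-1 * G)) = (4 * L2)^-1 * G.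
  by field; rewrite gt_eqF.
have e2 : (2 * L2)^-1 * G = 2 * ((4 * L2)^-1 * G) by field; rewrite gt_eqF.
have h : (4 * L2)^-1 * G <= f x - f xs by rewrite mulNr in hi; lra.
by rewrite mulrC -ler_pdivrMr ?mulr_gt0// mulrC.
Qed.

Lemma gap_ge0 x : 0 <= f x - f xs.
Proof. by rewrite subr_ge0. Qed.

Lemma gap_le_dist x : f x - f xs <= L2 * dotv (x - xs) (x - xs).
Proof.
have g0 : grad f xs = 0.
  apply: norm2_eq0; apply/eqP; rewrite -sqrf_eq0 norm2_sqr eq_le dotv_ge0 andbT.
  by have := grad_sqr_le_gap xs; rewrite subrr mulr0.
have := objective_taylor xs x; rewrite g0 -(scale0r 0) dotvZl mul0r subr0.
exact: le_trans (ler_norm _).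
Qed.

End minimizer.

End smooth_objective.

(** * Independence of the draws *)

Section independent_pair.
Context {d d1 d2} {Omega : measurableType d} {T1 : measurableType d1}
  {T2 : measurableType d2} {R : realType}.
Variables (Pr : probability Omega R) (muV : probability T2 R).
Variables (U : Omega -> T1) (V : Omega -> T2).
Hypotheses (mU : measurable_fun setT U) (mV : measurable_fun setT V).
Hypothesis lawV : forall B, measurable B -> Pr (V @^-1` B) = muV B.
Hypothesis indepUV : forall A B, measurable A -> measurable B ->
  (Pr (U @^-1` A `&` V @^-1` B) = Pr (U @^-1` A) * Pr (V @^-1` B))%E.
Variable h : T1 * T2 -> R.
Hypothesis mh : measurable_fun setT h.

Let U' : {mfun Omega >-> T1} := HB.pack U (isMeasurableFun.Build _ _ _ _ _ mU).

Let lawU : probability T1 R := distribution Pr U'.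

Let mUV : measurable_fun setT (fun w => (U w, V w)).
Proof. exact: measurable_fun_pair. Qed.

Let UV' : {mfun Omega >-> (T1 * T2)%type} :=
  HB.pack (fun w => (U w, V w)) (isMeasurableFun.Build _ _ _ _ _ mUV).

Let lawUV : probability (T1 * T2)%type R := distribution Pr UV'.

Let lawUV_prod A : measurable A -> lawUV A = (lawU \x muV)%E A.
Proof.
move=> mA; apply/esym; apply: product_measure_unique => // B C mB mC.
transitivity (Pr (U @^-1` B) * Pr (V @^-1` C))%E; first exact: indepUV.
by rewrite lawV.
Qed.

Let integral_lawUV (f : T1 * T2 -> \bar R) :
  (\int[lawUV]_u f u = \int[lawU \x muV]_u f u)%E.
Proof. by apply: eq_measure_integral => A mA _; exact: lawUV_prod. Qed.

(** By uniqueness of the product measure, the joint law is the product of the marginals; then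
    Fubini. *)
Lemma Er_indep : rint Pr (fun w => h (U w, V w)) ->
  rint Pr (fun w => Er muV (fun v => h (U w, v))) /\
  Er Pr (fun w => h (U w, V w)) = Er Pr (fun w => Er muV (fun v => h (U w, v))).
Proof.
move=> ri; have me : measurable_fun setT (EFin \o h) by exact/measurable_EFinP.
have ip : (lawU \x muV)%E.-integrable setT (EFin \o h).
  have : (pushforward Pr (fun w => (U w, V w))).-integrable setT (EFin \o h).
    exact: (@integrable_pushforward _ _ _ _ R _ mUV Pr setT (EFin \o h)).
  move=> /integrableP[_ fin]; apply/integrableP; split => //.
  by rewrite -integral_lawUV.
have mE := measurable_Er muV mh.
have FE : {ae lawU, forall u, fubini_F muV (EFin \o h) u =
    (Er muV (fun v => h (u, v)))%:E}.
  have := ae_integrable1 ip; apply: filterS => u ru.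
  by rewrite /fubini_F -ErE.
have iF : lawU.-integrable setT (fun u => (Er muV (fun v => h (u, v)))%:E).
  have /integrableP[mF fF] := integrable_fubini_F ip.
  apply/integrableP; split; first exact/measurable_EFinP.
  move: fF; congr (_ < _)%E; apply: ae_eq_integral => //.
  - exact: measurableT_comp.
  - by apply: measurableT_comp => //; exact/measurable_EFinP.
  by apply: filterS FE => u /= ->.
have iE : rint Pr (fun w => Er muV (fun v => h (U w, v))).
  have /integrableP[mF fF] := iF.
  apply/integrableP; split.
    by apply/measurable_EFinP; exact: (measurableT_comp mE mU).
  move: fF; rewrite (@ge0_integral_pushforward _ _ _ _ R _ mU Pr setT)//.
  by apply: measurableT_comp => //.
split => //; rewrite /Er /Rintegral; congr fine.
rewrite -[LHS](@integral_pushforward _ _ _ _ R _ mUV Pr setT (EFin \o h))//.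
rewrite -[RHS](@integral_pushforward _ _ _ _ R _ mU Pr setT
  (fun u => (Er muV (fun v => h (u, v)))%:E))//; last exact/measurable_EFinP.
rewrite integral_lawUV -integral12_prod_meas1//.
apply: (@ae_eq_integral _ _ _ lawU setT) => //.
- exact: (measurable_fubini_F ip).
- exact/measurable_EFinP.
by apply: filterS FE => u /= ->.
Qed.

(** The Tonelli version, in which joint integrability is a conclusion. This is how products with a
    fresh direction become integrable. *)
Lemma Er_indep_ge0 : (forall u, 0 <= h u) -> (forall u, rint muV (fun v => h (u, v))) ->
  rint Pr (fun w => Er muV (fun v => h (U w, v))) ->
  rint Pr (fun w => h (U w, V w)) /\
  Er Pr (fun w => h (U w, V w)) = Er Pr (fun w => Er muV (fun v => h (U w, v))).
Proof.
move=> h0 rh rH; have me : measurable_fun setT (EFin \o h) by exact/measurable_EFinP.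
have E : (\int[Pr]_w (h (U w, V w))%:E = \int[Pr]_w (Er muV (fun v => h (U w, v)))%:E)%E.
  transitivity (\int[lawUV]_u (h u)%:E)%E.
    rewrite [RHS](@ge0_integral_pushforward _ _ _ _ R _ mUV Pr setT (EFin \o h))//.
    by move=> u _; rewrite lee_fin.
  rewrite integral_lawUV fubini_tonelli1; [|exact: me|by move=> u; rewrite lee_fin].
  transitivity (\int[lawU]_u (Er muV (fun v => h (u, v)))%:E)%E.
    by apply: eq_integral => u _; rewrite /fubini_F -ErE.
  rewrite [LHS](@ge0_integral_pushforward _ _ _ _ R _ mU Pr setT
    (fun u => (Er muV (fun v => h (u, v)))%:E))//.
    by apply/measurable_EFinP; exact: measurable_Er.
  by move=> u _; rewrite lee_fin Er_ge0.
have r : rint Pr (fun w => h (U w, V w)).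
  apply: rint_fin => //; first exact: measurableT_comp.
  by rewrite E -(ErE rH) ltry.
by split => //; rewrite /Er /Rintegral E.
Qed.

End independent_pair.

Section generated_independence.
Context {d d2} {Omega : measurableType d} {T2 : measurableType d2} {R : realType}.
Variables (Pr : probability Omega R) (V : Omega -> T2) (G : set (set Omega)).
Hypotheses (mV : measurable_fun setT V) (mG : G `<=` measurable) (GT : G setT)
  (GI : setI_closed G).
Hypothesis indepGV : forall A B, G A -> measurable B ->
  (Pr (A `&` V @^-1` B) = Pr A * Pr (V @^-1` B))%E.

(** For fixed [B], the restriction of [Pr] to [V^-1 B] and the multiple of [Pr] by the mass of that
    event are finite measures that agree on a family stable under intersection. *)
Lemma generated_indep A B : <<s G >> A -> measurable B ->
  (Pr (A `&` V @^-1` B) = Pr A * Pr (V @^-1` B))%E.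
Proof.
move=> sA mB; have mVB : measurable (V @^-1` B).
  by rewrite -[X in measurable X]setTI; exact: mV.
have pf : Pr (V @^-1` B) \is a fin_num by exact: fin_num_measure.
have r0 : 0 <= fine (Pr (V @^-1` B)) by rewrite fine_ge0.
pose m1 := mrestr Pr mVB; pose m2 := mscale (NngNum r0) Pr.
have E C : (m2 C = Pr C * Pr (V @^-1` B))%E.
  by rewrite /m2 /mscale/= fineK// muleC.
rewrite -E; apply: (@g_sigma_algebra_measure_unique _ R Omega G mG (fun=> setT)
  (fun=> GT) _ m1 m2 GI) => //.
- by rewrite bigcup_const//; exists 0%N.
- by move=> C GC; transitivity (Pr C * Pr (V @^-1` B))%E; [exact: indepGV|exact/esym/E].
- move=> _; apply: (@le_lt_trans _ _ 1%E); last exact: ltry.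
  by apply: probability_le1; exact: measurableI.
Qed.

Lemma measurable_id_generated : measurable_fun setT (id : Omega -> g_sigma_algebraType G).
Proof.
move=> _ B sB; rewrite setTI; apply: smallest_sub sB => //.
exact: sigma_algebra_measurable.
Qed.

End generated_independence.

Section sampling_independence.
Context {R : realType} {d : measure_display} {X : measurableType d}.
Context {d' : measure_display} {Omega : measurableType d'}.
Variables (n N m : nat) (Pr : probability Omega R) (P : probability X R).
Variables (e : 'I_N -> Omega -> 'rV[R]_n) (xi : 'I_N -> 'I_m -> Omega -> X).
Hypothesis hs : ardfds_sampling Pr P e xi.

Definition cylinder (A : 'I_N -> set 'rV[R]_n) (B : 'I_N -> 'I_m -> set X) : set Omega :=
  [set w | (forall k, A k (e k w)) /\ (forall k i, B k i (xi k i w))].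

(* The events determined by all the draws except e k0, respectively xi k0 i0. *)
Definition cylinders_but_e (k0 : 'I_N) : set (set Omega) :=
  [set C | exists A B, [/\ forall k, measurable (A k), forall k i, measurable (B k i),
    A k0 = setT & C = cylinder A B]].

Definition cylinders_but_xi (k0 : 'I_N) (i0 : 'I_m) : set (set Omega) :=
  [set C | exists A B, [/\ forall k, measurable (A k), forall k i, measurable (B k i),
    B k0 i0 = setT & C = cylinder A B]].

Let preim {dT} {T : measurableType dT} (f : Omega -> T) B :
  measurable_fun setT f -> measurable B -> measurable (f @^-1` B).
Proof. by move=> mf mB; rewrite -[X in measurable X]setTI; exact: mf. Qed.

Lemma cylinderI A B A' B' :
  cylinder A B `&` cylinder A' B' =
  cylinder (fun k => A k `&` A' k) (fun k i => B k i `&` B' k i).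
Proof.
apply/seteqP; split => w.
  by move=> [[a b] [a' b']]; split.
by move=> [ab cd]; split; split=> [k|k i]; [have [] := ab k|have [] := cd k i
  |have [] := ab k|have [] := cd k i].
Qed.

Lemma measurable_cylinder A B : (forall k, measurable (A k)) ->
  (forall k i, measurable (B k i)) -> measurable (cylinder A B).
Proof.
move=> mA mB.
have -> : cylinder A B = (\bigcap_(k in [set: 'I_N]) e k @^-1` A k) `&`
   (\bigcap_(k in [set: 'I_N]) \bigcap_(i in [set: 'I_m]) xi k i @^-1` B k i).
  apply/seteqP; split => w [a b]; split.
  - by move=> k _; exact: a.
  - by move=> k _ i _; exact: b.
  - by move=> k; exact: a.
  - by move=> k i; exact: b.
apply: measurableI.
  apply: fin_bigcap_measurable => [|k _]; first exact: finite_finset.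
  exact: (preim (sm_meas_e hs k)).
apply: fin_bigcap_measurable => [|k _]; first exact: finite_finset.
apply: fin_bigcap_measurable => [|i _]; first exact: finite_finset.
exact: (preim (sm_meas_xi hs k i)).
Qed.

Section e_slot.
Variable k0 : 'I_N.

Let G := cylinders_but_e k0.

Lemma cylinders_but_e_measurable : G `<=` measurable.
Proof. by move=> _ [A [B [mA mB _ ->]]]; exact: measurable_cylinder. Qed.

Lemma cylinders_but_e_setT : G setT.
Proof.
exists (fun=> setT), (fun _ _ => setT); split => //.
by apply/seteqP; split.
Qed.

Lemma cylinders_but_e_setI : setI_closed G.
Proof.
move=> _ _ [A [B [mA mB A0 ->]]] [A' [B' [mA' mB' A0' ->]]].
rewrite cylinderI; exists (fun k => A k `&` A' k), (fun k i => B k i `&` B' k i).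
split => //; [by move=> k; exact: measurableI|by move=> k i; exact: measurableI|].
by rewrite A0 A0' setTI.
Qed.

Lemma cylinders_but_e_indep C D : G C -> measurable D ->
  (Pr (C `&` e k0 @^-1` D) = Pr C * Pr (e k0 @^-1` D))%E.
Proof.
move=> [A [B [mA mB A0 ->]]] mD.
pose A' k := if k == k0 then D else A k.
have mA' k : measurable (A' k) by rewrite /A'; case: ifP.
have -> : cylinder A B `&` e k0 @^-1` D = cylinder A' B.
  apply/seteqP; split => w.
    by move=> [[a b] D0]; split => // k; rewrite /A'; case: eqP => [->|].
  move=> [a b]; split; last by have := a k0; rewrite /A' eqxx.
  split => // k; have := a k; rewrite /A'; case: eqP => [->|//].
  by rewrite A0.
rewrite !(sm_indep hs)// (bigD1 k0)//= [in RHS](bigD1 k0)//= A0.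
rewrite preimage_setT probability_setT mul1e.
rewrite {1}/A' eqxx -muleA muleC; congr (_ * _ * _)%E.
by apply: eq_bigr => k kk0; rewrite /A' (negPf kk0).
Qed.

Let GT := g_sigma_algebraType G.

Lemma measurable_e_but_e k : k != k0 -> measurable_fun setT (e k : GT -> 'rV[R]_n).
Proof.
move=> kk0 _ D mD; rewrite setTI; apply: sub_sigma_algebra.
exists (fun j => if j == k then D else setT), (fun _ _ => setT); split => //.
- by move=> j; case: ifP.
- by rewrite eq_sym (negPf kk0).
apply/seteqP; split => w.
  by move=> Dw; split => // j; case: eqP => [->|].
by move=> [h _]; have := h k; rewrite eqxx.
Qed.

Lemma measurable_xi_but_e k i : measurable_fun setT (xi k i : GT -> X).
Proof.
move=> _ D mD; rewrite setTI; apply: sub_sigma_algebra.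
exists (fun=> setT), (fun j l => if (j == k) && (l == i) then D else setT).
split => //; first by move=> j l; case: ifP.
apply/seteqP; split => w.
  by move=> Dw; split => // j l; case: ifP => // /andP[/eqP -> /eqP ->].
by move=> [_ h]; have := h k i; rewrite !eqxx.
Qed.

(** Measurability for [GT] expresses that [U] is a function of the other draws without naming that
    function. *)
Lemma indep_e {dT} {T : measurableType dT} (U : Omega -> T) :
  measurable_fun setT (U : GT -> T) ->
  measurable_fun setT U /\ forall A B, measurable A -> measurable B ->
  (Pr (U @^-1` A `&` e k0 @^-1` B) = Pr (U @^-1` A) * Pr (e k0 @^-1` B))%E.
Proof.
move=> mU; split.
  by apply: (measurableT_comp mU); exact: (measurable_id_generated cylinders_but_e_measurable).
move=> A B mA mB; apply: (generated_indep (sm_meas_e hs k0) cylinders_but_e_measurable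
  cylinders_but_e_setT cylinders_but_e_setI cylinders_but_e_indep) => //.
by have := mU measurableT A mA; rewrite setTI.
Qed.

End e_slot.

Section xi_slot.
Variables (k0 : 'I_N) (i0 : 'I_m).

Let G := cylinders_but_xi k0 i0.

Lemma cylinders_but_xi_measurable : G `<=` measurable.
Proof. by move=> _ [A [B [mA mB _ ->]]]; exact: measurable_cylinder. Qed.

Lemma cylinders_but_xi_setT : G setT.
Proof.
exists (fun=> setT), (fun _ _ => setT); split => //.
by apply/seteqP; split.
Qed.

Lemma cylinders_but_xi_setI : setI_closed G.
Proof.
move=> _ _ [A [B [mA mB A0 ->]]] [A' [B' [mA' mB' A0' ->]]].
rewrite cylinderI; exists (fun k => A k `&` A' k), (fun k i => B k i `&` B' k i).
split => //; [by move=> k; exact: measurableI|by move=> k i; exact: measurableI|].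
by rewrite A0 A0' setTI.
Qed.

Lemma cylinders_but_xi_indep C D : G C -> measurable D ->
  (Pr (C `&` xi k0 i0 @^-1` D) = Pr C * Pr (xi k0 i0 @^-1` D))%E.
Proof.
move=> [A [B [mA mB B0 ->]]] mD.
pose B' k i := if (k == k0) && (i == i0) then D else B k i.
have mB' k i : measurable (B' k i) by rewrite /B'; case: ifP.
have -> : cylinder A B `&` xi k0 i0 @^-1` D = cylinder A B'.
  apply/seteqP; split => w.
    by move=> [[a b] D0]; split => // k i; rewrite /B'; case: ifP => // /andP[/eqP -> /eqP ->].
  move=> [a b]; split; last by have := b k0 i0; rewrite /B' !eqxx.
  split => // k i; have := b k i; rewrite /B'; case: ifP => // /andP[/eqP -> /eqP ->].
  by rewrite B0.
rewrite !(sm_indep hs)// -muleA; congr (_ * _)%E.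
rewrite (bigD1 k0)//= [in RHS](bigD1 k0)//= (bigD1 i0)//= [in RHS](bigD1 i0)//= B0.
rewrite preimage_setT probability_setT mul1e.
rewrite {1}/B' !eqxx/= -!muleA [LHS]muleC -!muleA; congr (_ * _)%E.
  by apply: eq_bigr => i ii0; rewrite /B' (negPf ii0) andbF.
congr (_ * _)%E.
by apply: eq_bigr => k kk0; apply: eq_bigr => i _; rewrite /B' (negPf kk0).
Qed.

Let GT := g_sigma_algebraType G.

Lemma measurable_e_but_xi k : measurable_fun setT (e k : GT -> 'rV[R]_n).
Proof.
move=> _ D mD; rewrite setTI; apply: sub_sigma_algebra.
exists (fun j => if j == k then D else setT), (fun _ _ => setT); split => //.
- by move=> j; case: ifP.
apply/seteqP; split => w.
  by move=> Dw; split => // j; case: eqP => [->|].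
by move=> [h _]; have := h k; rewrite eqxx.
Qed.

Lemma measurable_xi_but_xi k i : (k, i) != (k0, i0) ->
  measurable_fun setT (xi k i : GT -> X).
Proof.
move=> ki _ D mD; rewrite setTI; apply: sub_sigma_algebra.
exists (fun=> setT), (fun j l => if (j == k) && (l == i) then D else setT).
split => //; first by move=> j l; case: ifP.
  by case: ifP => // /andP[/eqP k0k /eqP i0i]; rewrite k0k i0i eqxx in ki.
apply/seteqP; split => w.
  by move=> Dw; split => // j l; case: ifP => // /andP[/eqP -> /eqP ->].
by move=> [_ h]; have := h k i; rewrite !eqxx.
Qed.

Lemma indep_xi {dT} {T : measurableType dT} (U : Omega -> T) :
  measurable_fun setT (U : GT -> T) ->
  measurable_fun setT U /\ forall A B, measurable A -> measurable B ->
  (Pr (U @^-1` A `&` xi k0 i0 @^-1` B) = Pr (U @^-1` A) * Pr (xi k0 i0 @^-1` B))%E.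
Proof.
move=> mU; split.
  by apply: (measurableT_comp mU); exact: (measurable_id_generated cylinders_but_xi_measurable).
move=> A B mA mB; apply: (generated_indep (sm_meas_xi hs k0 i0) cylinders_but_xi_measurable
  cylinders_but_xi_setT cylinders_but_xi_setI cylinders_but_xi_indep) => //.
by have := mU measurableT A mA; rewrite setTI.
Qed.

End xi_slot.
End sampling_independence.

(** * Moments over one fresh direction or one fresh sample *)

Section sampling_moments.
Context {R : realType} {d : measure_display} {X : measurableType d}.
Context {d' : measure_display} {Omega : measurableType d'}.
Variables (n N m : nat) (Pr : probability Omega R) (P : probability X R).
Variables (e : 'I_N -> Omega -> 'rV[R]_n) (xi : 'I_N -> 'I_m -> Omega -> X).
Hypotheses (hs : ardfds_sampling Pr P e xi) (n8 : (8 <= n)%N).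

Section direction.
Variable k : 'I_N.

Let e' : {mfun Omega >-> 'rV[R]_n} :=
  HB.pack (e k) (isMeasurableFun.Build _ _ _ _ _ (sm_meas_e hs k)).

Let mu : probability 'rV[R]_n R := distribution Pr e'.

Let mu_unif : uniform_on_sphere mu.
Proof. exact: sm_law_e hs k. Qed.

Let GT := g_sigma_algebraType (cylinders_but_e e xi k).

Lemma Er_direction {dT} {T : measurableType dT} (U : Omega -> T) (h : T * 'rV[R]_n -> R)
    (H : T -> R) :
  measurable_fun setT (U : GT -> T) -> measurable_fun setT h -> (forall u, 0 <= h u) ->
  (forall u, rint mu (fun v => h (u, v)) /\ Er mu (fun v => h (u, v)) = H u) ->
  rint Pr (fun w => H (U w)) ->
  rint Pr (fun w => h (U w, e k w)) /\
  Er Pr (fun w => h (U w, e k w)) = Er Pr (fun w => H (U w)).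
Proof.
move=> mU mh h0 hH rH; have [mU' ind] := indep_e hs mU.
have E : (fun w => Er mu (fun v => h (U w, v))) = (fun w => H (U w)).
  by apply/funext => w; have [] := hH (U w).
rewrite -E; apply: (Er_indep_ge0 mU' (sm_meas_e hs k)) => //.
- by move=> u; have [] := hH u.
- by rewrite E.
Qed.

Let Kbound p : p \in [:: 1%N; 2%N] ->
  rint mu (@dualsq R n p) /\ Er mu (@dualsq R n p) <= 8 / 3 * rho p n.
Proof. exact: Er_dualsq_le. Qed.

Lemma Er_dotv_direction_sqr (v : Omega -> 'rV[R]_n) :
  measurable_fun setT (v : GT -> 'rV[R]_n) -> rint Pr (fun w => dotv (v w) (v w)) ->
  rint Pr (fun w => dotv (v w) (e k w) ^+ 2) /\
  Er Pr (fun w => dotv (v w) (e k w) ^+ 2) = n%:R^-1 * Er Pr (fun w => dotv (v w) (v w)).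
Proof.
move=> mv rv; rewrite -ErZ//.
apply: (@Er_direction _ _ v (fun u => dotv u.1 u.2 ^+ 2) (fun u => n%:R^-1 * dotv u u)) => //.
- by apply: measurable_funX; exact: measurable_fun_dotv.
- by move=> u; exact: sqr_ge0.
- move=> u; have [r E] := sphere_moment mu_unif u u.
  by split; [exact: r|rewrite mulrC; exact: E].
- exact: rintZ.
Qed.

Lemma Er_dotv_direction_dualsq p (v : Omega -> 'rV[R]_n) : p \in [:: 1%N; 2%N] ->
  measurable_fun setT (v : GT -> 'rV[R]_n) -> rint Pr (fun w => dotv (v w) (v w)) ->
  rint Pr (fun w => dotv (v w) (e k w) ^+ 2 * dualsq p (e k w)) /\
  Er Pr (fun w => dotv (v w) (e k w) ^+ 2 * dualsq p (e k w)) <=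
    8 / 3 * rho p n / n%:R * Er Pr (fun w => dotv (v w) (v w)).
Proof.
move=> hp mv rv; have [_ K] := Kbound hp.
have [||||r ->] := @Er_direction _ _ v (fun u => dotv u.1 u.2 ^+ 2 * dualsq p u.2)
  (fun u => Er mu (@dualsq R n p) / n%:R * dotv u u) mv.
- apply: measurable_funM; first by apply: measurable_funX; exact: measurable_fun_dotv.
  by apply: (measurableT_comp (@measurable_dualsq R n p)).
- by move=> u; rewrite mulr_ge0 ?sqr_ge0 ?dualsq_ge0.
- move=> u; have [r E] := sphere_dualsq_moment mu_unif p u.
  by split; [exact: r|rewrite E; ring].
- exact: rintZ.
split => //; rewrite ErZ//; apply: ler_wpM2r.
  by apply: Er_ge0 => w; exact: dotv_ge0.
by rewrite ler_wpM2r// invr_ge0.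
Qed.

Lemma Er_direction_dualsq p (c : Omega -> R) : p \in [:: 1%N; 2%N] ->
  measurable_fun setT (c : GT -> R) -> (forall w, 0 <= c w) -> rint Pr c ->
  rint Pr (fun w => c w * dualsq p (e k w)) /\
  Er Pr (fun w => c w * dualsq p (e k w)) <= 8 / 3 * rho p n * Er Pr c.
Proof.
move=> hp mc c0 rc; have [rd K] := Kbound hp.
(* The absolute value makes the integrand nonnegative for all real arguments, as [Er_direction]
   asks; on the values of [c] it changes nothing. *)
have [||||r E] := @Er_direction _ _ c (fun u => `|u.1| * dualsq p u.2)
  (fun u => Er mu (@dualsq R n p) * `|u|) mc.
- apply: measurable_funM; first exact: measurableT_comp.
  by apply: (measurableT_comp (@measurable_dualsq R n p)).
- by move=> u; rewrite mulr_ge0 ?dualsq_ge0.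
- by move=> u; split; [exact: (rintZ `|u| rd)|rewrite /= ErZ// mulrC].
- by apply: rintZ; exact: rint_norm.
have E1 : (fun w => c w * dualsq p (e k w)) = (fun w => `|c w| * dualsq p (e k w)).
  by apply/funext => w; rewrite ger0_norm.
have E2 : (fun w => `|c w|) = c by apply/funext => w; rewrite ger0_norm.
rewrite E1; split => //; rewrite E ErZ; last by rewrite E2.
rewrite E2; apply: ler_wpM2r => //; exact: Er_ge0.
Qed.

(** Polarization: the product has no sign, so the averaging of squares is applied to [u], [v] and
    [u + v]. *)
Lemma Er_dotv_direction_pair (u v : Omega -> 'rV[R]_n) :
  measurable_fun setT (u : GT -> 'rV[R]_n) -> measurable_fun setT (v : GT -> 'rV[R]_n) ->
  rint Pr (fun w => dotv (u w) (u w)) -> rint Pr (fun w => dotv (v w) (v w)) ->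
  rint Pr (fun w => dotv (u w) (e k w) * dotv (v w) (e k w)) /\
  Er Pr (fun w => dotv (u w) (e k w) * dotv (v w) (e k w)) =
    n%:R^-1 * Er Pr (fun w => dotv (u w) (v w)).
Proof.
move=> mu' mv ru rv; have mk := sm_meas_e hs k.
have [mU _] := indep_e hs mu'; have [mV _] := indep_e hs mv.
have [ru1 Eu] := Er_dotv_direction_sqr mu' ru.
have [rv1 Ev] := Er_dotv_direction_sqr mv rv.
have rp : rint Pr (fun w => dotv (u w) (e k w) * dotv (v w) (e k w)).
  by apply: rintM => //; exact: measurable_fun_dotv.
have rs : rint Pr (fun w => (dotv (u w) (e k w) + dotv (v w) (e k w)) ^+ 2).
  by apply: rint_sqrD => //; exact: measurable_fun_dotv.
have ruv : rint Pr (fun w => dotv (u w) (v w)).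
  apply: (@rint_le _ _ _ _ _ (fun w => dotv (u w) (u w) + dotv (v w) (v w))).
  - exact: measurable_fun_dotv.
  - exact: rintD.
  move=> w; have := dotv_ge0 (u w - v w); have := dotv_ge0 (u w + v w).
  have := dotv_ge0 (u w); have := dotv_ge0 (v w).
  rewrite !(dotvBl, dotvBr, dotvDl, dotvDr) (dotvC (v w)) ler_norml => *.
  by apply/andP; split; lra.
have rd : rint Pr (fun w => dotv (u w + v w) (u w + v w)).
  rewrite (_ : (fun w => _) = (fun w => dotv (u w) (u w) + dotv (v w) (v w) +
    2 * dotv (u w) (v w))).
    by apply: rintD; [exact: rintD|exact: rintZ].
  by apply/funext => w; rewrite !(dotvDl, dotvDr) (dotvC (v w)); ring.
have [_] := Er_dotv_direction_sqr (measurable_fun_addv mu' mv) rd.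
have -> : (fun w => dotv (u w + v w) (e k w) ^+ 2) = (fun w => dotv (u w) (e k w) ^+ 2 +
    dotv (v w) (e k w) ^+ 2 + 2 * (dotv (u w) (e k w) * dotv (v w) (e k w))).
  by apply/funext => w; rewrite dotvDl; ring.
have -> : (fun w => dotv (u w + v w) (u w + v w)) = (fun w => dotv (u w) (u w) +
    dotv (v w) (v w) + 2 * dotv (u w) (v w)).
  by apply/funext => w; rewrite !(dotvDl, dotvDr) (dotvC (v w)); ring.
have r1 := rintD ru1 rv1; have r2 := rintZ 2 rp; have r3 := rintD ru rv.
have r4 := rintZ 2 ruv.
rewrite (ErD r1 r2) (ErD ru1 rv1) (ErZ _ rp) (ErD r3 r4) (ErD ru rv) (ErZ _ ruv) Eu Ev.
by move=> h; split => //; lra.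
Qed.

End direction.

Section samples.
Variables (F : 'rV[R]_n -> X -> R) (g : 'rV[R]_n -> X -> 'rV[R]_n).
Variables (L : X -> R) (L2 sigma : R).
Hypothesis hprob : stochastic_problem P F g L L2 sigma.
Variables (k : 'I_N) (i : 'I_m).

Let GT := g_sigma_algebraType (cylinders_but_xi e xi k i).

Let f := objective P F.

Let lawxi B : measurable B -> Pr (xi k i @^-1` B) = P B.
Proof. exact: sm_law_xi hs k i B. Qed.

Lemma ae_sample (Q : X -> Prop) : {ae P, forall s, Q s} -> {ae Pr, forall w, Q (xi k i w)}.
Proof.
move=> [A [mA A0 hA]]; exists (xi k i @^-1` A); split.
- by rewrite -[X in measurable X]setTI; exact: (sm_meas_xi hs k i).
- by rewrite lawxi.
- by move=> w nQ; exact: hA.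
Qed.

Lemma Er_sample_lipschitz : rint Pr (fun w => L (xi k i w) ^+ 2) /\
  Er Pr (fun w => L (xi k i w) ^+ 2) <= L2 ^+ 2.
Proof.
have [rL EL] := lipschitz_sqr hprob; have mL := sp_measL hprob.
have mx := sm_meas_xi hs k i.
have iE : (\int[Pr]_w (L (xi k i w) ^+ 2)%:E = \int[P]_s (L s ^+ 2)%:E)%E.
  rewrite -[LHS](@ge0_integral_pushforward _ _ _ _ R _ mx Pr setT
    (fun s => (L s ^+ 2)%:E))//.
  - by apply: eq_measure_integral => B mB _; exact: lawxi.
  - by apply/measurable_EFinP; exact: measurable_funX.
  - by move=> s _; rewrite lee_fin sqr_ge0.
apply: Er_le_fin.
- by apply: measurable_funX; exact: measurableT_comp.
- by move=> w; exact: sqr_ge0.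
- by rewrite iE -(ErE rL) lee_fin.
Qed.

Let meas_diff {dT} {T : measurableType dT} (a : T -> 'rV[R]_n) (b : T -> X) :
  measurable_fun setT a -> measurable_fun setT b ->
  measurable_fun setT (fun u => g (a u) (b u) - grad f (a u)).
Proof.
move=> ma mb; apply: measurable_fun_subv.
  by apply: (measurableT_comp (sp_measg hprob) (measurable_fun_pair ma mb)).
exact: (measurableT_comp (measurable_grad_objective hprob) ma).
Qed.

Lemma Er_sample_variance (x : Omega -> 'rV[R]_n) :
  measurable_fun setT (x : GT -> 'rV[R]_n) ->
  let D w := g (x w) (xi k i w) - grad f (x w) in
  rint Pr (fun w => dotv (D w) (D w)) /\ Er Pr (fun w => dotv (D w) (D w)) <= sigma ^+ 2.
Proof.
move=> mx D; have [mx' ind] := indep_xi hs mx.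
pose D' (u : 'rV[R]_n * X) := g u.1 u.2 - grad f u.1.
have var u := sample_grad_variance hprob u.
have mD' : measurable_fun setT D' by exact: meas_diff.
have mD2 : measurable_fun setT (fun u => dotv (D' u) (D' u)) by exact: measurable_fun_dotv.
have mE := measurable_Er P mD2.
have rE : rint Pr (fun w => Er P (fun s => dotv (D' (x w, s)) (D' (x w, s)))).
  apply: (rint_le _ (rint_cst Pr (sigma ^+ 2))).
    exact: (measurableT_comp mE mx').
  move=> w; rewrite ger0_norm; first by have [] := var (x w).
  by apply: Er_ge0 => s; exact: dotv_ge0.
have [||r E] := Er_indep_ge0 mx' (sm_meas_xi hs k i) lawxi ind mD2 _ _ rE.
- by move=> u; exact: dotv_ge0.
- by move=> u; have [] := var u.
split; first exact: r.
rewrite [leLHS]E -[leRHS](Er_cst Pr); apply: Er_le => //; first exact: rint_cst.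
by move=> w; have [] := var (x w).
Qed.

(** Only the sample [xi k i] is averaged, with [x] and [c] frozen; hence [c] may depend on the
    direction and on the other samples of the same iteration. *)
Lemma Er_sample_centered (x c : Omega -> 'rV[R]_n) :
  measurable_fun setT (x : GT -> 'rV[R]_n) -> measurable_fun setT (c : GT -> 'rV[R]_n) ->
  rint Pr (fun w => dotv (g (x w) (xi k i w) - grad f (x w)) (c w)) ->
  Er Pr (fun w => dotv (g (x w) (xi k i w) - grad f (x w)) (c w)) = 0.
Proof.
move=> mx mc r; have [mU ind] := indep_xi hs (measurable_fun_pair mx mc).
pose h (u : ('rV[R]_n * 'rV[R]_n) * X) := dotv (g u.1.1 u.2 - grad f u.1.1) u.1.2.
have m11 : measurable_fun setT (fun u : ('rV[R]_n * 'rV[R]_n) * X => u.1.1).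
  exact: (measurableT_comp measurable_fst measurable_fst).
have m12 : measurable_fun setT (fun u : ('rV[R]_n * 'rV[R]_n) * X => u.1.2).
  exact: (measurableT_comp measurable_snd measurable_fst).
have mh : measurable_fun setT h.
  by apply: measurable_fun_dotv => //; apply: meas_diff.
have [_ E] := Er_indep mU (sm_meas_xi hs k i) lawxi ind mh r.
rewrite [LHS]E -[RHS](Er_cst Pr); congr Er; apply/funext => w.
by have [] := Er_centered_sample_grad hprob (x w) (c w).
Qed.

End samples.
End sampling_moments.

(** * One iteration of the algorithm *)

Section run_measurability.
Context {R : realType} {d : measure_display} {X : measurableType d}.
Context {d' : measure_display} {Omega : measurableType d'}.
Variables (n p N m : nat) (Ft : 'rV[R]_n -> X -> R) (L2 t : R) (x0 : 'rV[R]_n).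
Variables (e : 'I_N -> Omega -> 'rV[R]_n) (xi : 'I_N -> 'I_m -> Omega -> X).
Variables (x y z : nat -> Omega -> 'rV[R]_n).
Hypotheses (n8 : (8 <= n)%N) (hp : p \in [:: 1%N; 2%N]).
Hypothesis hrun : ardfds_run p Ft L2 t x0 e xi x y z.
Hypothesis mFt : measurable_fun setT (fun u : 'rV[R]_n * X => Ft u.1 u.2).

Definition slope (k : 'I_N) (w : Omega) : R :=
  m%:R^-1 * \sum_i (Ft (x k.+1 w + t *: e k w) (xi k i w) - Ft (x k.+1 w) (xi k i w)) / t.

Lemma ardfds_gradE k w : ardfds_grad Ft t e xi x k w = slope k w *: e k w.
Proof.
rewrite /ardfds_grad /grad_approx; congr (_ *: _).
by rewrite /slope /oracle_answers big_map big_enum/=.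
Qed.

Lemma run_y_slope (k : 'I_N) w :
  y k.+1 w = x k.+1 w - ((2 * L2)^-1 * slope k w) *: e k w.
Proof. by rewrite (run_y hrun) ardfds_gradE scalerA. Qed.

Lemma run_z_min (k : 'I_N) w :
  is_minimizer (fun v => step_alpha n p L2 k.+1 * n%:R *
    dotv (slope k w *: e k w) (v - z k w) + bregman p (z k w) v) (z k.+1 w).
Proof. by have := run_z hrun k w; rewrite ardfds_gradE. Qed.

Section relative.
Context {dT} {T : measurableType dT} (phi : T -> Omega).

Let mFt2 (a : T -> 'rV[R]_n) (b : T -> X) : measurable_fun setT a ->
  measurable_fun setT b -> measurable_fun setT (fun w => Ft (a w) (b w)).
Proof. by move=> ma mb; apply: (measurableT_comp mFt (measurable_fun_pair ma mb)). Qed.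

Lemma measurable_step_x (k : 'I_N) : measurable_fun setT (fun w => y k (phi w)) ->
  measurable_fun setT (fun w => z k (phi w)) ->
  measurable_fun setT (fun w => x k.+1 (phi w)).
Proof.
move=> my mz; under eq_fun do rewrite (run_x hrun).
by apply: measurable_fun_addv; apply: measurable_fun_scalev.
Qed.

Lemma measurable_slope (k : 'I_N) : measurable_fun setT (fun w => x k.+1 (phi w)) ->
  measurable_fun setT (fun w => e k (phi w)) ->
  (forall i, measurable_fun setT (fun w => xi k i (phi w))) ->
  measurable_fun setT (fun w => slope k (phi w)).
Proof.
move=> mx me mxi; apply: measurable_funM => //; apply: measurable_sum => i.
apply: measurable_funM => //; apply: measurable_funB; apply: mFt2 => //.
by apply: measurable_fun_addv => //; apply: measurable_fun_scalev.
Qed.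

(** [phi] is the identity of [Omega], whose source carries either the full sigma-algebra or one that
    omits a draw of iteration [k]; one induction serves all three cases. The mirror image of [z] is
    treated before [z] itself. *)
Lemma measurable_run (k : nat) : (k <= N)%N ->
  (forall j : 'I_N, (j < k)%N -> measurable_fun setT (fun w => e j (phi w))) ->
  (forall (j : 'I_N) i, (j < k)%N -> measurable_fun setT (fun w => xi j i (phi w))) ->
  [/\ measurable_fun setT (fun w => y k (phi w)),
      measurable_fun setT (fun w => z k (phi w)) &
      measurable_fun setT (fun w => pgrad p (z k (phi w)))].
Proof.
elim: k => [|k ih] kN me mxi.
  have E w : [/\ x 0%N w = x0, y 0%N w = x0 & z 0%N w = x0] by exact: run_init hrun w.
  split.
  - rewrite (_ : (fun w => y 0%N (phi w)) = fun=> x0); first exact: measurable_cst.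
    by apply/funext => w; have [] := E (phi w).
  - rewrite (_ : (fun w => z 0%N (phi w)) = fun=> x0); first exact: measurable_cst.
    by apply/funext => w; have [] := E (phi w).
  - rewrite (_ : (fun w => pgrad p (z 0%N (phi w))) = fun=> pgrad p x0).
      exact: measurable_cst.
    by apply/funext => w; have [_ _ ->] := E (phi w).
have [||my mz mu] := ih (ltnW kN).
- by move=> j jk; apply: me; exact: ltnW.
- by move=> j i jk; apply: mxi; exact: ltnW.
pose k' := Ordinal kN.
have mek : measurable_fun setT (fun w => e k' (phi w)) by exact: me.
have mx : measurable_fun setT (fun w => x k'.+1 (phi w)) by exact: measurable_step_x.
have ms : measurable_fun setT (fun w => slope k' (phi w)).
  by apply: measurable_slope => // i; exact: mxi.
have mu' : measurable_fun setT (fun w => pgrad p (z k'.+1 (phi w))).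
  rewrite (_ : (fun w => _) = (fun w => pgrad p (z k' (phi w)) -
    (step_alpha n p L2 k'.+1 * n%:R) *: (slope k' (phi w) *: e k' (phi w)))).
    by apply: measurable_fun_subv => //; do 2 apply: measurable_fun_scalev => //.
  by apply/funext => w; exact: (mirror_pgrad n8 hp (run_z_min k' (phi w))).
split => //.
  under eq_fun do rewrite (run_y_slope k').
  apply: measurable_fun_subv => //; apply: measurable_fun_scalev => //.
  exact: measurable_funM.
have [J mJ JK] := @pgrad_measurable_inverse R n n8 p.
by under eq_fun do rewrite -[z _ _]JK; exact: (measurableT_comp mJ mu').
Qed.

Lemma measurable_bregman (v : 'rV[R]_n) (k : nat) :
  measurable_fun setT (fun w => z k (phi w)) ->
  measurable_fun setT (fun w => pgrad p (z k (phi w))) ->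
  measurable_fun setT (fun w => bregman p (z k (phi w)) v).
Proof.
move=> mz mu; rewrite /bregman; apply: measurable_funB.
  apply: measurable_funB => //.
  exact: (measurableT_comp (@measurable_prox R n p) mz).
under eq_fun do rewrite grad_prox//.
by apply: measurable_fun_dotv => //; exact: measurable_fun_subv.
Qed.

End relative.
End run_measurability.

Lemma sqr_mean_le (R : realFieldType) (m : nat) (r : 'I_m -> R) : (0 < m)%N ->
  (m%:R^-1 * \sum_i r i) ^+ 2 <= m%:R^-1 * \sum_i r i ^+ 2.
Proof.
move=> m0; have m0' : m%:R != 0 :> R by rewrite pnatr_eq0 -lt0n.
set c := m%:R^-1 * _.
have : 0 <= \sum_i (r i - c) ^+ 2 by apply: sumr_ge0 => i _; exact: sqr_ge0.
have -> : \sum_i (r i - c) ^+ 2 = \sum_i r i ^+ 2 - m%:R * c ^+ 2.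
  transitivity (\sum_i (r i ^+ 2 - 2 * c * r i + c ^+ 2)).
    by apply: eq_bigr => i _; ring.
  rewrite big_split sumrB/= -mulr_sumr sumr_const card_ord -[_ *+ m]mulr_natl.
  have -> : \sum_i r i = m%:R * c by rewrite /c mulVKf.
  by ring.
rewrite subr_ge0 => h; have mp : 0 < m%:R :> R by rewrite ltr0n.
by rewrite -(ler_pM2l mp) mulVKf.
Qed.

Section vector_integrability.
Context {R : realType} {n : nat} {d : measure_display} {T : measurableType d}.
Variable P : probability T R.
Implicit Types u v : T -> 'rV[R]_n.

Lemma rint_dotvD u v : measurable_fun setT u -> measurable_fun setT v ->
  rint P (fun w => dotv (u w) (u w)) -> rint P (fun w => dotv (v w) (v w)) ->
  rint P (fun w => dotv (u w + v w) (u w + v w)).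
Proof.
move=> mu mv ru rv.
apply: (@rint_le _ _ _ _ _ (fun w => 2 * dotv (u w) (u w) + 2 * dotv (v w) (v w))).
- by apply: measurable_fun_dotv; exact: measurable_fun_addv.
- by apply: rintD; exact: rintZ.
move=> w; rewrite ger0_norm ?dotv_ge0//.
have := dotv_ge0 (u w - v w); rewrite !(dotvBl, dotvBr, dotvDl, dotvDr) (dotvC (v w)).
by lra.
Qed.

Lemma rint_dotv u v : measurable_fun setT u -> measurable_fun setT v ->
  rint P (fun w => dotv (u w) (u w)) -> rint P (fun w => dotv (v w) (v w)) ->
  rint P (fun w => dotv (u w) (v w)).
Proof.
move=> mu mv ru rv.
apply: (@rint_le _ _ _ _ _ (fun w => dotv (u w) (u w) + dotv (v w) (v w))).
- exact: measurable_fun_dotv.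
- exact: rintD.
move=> w; have := dotv_ge0 (u w - v w); have := dotv_ge0 (u w + v w).
have := dotv_ge0 (u w); have := dotv_ge0 (v w).
rewrite !(dotvBl, dotvBr, dotvDl, dotvDr) (dotvC (v w)) ler_norml => *.
by apply/andP; split; lra.
Qed.

Lemma rint_dotvZ c u : rint P (fun w => dotv (u w) (u w)) ->
  rint P (fun w => dotv (c *: u w) (c *: u w)).
Proof.
move=> ru; rewrite (_ : (fun w => _) = (fun w => c ^+ 2 * dotv (u w) (u w))).
  exact: rintZ.
by apply/funext => w; rewrite dotvZl dotvZr; ring.
Qed.

End vector_integrability.

Section rho_bounds.
Context {R : realType}.

Lemma rho_gt0 p n : (8 <= n)%N -> p \in [:: 1%N; 2%N] -> 0 < rho p n :> R.
Proof.
move=> n8; rewrite !inE => /orP[/eqP ->|/eqP ->]; last by rewrite rho2.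
rewrite rho1 divr_gt0 ?ltr0n ?(leq_trans _ n8)//.
by have := @ln_dim_ge2 R n n8; lra.
Qed.

End rho_bounds.

Section one_step.
Context {R : realType} {d : measure_display} {X : measurableType d}.
Context {d' : measure_display} {Omega : measurableType d'}.
Variables (n p N m : nat) (Pr : probability Omega R) (P : probability X R).
Variables (F eta : 'rV[R]_n -> X -> R) (g : 'rV[R]_n -> X -> 'rV[R]_n) (L : X -> R).
Variables (L2 sigma Delta t : R) (x0 xs : 'rV[R]_n).
Variables (e : 'I_N -> Omega -> 'rV[R]_n) (xi : 'I_N -> 'I_m -> Omega -> X).
Variables (x y z : nat -> Omega -> 'rV[R]_n).
Hypotheses (n8 : (8 <= n)%N) (hp : p \in [:: 1%N; 2%N]) (m_gt0 : (0 < m)%N).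
Hypotheses (t_gt0 : 0 < t) (Delta_ge0 : 0 <= Delta).
Hypothesis hprob : stochastic_problem P F g L L2 sigma.
Hypothesis xs_min : is_minimizer (objective P F) xs.
Hypothesis hnoise : oracle_noise P eta Delta.
Hypothesis hs : ardfds_sampling Pr P e xi.

Let Ft (v : 'rV[R]_n) (s : X) := F v s + eta v s.

Hypothesis hrun : ardfds_run p Ft L2 t x0 e xi x y z.

Let f := objective P F.
Let L2_gt0 : 0 < L2. Proof. exact: sp_L2gt0 hprob. Qed.
Let n_gt0 : 0 < n%:R :> R. Proof. by rewrite ltr0n (leq_trans _ n8). Qed.
Let mR_gt0 : 0 < m%:R :> R. Proof. by rewrite ltr0n. Qed.
Let m_neq0 : m%:R != 0 :> R. Proof. by rewrite gt_eqF. Qed.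
Let rh_gt0 : 0 < rho p n :> R. Proof. exact: rho_gt0. Qed.

Let al_gt0 j : 0 < step_alpha n p L2 j.
Proof.
apply: divr_gt0; first by rewrite ltr0n.
by do 3 ![apply: mulr_gt0 => //]; exact: exprn_gt0.
Qed.

Let mFt : measurable_fun setT (fun u : 'rV[R]_n * X => Ft u.1 u.2).
Proof. by apply: measurable_funD; [exact: sp_measF hprob|exact: on_meas hnoise]. Qed.

Let slp := slope (m:=m) Ft t e xi x.

Section iteration.
Variable k : 'I_N.

Let gr w := grad f (x k.+1 w).
Let D i w := g (x k.+1 w) (xi k i w) - gr w.
Let a w := dotv (gr w) (e k w).
Let b w := m%:R^-1 * \sum_i dotv (D i w) (e k w).
Let th w := slp k w - a w - b w.
Let q w := dotv (z k w - xs) (e k w).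

(* The bound on the squared bias of the finite difference, one term per sample. *)
Definition bias_sqr (l : R) := 8 * Delta ^+ 2 / t ^+ 2 + 2 * t ^+ 2 * l ^+ 2.

Lemma bias_sqr_ge0 l : 0 <= bias_sqr l.
Proof.
apply: addr_ge0.
  by apply: divr_ge0; [apply: mulr_ge0 => //; exact: sqr_ge0|exact: sqr_ge0].
by apply: mulr_ge0; [apply: mulr_ge0 => //; exact: sqr_ge0|exact: sqr_ge0].
Qed.

(** Majorizes [th^2] by the samples alone. As no direction occurs in it, its product with
    [dualsq p (e k w)] factorizes under the expectation. *)
Let T2 w := m%:R^-1 * \sum_i bias_sqr (L (xi k i w)).

Let me : measurable_fun setT (e k). Proof. exact: sm_meas_e hs k. Qed.
Let mxi i : measurable_fun setT (xi k i). Proof. exact: sm_meas_xi hs k i. Qed.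

Let state_meas {dT} {T : measurableType dT} (phi : T -> Omega) :
  (forall j : 'I_N, (j < k)%N -> measurable_fun setT (fun w => e j (phi w))) ->
  (forall (j : 'I_N) i, (j < k)%N -> measurable_fun setT (fun w => xi j i (phi w))) ->
  [/\ measurable_fun setT (fun w => y k (phi w)),
      measurable_fun setT (fun w => z k (phi w)),
      measurable_fun setT (fun w => pgrad p (z k (phi w))) &
      measurable_fun setT (fun w => x k.+1 (phi w))].
Proof.
move=> h1 h2; have [my mz mu] := measurable_run n8 hp hrun mFt (ltnW (ltn_ord k)) h1 h2.
by split => //; exact: (measurable_step_x hrun).
Qed.

Let GE := g_sigma_algebraType (cylinders_but_e e xi k).

Let state_meas_e :
  [/\ measurable_fun setT (y k : GE -> 'rV[R]_n), measurable_fun setT (z k : GE -> 'rV[R]_n),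
      measurable_fun setT ((fun w => pgrad p (z k w)) : GE -> 'rV[R]_n) &
      measurable_fun setT (x k.+1 : GE -> 'rV[R]_n)].
Proof.
apply: (@state_meas _ GE (fun w => w)) => [j jk|j i jk].
  by apply: measurable_e_but_e; rewrite -val_eqE/= ltn_eqF.
exact: measurable_xi_but_e.
Qed.

Let GX i := g_sigma_algebraType (cylinders_but_xi e xi k i).

Let state_meas_xi i :
  [/\ measurable_fun setT (y k : GX i -> 'rV[R]_n), measurable_fun setT (z k : GX i -> 'rV[R]_n),
      measurable_fun setT ((fun w => pgrad p (z k w)) : GX i -> 'rV[R]_n) &
      measurable_fun setT (x k.+1 : GX i -> 'rV[R]_n)].
Proof.
apply: (@state_meas _ (GX i) (fun w => w)) => [j jk|j l jk].
  exact: measurable_e_but_xi.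
by apply: measurable_xi_but_xi; rewrite xpair_eqE -val_eqE/= ltn_eqF.
Qed.

Let state_meas_id := @state_meas _ Omega id (fun j _ => sm_meas_e hs j)
  (fun j i _ => sm_meas_xi hs j i).

Let mx : measurable_fun setT (x k.+1). Proof. by have [] := state_meas_id. Qed.
Let my : measurable_fun setT (y k). Proof. by have [] := state_meas_id. Qed.
Let mz : measurable_fun setT (z k). Proof. by have [] := state_meas_id. Qed.

Let mgr {dT} {T : measurableType dT} (v : T -> 'rV[R]_n) :
  measurable_fun setT v -> measurable_fun setT (fun w => grad f (v w)).
Proof. by move=> mv; exact: (measurableT_comp (measurable_grad_objective hprob) mv). Qed.

Let mD {dT} {T : measurableType dT} (v : T -> 'rV[R]_n) (s : T -> X) :
  measurable_fun setT v -> measurable_fun setT s ->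
  measurable_fun setT (fun w => g (v w) (s w) - grad f (v w)).
Proof.
move=> mv ms; apply: measurable_fun_subv; last exact: mgr.
exact: (measurableT_comp (sp_measg hprob) (measurable_fun_pair mv ms)).
Qed.

Let mDi i : measurable_fun setT (D i). Proof. exact: mD. Qed.
Let ma : measurable_fun setT a. Proof. by apply: measurable_fun_dotv => //; exact: mgr. Qed.
Let mb : measurable_fun setT b.
Proof.
by apply: measurable_funM => //; apply: measurable_sum => i; exact: measurable_fun_dotv.
Qed.
Let ms : measurable_fun setT (slp k).
Proof. by apply: (@measurable_slope _ _ _ _ _ _ _ _ _ _ _ _ _ mFt _ _ id). Qed.
Let mth : measurable_fun setT th.
Proof. by apply: measurable_funB => //; exact: measurable_funB. Qed.
Let mq : measurable_fun setT q.
Proof. by apply: measurable_fun_dotv => //; exact: measurable_fun_subv. Qed.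

Let e_unit : {ae Pr, forall w, dotv (e k w) (e k w) = 1}.
Proof.
have [h _] := sm_law_e hs k.
have mS : measurable (e k @^-1` [set v | norm2 v = 1]).
  rewrite (_ : _ @^-1` _ = (fun w => dotv (e k w) (e k w)) @^-1` [set 1]).
    by rewrite -[X in measurable X]setTI; apply: measurable_fun_dotv.
  apply/seteqP; split => w /= v1; first by rewrite -norm2_sqr v1 expr1n.
  by rewrite /norm2 v1 sqrtr1.
exists (~` (e k @^-1` [set v | norm2 v = 1])); split.
- exact: measurableC.
- by rewrite probability_setC// -[X in (1 - X)%E]/(pushforward Pr (e k) _) h subee.
- by move=> w /= nv v1; apply: nv; rewrite -norm2_sqr v1 expr1n.
Qed.

Let bias_le : {ae Pr, forall w, th w ^+ 2 <= T2 w}.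
Proof.
(* The exceptional set does not depend on the two points, so the bound may be used at the random
   points [x] and [x + t e]. *)
have hF : {ae Pr, forall w, forall i, forall u v,
    `|F v (xi k i w) - F u (xi k i w) - dotv (g u (xi k i w)) (v - u)| <=
    L (xi k i w) * dotv (v - u) (v - u)}.
  apply: filter_forall => i.
  exact: (ae_sample hs k i (sample_taylor hprob)).
have hE : {ae Pr, forall w, forall i, forall u, `|eta u (xi k i w)| <= Delta}.
  by apply: filter_forall => i; exact: (ae_sample hs k i (on_bound hnoise)).
apply: filterS3 e_unit hF hE => w e1 taylor bound.
pose r i := (Ft (x k.+1 w + t *: e k w) (xi k i w) - Ft (x k.+1 w) (xi k i w)) / t -
  dotv (g (x k.+1 w) (xi k i w)) (e k w).
have -> : th w = m%:R^-1 * \sum_i r i.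
  rewrite /th /slp /slope /b /a /D sumrB/= mulrBr -addrA -opprD; congr (_ - _).
  have grE : dotv (gr w) (e k w) = m%:R^-1 * (m%:R * dotv (gr w) (e k w)) by rewrite mulKf.
  rewrite grE -mulrDr; congr (_ * _).
  rewrite mulr_natl -[X in _ *+ X]card_ord -sumr_const -big_split/=.
  by apply: eq_bigr => i _; rewrite dotvBl addrC subrK.
apply: le_trans (sqr_mean_le _ m_gt0) _.
apply: ler_wpM2l; first by rewrite invr_ge0 ltW.
apply: ler_sum => i _.
have := taylor i (x k.+1 w) (x k.+1 w + t *: e k w).
rewrite [_ + _ - x k.+1 w]addrAC subrr add0r !dotvZr dotvZl e1 mulr1.
have := bound i (x k.+1 w); have := bound i (x k.+1 w + t *: e k w).
rewrite /r /Ft /bias_sqr; set F1 := F _ _; set F0 := F _ _; set h1 := eta _ _.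
set h0 := eta _ _; set G := dotv _ _; set l := L _ => b1 b0 ty.
have -> : (F1 + h1 - (F0 + h0)) / t - G = (F1 - F0 - t * G + (h1 - h0)) / t.
  by field; rewrite gt_eqF.
rewrite exprMn exprVn ler_pdivrMr ?exprn_gt0//.
have -> : (8 * Delta ^+ 2 / t ^+ 2 + 2 * t ^+ 2 * l ^+ 2) * t ^+ 2 =
    8 * Delta ^+ 2 + 2 * (l * (t * t)) ^+ 2 by field; rewrite gt_eqF.
have s1 : (F1 - F0 - t * G) ^+ 2 <= (l * (t * t)) ^+ 2.
  rewrite -real_normK ?num_real// lerXn2r ?nnegrE//; exact: le_trans ty.
have s2 : (h1 - h0) ^+ 2 <= (2 * Delta) ^+ 2.
  rewrite -real_normK ?num_real// lerXn2r ?nnegrE ?mulr_ge0//.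
  by apply: le_trans (ler_normB _ _) _; lra.
move: s1 s2; set u := F1 - F0 - t * G; set v := h1 - h0; set c := l * (t * t) => s1 s2.
have := sqr_ge0 (u - v); nra.
Qed.

Definition theta2 : R := bias_sqr L2.

Let ErT2 : rint Pr T2 /\ Er Pr T2 <= theta2.
Proof.
have rb i : rint Pr (fun w => bias_sqr (L (xi k i w))).
  apply: rintD; first exact: rint_cst.
  by apply: rintZ; have [] := Er_sample_lipschitz hs hprob k i.
have rs : rint Pr (fun w => \sum_i bias_sqr (L (xi k i w))) by exact: rint_sum.
split; first exact: rintZ.
have -> : theta2 = m%:R^-1 * (m%:R * theta2) by rewrite mulKf.
rewrite ErZ// Er_sum//.
apply: ler_wpM2l; first by rewrite invr_ge0 ltW.
rewrite mulr_natl -[X in _ *+ X]card_ord -sumr_const; apply: ler_sum => i _.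
have [rl El] := Er_sample_lipschitz hs hprob k i.
rewrite ErD; [|exact: rint_cst|exact: rintZ].
rewrite Er_cst ErZ// lerD2l; apply: ler_wpM2l => //.
by rewrite mulr_ge0// sqr_ge0.
Qed.

Hypothesis rV : rint Pr (fun w => bregman p (z k w) xs).
Hypothesis rY : rint Pr (fun w => dotv (y k w - xs) (y k w - xs)).

Let mZs : measurable_fun setT (fun w => z k w - xs).
Proof. exact: measurable_fun_subv. Qed.
Let mYs : measurable_fun setT (fun w => y k w - xs).
Proof. exact: measurable_fun_subv. Qed.
Let mXs : measurable_fun setT (fun w => x k.+1 w - xs).
Proof. exact: measurable_fun_subv. Qed.

Let rZ : rint Pr (fun w => dotv (z k w - xs) (z k w - xs)).
Proof.
apply: (rint_le _ (rintZ 9 rV)); first exact: measurable_fun_dotv.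
by move=> w; rewrite ger0_norm ?dotv_ge0//; exact: dotv_le_bregman.
Qed.

Let rX : rint Pr (fun w => dotv (x k.+1 w - xs) (x k.+1 w - xs)).
Proof.
have E w : x k.+1 w - xs = step_tau k *: (z k w - xs) + (1 - step_tau k) *: (y k w - xs).
  rewrite (run_x hrun) !scalerBr addrACA -opprD -scalerDl.
  by rewrite addrCA subrr addr0 scale1r.
under eq_fun do rewrite E.
apply: rint_dotvD; [exact: measurable_fun_scalev|exact: measurable_fun_scalev| |].
  exact: rint_dotvZ rZ.
exact: rint_dotvZ rY.
Qed.

Let rgap (v : Omega -> 'rV[R]_n) : measurable_fun setT v ->
  rint Pr (fun w => dotv (v w - xs) (v w - xs)) -> rint Pr (fun w => f (v w) - f xs).
Proof.
move=> mv rv; apply: (rint_le _ (rintZ L2 rv)).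
  apply: measurable_funB => //; exact: (measurableT_comp (measurable_objective hprob) mv).
move=> w; rewrite ger0_norm; last exact: (gap_ge0 xs_min).
exact: (gap_le_dist hprob xs_min).
Qed.

Let rgr : rint Pr (fun w => dotv (gr w) (gr w)).
Proof.
apply: (rint_le _ (rintZ (4 * L2) (rgap mx rX))).
  by apply: measurable_fun_dotv; exact: mgr.
move=> w; rewrite ger0_norm ?dotv_ge0//; exact: (grad_sqr_le_gap hprob xs_min).
Qed.

Let mgr_e : measurable_fun setT (gr : GE -> 'rV[R]_n).
Proof. by apply: mgr; have [] := state_meas_e. Qed.

Let mZs_e : measurable_fun setT ((fun w => z k w - xs) : GE -> 'rV[R]_n).
Proof. by apply: measurable_fun_subv => //; have [] := state_meas_e. Qed.

Let ra : rint Pr (fun w => a w ^+ 2) /\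
  Er Pr (fun w => a w ^+ 2) = n%:R^-1 * Er Pr (fun w => dotv (gr w) (gr w)).
Proof. exact: (Er_dotv_direction_sqr hs mgr_e rgr). Qed.

Let rad : rint Pr (fun w => a w ^+ 2 * dualsq p (e k w)) /\
  Er Pr (fun w => a w ^+ 2 * dualsq p (e k w)) <=
  8 / 3 * rho p n / n%:R * Er Pr (fun w => dotv (gr w) (gr w)).
Proof. exact: (Er_dotv_direction_dualsq hs n8 hp mgr_e rgr). Qed.

Let rq : rint Pr (fun w => q w ^+ 2) /\ Er Pr (fun w => q w ^+ 2) <=
  9 / n%:R * Er Pr (fun w => bregman p (z k w) xs).
Proof.
have [r E] := Er_dotv_direction_sqr hs mZs_e rZ; split; first exact: r.
have -> : 9 / n%:R * Er Pr (fun w => bregman p (z k w) xs) =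
    n%:R^-1 * (9 * Er Pr (fun w => bregman p (z k w) xs)) by ring.
rewrite [leLHS]E; apply: ler_wpM2l; first by rewrite invr_ge0 ltW.
rewrite -ErZ//; apply: Er_le => //; first exact: rintZ.
by move=> w; exact: dotv_le_bregman.
Qed.

Let raq : rint Pr (fun w => a w * q w) /\ Er Pr (fun w => a w * q w) =
  n%:R^-1 * Er Pr (fun w => dotv (gr w) (z k w - xs)).
Proof. exact: (Er_dotv_direction_pair hs mgr_e mZs_e rgr rZ). Qed.

Let mD_e i : measurable_fun setT (D i : GE -> 'rV[R]_n).
Proof. by apply: mD; [have [] := state_meas_e|exact: measurable_xi_but_e]. Qed.

Let rD i : rint Pr (fun w => dotv (D i w) (D i w)) /\
  Er Pr (fun w => dotv (D i w) (D i w)) <= sigma ^+ 2.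
Proof. by apply: (Er_sample_variance hs hprob (k:=k) (i:=i)); have [] := state_meas_xi i. Qed.

Let rDe i : rint Pr (fun w => dotv (D i w) (e k w) ^+ 2).
Proof. by have [] := Er_dotv_direction_sqr hs (mD_e i) (proj1 (rD i)). Qed.

Let mDe i : measurable_fun setT (fun w => dotv (D i w) (e k w)).
Proof. exact: measurable_fun_dotv. Qed.

Let rb2 (W : Omega -> R) : measurable_fun setT W -> (forall w, 0 <= W w) ->
  (forall i, rint Pr (fun w => dotv (D i w) (e k w) ^+ 2 * W w)) ->
  rint Pr (fun w => b w ^+ 2 * W w).
Proof.
move=> mW W0 rW; have rs := rintZ m%:R^-1 (rint_sum (index_enum 'I_m) rW).
apply: (rint_le _ rs).
  by apply: measurable_funM => //; exact: measurable_funX.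
move=> w; rewrite ger0_norm; last by apply: mulr_ge0 => //; exact: sqr_ge0.
rewrite /= -mulr_suml mulrA.
by apply: ler_wpM2r => //; exact: sqr_mean_le.
Qed.

Let rbq : rint Pr (fun w => b w * q w) /\ Er Pr (fun w => b w * q w) = 0.
Proof.
have r i : rint Pr (fun w => dotv (D i w) (e k w) * q w).
  by apply: rintM => //; have [] := rq.
have E : (fun w => b w * q w) = (fun w => m%:R^-1 * \sum_i dotv (D i w) (e k w) * q w).
  by apply/funext => w; rewrite /b -mulrA -mulr_suml.
have rs : rint Pr (fun w => \sum_i dotv (D i w) (e k w) * q w) by exact: rint_sum.
rewrite E; split; first exact: rintZ.
rewrite ErZ// Er_sum// big1 ?mulr0// => i _.
have Ec : (fun w => dotv (D i w) (e k w) * q w) =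
    (fun w => dotv (g (x k.+1 w) (xi k i w) - grad f (x k.+1 w)) (q w *: e k w)).
  by apply/funext => w; rewrite dotvZr mulrC.
have rr := r i; rewrite Ec in rr *.
have [_ mzx _ mxx] := state_meas_xi i.
apply: (Er_sample_centered hs hprob (k:=k) (i:=i)) => //.
have mex : measurable_fun setT (e k : GX i -> 'rV[R]_n) by exact: measurable_e_but_xi.
apply: measurable_fun_scalev => //; apply: measurable_fun_dotv => //.
exact: measurable_fun_subv.
Qed.

(** Terms with two different samples vanish by averaging over one of them with the direction frozen;
    the [m] diagonal terms against [1 / m^2] give the factor [1 / m]. The case [p' = 2], where the
    weight is 1 almost surely, yields [rb]. *)
Let rbd p' : p' \in [:: 1%N; 2%N] ->
  rint Pr (fun w => b w ^+ 2 * dualsq p' (e k w)) /\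
  Er Pr (fun w => b w ^+ 2 * dualsq p' (e k w)) <=
    8 / 3 * rho p' n / n%:R * (sigma ^+ 2 / m%:R).
Proof.
move=> hp'; have rh' : 0 < rho p' n :> R by exact: rho_gt0.
have rd i : rint Pr (fun w => dotv (D i w) (e k w) ^+ 2 * dualsq p' (e k w)) /\
    Er Pr (fun w => dotv (D i w) (e k w) ^+ 2 * dualsq p' (e k w)) <=
    8 / 3 * rho p' n / n%:R * sigma ^+ 2.
  have [r E] := Er_dotv_direction_dualsq hs n8 hp' (mD_e i) (proj1 (rD i)).
  split => //; apply: le_trans E _; apply: ler_wpM2l; last by have [] := rD i.
  by apply: divr_ge0; [apply: mulr_ge0 => //; exact: ltW|exact: ltW].
have md : measurable_fun setT (fun w => dualsq p' (e k w)).
  by apply: (measurableT_comp (@measurable_dualsq R n p')).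
have rb := rb2 md (fun w => dualsq_ge0 _ _) (fun i => proj1 (rd i)).
split => //.
pose c i j w := dotv (D i w) (e k w) * dotv (D j w) (e k w) * dualsq p' (e k w).
have rc i j : rint Pr (c i j).
  apply: (rint_le _ (rintD (proj1 (rd i)) (proj1 (rd j)))).
    by apply: measurable_funM => //; exact: measurable_funM.
  move=> w; rewrite -mulrDl normrM (ger0_norm (dualsq_ge0 _ _)).
  apply: ler_wpM2r; first exact: dualsq_ge0.
  rewrite ler_norml; set u := dotv _ _; set v := dotv _ _.
  by have := sqr_ge0 (u - v); have := sqr_ge0 (u + v); have := sqr_ge0 u;
    have := sqr_ge0 v => *; apply/andP; split; nra.
have c0 i j : j != i -> Er Pr (c i j) = 0.
  move=> ji.
  have Ec : c i j = (fun w => dotv (g (x k.+1 w) (xi k i w) - grad f (x k.+1 w))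
      ((dotv (D j w) (e k w) * dualsq p' (e k w)) *: e k w)).
    by apply/funext => w; rewrite dotvZr /c /D /gr; ring.
  have rr := rc i j; rewrite Ec in rr *.
  have [_ _ _ mxx] := state_meas_xi i.
  have mex : measurable_fun setT (e k : GX i -> 'rV[R]_n) by exact: measurable_e_but_xi.
  have mxj : measurable_fun setT (xi k j : GX i -> X).
    by apply: measurable_xi_but_xi; rewrite xpair_eqE eqxx.
  apply: (Er_sample_centered hs hprob (k:=k) (i:=i)) => //.
  apply: measurable_fun_scalev => //; apply: measurable_funM.
    by apply: measurable_fun_dotv => //; exact: mD.
  by apply: (measurableT_comp (@measurable_dualsq R n p')).
have E : (fun w => b w ^+ 2 * dualsq p' (e k w)) =
    (fun w => m%:R^-1 ^+ 2 * \sum_i \sum_j c i j w).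
  apply/funext => w; rewrite /b exprMn -mulrA; congr (_ * _).
  rewrite expr2 mulr_suml mulr_suml; apply: eq_bigr => i _.
  by rewrite mulr_sumr mulr_suml; apply: eq_bigr.
have rcs i : rint Pr (fun w => \sum_j c i j w) by exact: rint_sum.
rewrite E ErZ; last exact: rint_sum.
rewrite Er_sum//.
have h : \sum_i Er Pr (fun w => \sum_j c i j w) <=
    m%:R * (8 / 3 * rho p' n / n%:R * sigma ^+ 2).
  rewrite mulr_natl -[X in _ *+ X]card_ord -sumr_const; apply: ler_sum => i _.
  rewrite Er_sum// (bigD1 i)//= big1 ?addr0 => [|j ji]; last exact: c0.
  have -> : c i i = (fun w => dotv (D i w) (e k w) ^+ 2 * dualsq p' (e k w)).
    by apply/funext => w; rewrite /c expr2.
  by have [] := rd i.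
apply: (@le_trans _ _ (m%:R^-1 ^+ 2 * (m%:R * (8 / 3 * rho p' n / n%:R * sigma ^+ 2)))).
  by apply: ler_wpM2l => //; exact: sqr_ge0.
by rewrite le_eqVlt; apply/orP; left; apply/eqP; field; rewrite m_neq0 gt_eqF.
Qed.

Let rb : rint Pr (fun w => b w ^+ 2) /\
  Er Pr (fun w => b w ^+ 2) <= 8 / 3 / n%:R * (sigma ^+ 2 / m%:R).
Proof.
have hp2 : 2%N \in [:: 1%N; 2%N] by rewrite !inE eqxx orbT.
have [r2 E2] := rbd hp2; rewrite rho2// mulr1 in E2.
have r1 : rint Pr (fun w => b w ^+ 2 * 1).
  by apply: rb2 => // i; under eq_fun do rewrite mulr1.
under eq_fun do rewrite -[_ ^+ 2]mulr1; split => //; apply: le_trans E2.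
apply: Er_ae_le => //.
by apply: filterS e_unit => w e1; rewrite /dualsq/= e1.
Qed.

Let rth : rint Pr (fun w => th w ^+ 2) /\ Er Pr (fun w => th w ^+ 2) <= theta2.
Proof.
have [rT ET] := ErT2.
have r : rint Pr (fun w => th w ^+ 2).
  apply: (rint_ae_le _ rT); first exact: measurable_funX.
  by apply: filterS bias_le => w; rewrite ger0_norm ?sqr_ge0.
by split => //; apply: le_trans ET; apply: Er_ae_le.
Qed.

Let rthd : rint Pr (fun w => th w ^+ 2 * dualsq p (e k w)) /\
  Er Pr (fun w => th w ^+ 2 * dualsq p (e k w)) <= 8 / 3 * rho p n * theta2.
Proof.
have [rT ET] := ErT2.
have T0 w : 0 <= T2 w.
  apply: mulr_ge0; first by rewrite invr_ge0 ltW.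
  by apply: sumr_ge0 => i _; exact: bias_sqr_ge0.
have mT : measurable_fun setT (T2 : GE -> R).
  apply: measurable_funM => //; apply: measurable_sum => i.
  apply: measurable_funD => //; apply: measurable_funM => //; apply: measurable_funX.
  by apply: (measurableT_comp (sp_measL hprob)); exact: measurable_xi_but_e.
have [rTd ETd] := Er_direction_dualsq hs n8 hp mT T0 rT.
have md : measurable_fun setT (fun w => dualsq p (e k w)).
  by apply: (measurableT_comp (@measurable_dualsq R n p)).
have le : {ae Pr, forall w, th w ^+ 2 * dualsq p (e k w) <= T2 w * dualsq p (e k w)}.
  by apply: filterS bias_le => w h; apply: ler_wpM2r => //; exact: dualsq_ge0.
have r : rint Pr (fun w => th w ^+ 2 * dualsq p (e k w)).
  apply: (rint_ae_le _ rTd); first by apply: measurable_funM => //; exact: measurable_funX.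
  by apply: filterS le => w h; rewrite ger0_norm//;
    apply: mulr_ge0; [exact: sqr_ge0|exact: dualsq_ge0].
split => //; apply: le_trans (Er_ae_le r rTd le) _; apply: le_trans ETd _.
by apply: ler_wpM2l => //; apply: mulr_ge0 => //; exact: ltW.
Qed.

Let slopeE w : slp k w = a w + b w + th w.
Proof. by rewrite /th; ring. Qed.

Let slope_sqr_le w : slp k w ^+ 2 <= 2 * a w ^+ 2 + 4 * b w ^+ 2 + 4 * th w ^+ 2.
Proof.
rewrite slopeE; have := sqr_ge0 (a w - b w - th w); have := sqr_ge0 (b w - th w); nra.
Qed.

Let rs : rint Pr (fun w => slp k w ^+ 2).
Proof.
have r := rintD (rintD (rintZ 2 (proj1 ra)) (rintZ 4 (proj1 rb))) (rintZ 4 (proj1 rth)).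
apply: (rint_le _ r); first exact: measurable_funX.
by move=> w; rewrite ger0_norm ?sqr_ge0//; exact: slope_sqr_le.
Qed.

Let rsd : rint Pr (fun w => slp k w ^+ 2 * dualsq p (e k w)) /\
  Er Pr (fun w => slp k w ^+ 2 * dualsq p (e k w)) <=
  8 / 3 * rho p n * (2 * (n%:R^-1 * Er Pr (fun w => dotv (gr w) (gr w))) +
    4 * (n%:R^-1 * (sigma ^+ 2 / m%:R)) + 4 * theta2).
Proof.
have [r1 E1] := rad; have [r2 E2] := rbd hp; have [r3 E3] := rthd.
have r12 := rintD (rintZ 2 r1) (rintZ 4 r2).
have r := rintD r12 (rintZ 4 r3).
have le w : slp k w ^+ 2 * dualsq p (e k w) <=
    2 * (a w ^+ 2 * dualsq p (e k w)) + 4 * (b w ^+ 2 * dualsq p (e k w)) +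
    4 * (th w ^+ 2 * dualsq p (e k w)).
  have := ler_wpM2r (dualsq_ge0 p (e k w)) (slope_sqr_le w).
  by rewrite 2!mulrDl -!mulrA.
have rr : rint Pr (fun w => slp k w ^+ 2 * dualsq p (e k w)).
  apply: (rint_le _ r).
    apply: measurable_funM; first exact: measurable_funX.
    by apply: (measurableT_comp (@measurable_dualsq R n p)).
  by move=> w; rewrite ger0_norm//;
    apply: mulr_ge0; [exact: sqr_ge0|exact: dualsq_ge0].
split => //; apply: le_trans (Er_le rr r le) _.
rewrite (ErD r12 (rintZ 4 r3)) (ErD (rintZ 2 r1) (rintZ 4 r2)) !ErZ//.
by lra.
Qed.

(** Completing the square: with slope [a + s], the upper Taylor bound at step [1 / (2 L2)] is
    exactly [- (a^2 - s^2) / (4 L2)]. *)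
Let descent : {ae Pr, forall w, (4 * L2)^-1 * (a w ^+ 2 - (b w + th w) ^+ 2) <=
  (f (x k.+1 w) - f xs) - (f (y k.+1 w) - f xs)}.
Proof.
apply: filterS e_unit => w e1.
have := objective_taylor hprob (x k.+1 w) (y k.+1 w).
rewrite (run_y_slope hrun) [_ - _ - x k.+1 w]addrAC subrr add0r -scaleNr !dotvZr dotvZl e1.
rewrite -/f -/(gr w) -/(a w) -/(slp k w) ler_norml => /andP[_].
set fx := f (x k.+1 w); set fy := f (_ + _) => h.
have E : - ((2 * L2)^-1 * slp k w) * a w +
   L2 * (- ((2 * L2)^-1 * slp k w) * (- ((2 * L2)^-1 * slp k w) * 1)) =
   - ((4 * L2)^-1 * (a w ^+ 2 - (b w + th w) ^+ 2)).
  by rewrite slopeE; field; rewrite gt_eqF.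
by lra.
Qed.

Let myk1 : measurable_fun setT (y k.+1).
Proof.
have := @measurable_run _ _ _ _ _ _ _ _ _ _ _ _ _ _ _ _ _ _ n8 hp hrun mFt _ Omega id k.+1
  (ltn_ord k) (fun j _ => sm_meas_e hs j) (fun j i _ => sm_meas_xi hs j i).
by case.
Qed.

Let mVk1 : measurable_fun setT (fun w => bregman p (z k.+1 w) xs).
Proof.
have := @measurable_run _ _ _ _ _ _ _ _ _ _ _ _ _ _ _ _ _ _ n8 hp hrun mFt _ Omega id k.+1
  (ltn_ord k) (fun j _ => sm_meas_e hs j) (fun j i _ => sm_meas_xi hs j i).
by case=> _ h1 h2; exact: (measurable_bregman n8 hp xs h1 h2).
Qed.

Let beta := step_alpha n p L2 k.+1 * n%:R.

Let mirror w : bregman p (z k.+1 w) xs <= bregman p (z k w) xs -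
  beta * (a w * q w + b w * q w + th w * q w) +
  9 / 4 * beta ^+ 2 * (slp k w ^+ 2 * dualsq p (e k w)).
Proof.
have := mirror_descent n8 hp (run_z_min hrun k w) xs.
rewrite -/(slp k w) -/beta dualsqZ dotvZl (dotvC (e k w)) -/(q w) slopeE.
by lra.
Qed.

(** Carried along because [gap_le_dist] converts it into integrability of the objective at [y]. *)
Lemma step_dist_integrable : rint Pr (fun w => dotv (y k.+1 w - xs) (y k.+1 w - xs)).
Proof.
pose c : R := - (2 * L2)^-1.
have E w : y k.+1 w - xs = (x k.+1 w - xs) + (c * slp k w) *: e k w.
  by rewrite (run_y_slope hrun) /c mulNr scaleNr addrAC.
have mse : measurable_fun setT (fun w => (c * slp k w) *: e k w).
  by apply: measurable_fun_scalev => //; exact: measurable_funM.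
under eq_fun do rewrite E; apply: rint_dotvD => //.
apply: (rint_ae_le _ (rintZ (c ^+ 2) rs)); first exact: measurable_fun_dotv.
apply: filterS e_unit => w e1.
by rewrite ger0_norm ?dotv_ge0// dotvZl dotvZr e1 mulr1 -expr2 exprMn.
Qed.

Let rthq : rint Pr (fun w => th w * q w).
Proof. by apply: rintM => //; [have [] := rth|have [] := rq]. Qed.

Let r_cross : rint Pr (fun w => a w * q w + b w * q w + th w * q w).
Proof. by apply: rintD rthq; apply: rintD; [have [] := raq|have [] := rbq]. Qed.

Let r_mirror : rint Pr (fun w => bregman p (z k w) xs -
  beta * (a w * q w + b w * q w + th w * q w) +
  9 / 4 * beta ^+ 2 * (slp k w ^+ 2 * dualsq p (e k w))).
Proof.
apply: rintD; last by apply: rintZ; have [] := rsd.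
by apply: rintB => //; exact: rintZ.
Qed.

Lemma step_bregman_integrable : rint Pr (fun w => bregman p (z k.+1 w) xs).
Proof.
apply: (rint_le _ r_mirror) => // w.
by rewrite ger0_norm; [exact: mirror|exact: (bregman_ge0 n8)].
Qed.

Lemma run_coupling w : step_alpha n p L2 k.+1 * dotv (gr w) (z k w - xs) >=
  step_alpha n p L2 k.+1 * ((f (x k.+1 w) - f xs) +
    k%:R / 2 * ((f (x k.+1 w) - f xs) - (f (y k w) - f xs))).
Proof.
have al0 : 0 <= step_alpha n p L2 k.+1 by exact: ltW.
apply: ler_wpM2l => //.
have xk := run_x hrun k w.
(* [tau = 2 / (k + 2)] gives [(1 - tau) / tau = k / 2]. *)
have zx : z k w - x k.+1 w = (k%:R / 2) *: (x k.+1 w - y k w).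
  have k2 : k.+2%:R = k%:R + 2 :> R by rewrite -addn2 natrD.
  have k20 : k%:R + 2 != 0 :> R by rewrite -k2 pnatr_eq0.
  rewrite xk /step_tau k2; apply/rowP => i; rewrite !mxE.
  by field.
have h1 := objective_convex hprob (x k.+1 w) xs.
have h2 := objective_convex hprob (x k.+1 w) (y k w).
have -> : z k w - xs = (k%:R / 2) *: (x k.+1 w - y k w) + (x k.+1 w - xs).
  by rewrite -zx addrA subrK.
rewrite -!/f in h1 h2; rewrite dotvDr dotvZr.
have -> : dotv (gr w) (x k.+1 w - y k w) = - dotv (gr w) (y k w - x k.+1 w).
  by rewrite -opprB dotvNr.
have -> : dotv (gr w) (x k.+1 w - xs) = - dotv (gr w) (xs - x k.+1 w).
  by rewrite -opprB dotvNr.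
have h3 : f (x k.+1 w) - f (y k w) <= - dotv (gr w) (y k w - x k.+1 w).
  by rewrite /gr; lra.
have k0 : 0 <= k%:R / 2 :> R by rewrite divr_ge0.
have := ler_wpM2l k0 h3; rewrite /gr; lra.
Qed.

Let rgapX := rgap mx rX.
Let rgapY := rgap my rY.
Let rgapY1 := rgap myk1 step_dist_integrable.

Let Er_descent : n%:R^-1 * Er Pr (fun w => dotv (gr w) (gr w)) <=
  4 * L2 * (Er Pr (fun w => f (x k.+1 w) - f xs) - Er Pr (fun w => f (y k.+1 w) - f xs)) +
  (16 / 3 / n%:R * (sigma ^+ 2 / m%:R) + 2 * theta2).
Proof.
have [rA <-] := ra; have [rB EB] := rb; have [rT ET] := rth.
have r0 := rintB rgapX rgapY1.
have rL := rintZ (4 * L2) r0.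
have rBT := rintD (rintZ 2 rB) (rintZ 2 rT).
have le : {ae Pr, forall w, a w ^+ 2 <=
  4 * L2 * ((f (x k.+1 w) - f xs) - (f (y k.+1 w) - f xs)) +
   (2 * b w ^+ 2 + 2 * th w ^+ 2)}.
  apply: filterS descent => w; rewrite mulrC ler_pdivrMr ?mulr_gt0// => h.
  have := sqr_ge0 (b w - th w); have := h; nra.
apply: le_trans (Er_ae_le rA (rintD rL rBT) le) _.
rewrite (ErD rL rBT) (ErD (rintZ 2 rB) (rintZ 2 rT)) !ErZ// (ErB rgapX rgapY1).
by lra.
Qed.

(** The gap at [x k.+1] cancels: the coupling provides it with weight [al (1 + k/2)], and the
    squared slope in the mirror step costs the same weight [al (k + 2) / 2] through the descent
    inequality. [gamma] is the Young parameter for the bias, left free until [N] is known. *)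
Lemma one_step gamma : 0 < gamma ->
  let al := step_alpha n p L2 k.+1 in
  let noise := 16 / 3 / n%:R * (sigma ^+ 2 / m%:R) + 2 * theta2 in
  al * k.+2%:R / 2 * Er Pr (fun w => f (y k.+1 w) - f xs) +
    Er Pr (fun w => bregman p (z k.+1 w) xs) <=
  al * k%:R / 2 * Er Pr (fun w => f (y k w) - f xs) +
    (1 + 9 * al / (2 * gamma)) * Er Pr (fun w => bregman p (z k w) xs) +
    al * n%:R * gamma * theta2 / 2 + al * k.+2%:R / 2 * (noise / (2 * L2)).
Proof.
move=> ga0; lazy zeta; set al := step_alpha n p L2 k.+1.
set noise := 16 / 3 / n%:R * _ + _.
have al0 : 0 < al by exact: al_gt0.
have [raq1 Eaq] := raq; have [rbq1 Ebq] := rbq; have [rsd1 Esd] := rsd.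
have [rq1 Eq] := rq; have [rT ET] := rth.
have be0 : 0 < beta by rewrite /beta mulr_gt0.
have M := Er_le (step_bregman_integrable) r_mirror mirror.
have rc1 := rintZ beta r_cross.
rewrite (ErD (rintB rV rc1) (rintZ _ rsd1)) (ErB rV rc1) !ErZ// in M.
rewrite (ErD (rintD raq1 rbq1) rthq) (ErD raq1 rbq1) Ebq addr0 Eaq in M.
have Tq : - Er Pr (fun w => th w * q w) <=
    gamma / 2 * theta2 + (2 * gamma)^-1 * (9 / n%:R * Er Pr (fun w => bregman p (z k w) xs)).
  rewrite -mulN1r -ErZ//.
  have le w : -1 * (th w * q w) <= gamma / 2 * th w ^+ 2 + (2 * gamma)^-1 * q w ^+ 2.
    have := sqr_ge0 (gamma * th w + q w) => h.
    rewrite -subr_ge0.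
    have -> : gamma / 2 * th w ^+ 2 + (2 * gamma)^-1 * q w ^+ 2 - -1 * (th w * q w) =
      (gamma * th w + q w) ^+ 2 / (2 * gamma) by field; rewrite gt_eqF.
    by rewrite divr_ge0// mulr_ge0// ltW.
  apply: le_trans (Er_le (rintZ (-1) rthq) (rintD (rintZ _ rT) (rintZ _ rq1)) le) _.
  rewrite (ErD (rintZ _ rT) (rintZ _ rq1)) !ErZ//.
  apply: lerD; first by apply: ler_wpM2l => //; rewrite divr_ge0// ltW.
  by apply: ler_wpM2l => //; rewrite invr_ge0 mulr_ge0// ltW.
have rgz : rint Pr (fun w => dotv (gr w) (z k w - xs)).
  by apply: rint_dotv => //; exact: mgr.
have rXY := rintB rgapX rgapY.
have Cp : Er Pr (fun w => f (x k.+1 w) - f xs) + k%:R / 2 *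
    (Er Pr (fun w => f (x k.+1 w) - f xs) - Er Pr (fun w => f (y k w) - f xs)) <=
    Er Pr (fun w => dotv (gr w) (z k w - xs)).
  rewrite -(ErB rgapX rgapY) -ErZ// -(ErD rgapX (rintZ _ rXY)).
  apply: (Er_le (rintD rgapX (rintZ _ rXY)) rgz) => w.
  by have := run_coupling w; rewrite -/al (ler_pM2l al0).
move: M Tq Cp Esd Er_descent; rewrite -/noise.
set EX := Er Pr (fun w => f (x k.+1 w) - f xs).
set EY' := Er Pr (fun w => f (y k.+1 w) - f xs).
set EY := Er Pr (fun w => f (y k w) - f xs).
set EV := Er Pr (fun w => bregman p (z k w) xs).
set EV' := Er Pr (fun w => bregman p (z k.+1 w) xs).
set C := Er Pr (fun w => dotv (gr w) (z k w - xs)).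
set G := n%:R^-1 * Er _ _.
set TQ := Er Pr (fun w => th w * q w).
set S := Er Pr (fun w => slp k w ^+ 2 * dualsq p (e k w)) => M Tq Cp Esd Ed.
have k2E : k.+2%:R = k%:R + 2 :> R by rewrite -addn2 natrD.
(* Here the 96 of the step size is used up: [48] is the product of [9/4] from the mirror step, [8/3]
   from the dual moment and [8] from twice the descent inequality. *)
have alE : 48 * n%:R ^+ 2 * rho p n * L2 * al = k.+2%:R / 2.
  by rewrite /al /step_alpha; field; rewrite !gt_eqF.
have s0 : 0 <= n%:R^-1 * (sigma ^+ 2 / m%:R).
  by rewrite mulr_ge0 ?divr_ge0 ?invr_ge0 ?sqr_ge0// ltW.
have S1 : S <= 8 / 3 * rho p n * (8 * L2 * (EX - EY') + 4 * noise).
  apply: le_trans Esd _; apply: ler_wpM2l; first by rewrite mulr_ge0// ltW.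
  by rewrite /noise; move: Ed; rewrite /noise; move: s0; lra.
have S2 : 9 / 4 * beta ^+ 2 * S <= al * k.+2%:R / 2 * (EX - EY' + noise / (2 * L2)).
  have b0 : 0 <= 9 / 4 * beta ^+ 2 by rewrite mulr_ge0// sqr_ge0.
  apply: le_trans (ler_wpM2l b0 S1) _.
  rewrite -[al * k.+2%:R / 2]mulrA -alE /beta -/al le_eqVlt; apply/orP; left; apply/eqP.
  by field; rewrite gt_eqF.
have B1 : - (beta * (n%:R^-1 * C + TQ)) <=
   - al * (EX + k%:R / 2 * (EX - EY)) +
   (al * n%:R * gamma * theta2 / 2 + 9 * al / (2 * gamma) * EV).
  have -> : - (beta * (n%:R^-1 * C + TQ)) = - al * C + beta * (- TQ).
    by rewrite /beta -/al; field; rewrite gt_eqF.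
  apply: lerD; first by rewrite !mulNr lerN2; apply: ler_wpM2l => //; exact: ltW.
  apply: le_trans (ler_wpM2l (ltW be0) Tq) _.
  by rewrite le_eqVlt; apply/orP; left; apply/eqP; rewrite /beta -/al; field; rewrite !gt_eqF.
rewrite mulrDr in S2; rewrite k2E in S2 *.
move: M S2 B1; set t1 := beta * _; set t2 := 9 / 4 * _ * _.
set t3 := 9 * al / (2 * gamma) * EV; set t4 := _ * theta2 / 2.
set t5 := _ * (noise / (2 * L2)).
rewrite [(1 + _) * EV]mulrDl mul1r -/t3 => M S2 B1.
by nra.
Qed.

End iteration.
End one_step.

(** * Convergence *)

(* [(1 + 1/(2N))^k <= 1 + k/N] for [k <= N]. *)
Lemma perturbed_recursion (R : realFieldType) (N : nat) (E : nat -> R) (a c : R) :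
  0 <= a -> 0 <= c -> E 0%N <= a ->
  (forall k, (k < N)%N -> E k.+1 <= (1 + (2 * N%:R)^-1) * E k + c) ->
  forall k, (k <= N)%N -> E k <= (1 + k%:R / N%:R) * (a + k%:R * c).
Proof.
move=> a0 c0 E0 step; elim=> [|k ih] kN; first by rewrite !mul0r !addr0 mul1r.
have N0 : 0 < N%:R :> R by rewrite ltr0n (leq_ltn_trans _ kN).
have h := ih (ltnW kN).
set u := 1 / (2 * N%:R) : R; have u0 : 0 <= u by rewrite divr_ge0// mulr_ge0// ltW.
have uE : (2 * N%:R)^-1 = u by rewrite /u div1r.
have iE : N%:R^-1 = 2 * u by rewrite /u; field; rewrite gt_eqF.
have := step k kN; rewrite iE in h *; rewrite uE => st.
apply: le_trans st _; rewrite -[k.+1%:R]natr1.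
have k0 : 0 <= k%:R :> R by [].
have ku : 2 * (k%:R * u) <= 1.
  have -> : 2 * (k%:R * u) = k%:R / N%:R by rewrite iE; ring.
  by rewrite ler_pdivrMr// mul1r ler_nat ltnW.
have h1 : 0 <= 1 + u by lra.
apply: le_trans (lerD (ler_wpM2l h1 h) (lexx c)) _.
set b := a + k%:R * c; have b0 : 0 <= b by rewrite addr_ge0// mulr_ge0.
have -> : a + (k%:R + 1) * c = b + c by rewrite /b; ring.
set v := k%:R * u in ku; have v0 : 0 <= v by rewrite mulr_ge0.
have -> : k%:R * (2 * u) = 2 * v by rewrite /v; ring.
have -> : (k%:R + 1) * (2 * u) = 2 * v + 2 * u by rewrite /v; ring.
have p1 : 0 <= u * b * (1 - 2 * v) by rewrite !mulr_ge0// subr_ge0.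
have p2 : 0 <= (2 * v + 2 * u) * c by rewrite mulr_ge0// addr_ge0// mulr_ge0.
by lra.
Qed.

(** Step [k] consumes [Phi k] with weight [A k] and delivers [Phi k.+1] with weight
    [(k + 2)^2 / (2 W) >= A k.+1], so the steps telescope up to the growth of [V]; [A 0 = 0] removes
    the initial gap. *)
Lemma accelerated_recursion (R : realFieldType) (N : nat) (Phi V : nat -> R)
  (W n theta nu Theta : R) : (0 < N)%N -> 0 < W -> 0 <= n -> 0 <= theta -> 0 <= nu ->
  0 <= Theta -> (forall k, 0 <= Phi k) -> (forall k, 0 <= V k) -> V 0%N <= Theta ->
  (forall k, (k < N)%N -> forall gamma, 0 < gamma ->
    k.+2%:R / W * k.+2%:R / 2 * Phi k.+1 + V k.+1 <=
    k.+2%:R / W * k%:R / 2 * Phi k + (1 + 9 * (k.+2%:R / W) / (2 * gamma)) * V k +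
    k.+2%:R / W * n * gamma * theta / 2 + k.+2%:R / W * k.+2%:R / 2 * nu) ->
  Phi N <= 4 * W * Theta / N%:R ^+ 2 + 72 * N%:R ^+ 2 * n * theta / W + 8 * N%:R * nu.
Proof.
move=> N0' W0 n0 th0 nu0 T0 Phi0 V0 VT step.
have N0 : 0 < N%:R :> R by rewrite ltr0n.
have N1 : 1 <= N%:R :> R by rewrite ler1n.
(* The step size is at most [(N + 1) / W], so this choice keeps the growth [9 al / (2 gamma)] below
   [1 / (2 N)]. *)
pose ga : R := 9 * (N%:R * (N%:R + 1)) / W.
have ga0 : 0 < ga by rewrite divr_gt0// !mulr_gt0// ltr_wpDr.
pose A k : R := k%:R * (k%:R + 2) / (2 * W).
pose E k := A k * Phi k + V k.
pose c := (N%:R + 1) / W * n * ga * theta / 2 + (N%:R + 1) ^+ 2 / (2 * W) * nu.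
have c0 : 0 <= c.
  have W0' := ltW W0; have g' := ltW ga0; have N1' : 0 <= N%:R + 1 :> R by lra.
  apply: addr_ge0; last by rewrite mulr_ge0// divr_ge0 ?exprn_ge0 ?mulr_ge0.
  by rewrite divr_ge0// !mulr_ge0// invr_ge0.
have rec k : (k < N)%N -> E k.+1 <= (1 + (2 * N%:R)^-1) * E k + c.
  move=> kN; have k0 : 0 <= k%:R :> R by [].
  have kN1 : k%:R + 1 <= N%:R :> R by rewrite natr1 ler_nat.
  have k2 : k.+2%:R = k%:R + 2 :> R by rewrite -addn2 natrD.
  have := step k kN ga ga0; rewrite k2.
  have W0' : 0 <= W^-1 by rewrite invr_ge0 ltW.
  have A1 : A k.+1 <= (k%:R + 2) / W * (k%:R + 2) / 2.
    rewrite /A -natr1 invfM; set w := W^-1 in W0' *; nra.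
  have A2 : (k%:R + 2) / W * k%:R / 2 = A k by rewrite /A; field; rewrite gt_eqF.
  have A0 : 0 <= A k.
    by rewrite divr_ge0 ?mulr_ge0// ?addr_ge0// ltW.
  have B : 9 * ((k%:R + 2) / W) / (2 * ga) <= (2 * N%:R)^-1.
    have -> : 9 * ((k%:R + 2) / W) / (2 * ga) = (k%:R + 2) / (N%:R + 1) * (2 * N%:R)^-1.
      by rewrite /ga; field; rewrite !gt_eqF// ltr_wpDr.
    rewrite ler_piMl ?invr_ge0 ?mulr_ge0// ler_pdivrMr ?ltr_wpDr//; lra.
  have D : (k%:R + 2) / W * n * ga * theta / 2 + (k%:R + 2) / W * (k%:R + 2) / 2 * nu <= c.
    rewrite /c; apply: lerD.
      rewrite ler_pM2r ?invr_gt0//; have ga1 := ltW ga0.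
      do 3 (apply: ler_wpM2r => //).
      by apply: ler_wpM2r => //; lra.
    apply: ler_wpM2r => //.
    have -> : (k%:R + 2) / W * (k%:R + 2) / 2 = (k%:R + 2) ^+ 2 / (2 * W).
      by field; rewrite gt_eqF.
    apply: ler_wpM2r; first by rewrite invr_ge0 mulr_ge0// ltW.
    rewrite lerXn2r ?nnegrE ?addr_ge0//; move: kN1; clear; lra.
  rewrite A2 /E => st.
  have P1 := ler_wpM2r (Phi0 k.+1) A1.
  have P2 := ler_wpM2r (V0 k) B.
  have P3 : 0 <= (2 * N%:R)^-1 * (A k * Phi k).
    by apply: mulr_ge0; [rewrite invr_ge0 mulr_ge0|exact: mulr_ge0].
  move: st D P1 P2 P3; set u := (2 * _)^-1; set x1 := _ * theta / 2; set x2 := _ * nu.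
  set x3 := A k * Phi k; set x4 := 9 * _ / _; set x5 := A k.+1 * _; set x6 := _ * Phi k.+1.
  rewrite !mulrDl !mulrDr => *; lra.
have E0 : E 0%N <= Theta by rewrite /E /A !mul0r add0r.
have := perturbed_recursion T0 c0 E0 rec (leqnn N).
rewrite divff ?gt_eqF// /E => fin.
have fin2 : A N * Phi N <= 2 * (Theta + N%:R * c) by have := V0 N; lra.
have AN : N%:R ^+ 2 / (2 * W) * Phi N <= A N * Phi N.
  apply: ler_wpM2r => //; rewrite /A; apply: ler_wpM2r.
    by rewrite invr_ge0 mulr_ge0// ltW.
  by rewrite expr2 ler_wpM2l// lerDl.
have fin3 := le_trans AN fin2.
have q0 : 0 <= 2 * W / N%:R ^+ 2 by rewrite divr_ge0 ?mulr_ge0 ?exprn_ge0// ltW.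
have := ler_wpM2l q0 fin3.
have -> : 2 * W / N%:R ^+ 2 * (N%:R ^+ 2 / (2 * W) * Phi N) = Phi N.
  by field; rewrite !gt_eqF.
move=> h; apply: le_trans h _.
have -> : 2 * W / N%:R ^+ 2 * (2 * (Theta + N%:R * c)) = 4 * W * Theta / N%:R ^+ 2 +
   18 * (N%:R + 1) ^+ 2 * n * theta / W + 2 * (N%:R + 1) ^+ 2 / N%:R * nu.
  by rewrite /c /ga; field; rewrite !gt_eqF.
have sq : (N%:R + 1) ^+ 2 <= (2 * N%:R) ^+ 2 :> R by rewrite lerXn2r ?nnegrE; lra.
rewrite exprMn in sq.
apply: lerD; first apply: lerD => //.
  apply: ler_wpM2r; first by rewrite invr_ge0 ltW.
  by do 2 (apply: ler_wpM2r => //); lra.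
apply: ler_wpM2r => //; rewrite ler_pdivrMr// -mulrA -expr2; lra.
Qed.

Section convergence.
Context {R : realType} {d : measure_display} {X : measurableType d}.
Context {d' : measure_display} {Omega : measurableType d'}.
Variables (n p N m : nat) (Pr : probability Omega R) (P : probability X R).
Variables (F eta : 'rV[R]_n -> X -> R) (g : 'rV[R]_n -> X -> 'rV[R]_n) (L : X -> R).
Variables (L2 sigma Delta t Theta : R) (x0 xs : 'rV[R]_n).
Variables (e : 'I_N -> Omega -> 'rV[R]_n) (xi : 'I_N -> 'I_m -> Omega -> X).
Variables (x y z : nat -> Omega -> 'rV[R]_n).
Hypotheses (n8 : (8 <= n)%N) (hp : p \in [:: 1%N; 2%N]) (m_gt0 : (0 < m)%N).
Hypotheses (N_gt0 : (0 < N)%N) (t_gt0 : 0 < t) (Delta_ge0 : 0 <= Delta).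
Hypothesis hprob : stochastic_problem P F g L L2 sigma.
Hypothesis xs_min : is_minimizer (objective P F) xs.
Hypothesis hnoise : oracle_noise P eta Delta.
Hypothesis hs : ardfds_sampling Pr P e xi.
Hypothesis hrun : ardfds_run p (fun v s => F v s + eta v s) L2 t x0 e xi x y z.
Hypothesis hTheta : bregman p x0 xs <= Theta.

Lemma run_integrable k : (k <= N)%N -> rint Pr (fun w => bregman p (z k w) xs) /\
  rint Pr (fun w => dotv (y k w - xs) (y k w - xs)).
Proof.
elim: k => [_|k ih kN].
  split.
    rewrite (_ : (fun w => _) = (fun=> bregman p x0 xs)); first exact: rint_cst.
    by apply/funext => w; have [_ _ ->] := run_init hrun w.
  rewrite (_ : (fun w => _) = (fun=> dotv (x0 - xs) (x0 - xs))); first exact: rint_cst.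
  by apply/funext => w; have [_ -> _] := run_init hrun w.
have [rV rY] := ih (ltnW kN).
split.
  exact: (step_bregman_integrable n8 hp m_gt0 t_gt0 Delta_ge0 hprob xs_min hnoise hs hrun
    (k := Ordinal kN) rV rY).
exact: (step_dist_integrable n8 hp m_gt0 t_gt0 Delta_ge0 hprob xs_min hnoise hs hrun
  (k := Ordinal kN) rV rY).
Qed.

Lemma run_gap_integrable : rint Pr (fun w => objective P F (y N w) - objective P F xs).
Proof.
have [_ rY] := run_integrable (leqnn N).
have my : measurable_fun setT (y N).
  have mFt : measurable_fun setT (fun u : 'rV[R]_n * X => F u.1 u.2 + eta u.1 u.2).
    by apply: measurable_funD; [exact: sp_measF hprob|exact: on_meas hnoise].
  have := @measurable_run _ _ _ _ _ _ _ _ _ _ _ _ _ _ _ _ _ _ n8 hp hrun mFt _ Omega id N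
    (leqnn N) (fun j _ => sm_meas_e hs j) (fun j i _ => sm_meas_xi hs j i).
  by case.
apply: (rint_le _ (rintZ L2 rY)).
  by apply: measurable_funB => //; exact: (measurableT_comp (measurable_objective hprob) my).
move=> w; rewrite ger0_norm; last exact: (gap_ge0 xs_min).
exact: (gap_le_dist hprob xs_min).
Qed.

Lemma run_gap_le : Er Pr (fun w => objective P F (y N w) - objective P F xs) <=
  384 * (n%:R ^+ 2 * rho p n * L2 * Theta / N%:R ^+ 2) +
  N%:R ^+ 2 * theta2 L2 Delta t / (n%:R * rho p n * L2) +
  22 * (N%:R * (sigma ^+ 2 / (n%:R * m%:R) + theta2 L2 Delta t) / L2).
Proof.
have n0 : 0 < n%:R :> R by rewrite ltr0n (leq_trans _ n8).
have m0 : 0 < m%:R :> R by rewrite ltr0n.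
have N0 : 0 < N%:R :> R by rewrite ltr0n.
have L0 : 0 < L2 := sp_L2gt0 hprob.
have rh0 : 0 < rho p n :> R by exact: rho_gt0.
have th0 : 0 <= theta2 L2 Delta t by exact: bias_sqr_ge0.
pose W := 96 * n%:R ^+ 2 * rho p n * L2.
have W0 : 0 < W by do 3 ![apply: mulr_gt0 => //]; exact: exprn_gt0.
pose noise := 16 / 3 / n%:R * (sigma ^+ 2 / m%:R) + 2 * theta2 L2 Delta t.
have s0 : 0 <= sigma ^+ 2 / (n%:R * m%:R).
  by rewrite divr_ge0 ?sqr_ge0// mulr_ge0// ltW.
have noiseE : noise = 16 / 3 * (sigma ^+ 2 / (n%:R * m%:R)) + 2 * theta2 L2 Delta t.
  by rewrite /noise; field; rewrite !gt_eqF.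
have noise0 : 0 <= noise by rewrite noiseE addr_ge0// mulr_ge0.
have nu0 : 0 <= noise / (2 * L2) by rewrite divr_ge0// mulr_ge0// ltW.
have V0 k w : 0 <= bregman p (z k w) xs by exact: (bregman_ge0 n8).
have T0 : 0 <= Theta by apply: le_trans hTheta; exact: (bregman_ge0 n8).
have Vx0 : Er Pr (fun w => bregman p (z 0%N w) xs) <= Theta.
  rewrite (_ : (fun w => _) = (fun=> bregman p x0 xs)) ?Er_cst//.
  by apply/funext => w; have [_ _ ->] := run_init hrun w.
have Phi0 k : 0 <= Er Pr (fun w => objective P F (y k w) - objective P F xs).
  by apply: Er_ge0 => w; exact: (gap_ge0 xs_min).
have EV0 k : 0 <= Er Pr (fun w => bregman p (z k w) xs) by exact: Er_ge0.
have step := accelerated_recursion N_gt0 W0 (ltW n0) th0 nu0 T0 Phi0 EV0 Vx0.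
have /step : forall k, (k < N)%N -> forall gamma, 0 < gamma ->
    k.+2%:R / W * k.+2%:R / 2 * Er Pr (fun w => objective P F (y k.+1 w) - objective P F xs) +
    Er Pr (fun w => bregman p (z k.+1 w) xs) <=
    k.+2%:R / W * k%:R / 2 * Er Pr (fun w => objective P F (y k w) - objective P F xs) +
    (1 + 9 * (k.+2%:R / W) / (2 * gamma)) * Er Pr (fun w => bregman p (z k w) xs) +
    k.+2%:R / W * n%:R * gamma * theta2 L2 Delta t / 2 +
    k.+2%:R / W * k.+2%:R / 2 * (noise / (2 * L2)).
  move=> k kN gamma ga0; have [rV rY] := run_integrable (ltnW kN).
  exact: (one_step n8 hp m_gt0 t_gt0 Delta_ge0 hprob xs_min hnoise hs hrun
    (k := Ordinal kN) rV rY ga0).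
move=> h; apply: le_trans h _.
have -> : 4 * W * Theta / N%:R ^+ 2 = 384 * (n%:R ^+ 2 * rho p n * L2 * Theta / N%:R ^+ 2).
  by rewrite /W; field; rewrite gt_eqF.
have -> : 72 * N%:R ^+ 2 * n%:R * theta2 L2 Delta t / W =
    3 / 4 * (N%:R ^+ 2 * theta2 L2 Delta t / (n%:R * rho p n * L2)).
  by rewrite /W; field; rewrite !gt_eqF.
have -> : 8 * N%:R * (noise / (2 * L2)) = 4 * (N%:R * noise / L2).
  by field; rewrite gt_eqF.
rewrite -!addrA lerD2l; apply: lerD.
  rewrite ler_piMl//; last lra.
  apply: divr_ge0; first by apply: mulr_ge0 => //; exact: sqr_ge0.
  by apply: mulr_ge0; [apply: mulr_ge0|]; exact: ltW.
have -> : 22 * (N%:R * (sigma ^+ 2 / (n%:R * m%:R) + theta2 L2 Delta t) / L2) =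
  4 * (N%:R * (22 / 4 * (sigma ^+ 2 / (n%:R * m%:R) + theta2 L2 Delta t)) / L2).
  by field; rewrite !gt_eqF.
rewrite ler_pM2l// ler_pM2r ?invr_gt0// ler_pM2l// noiseE; lra.
Qed.

End convergence.

(** * Rates *)

Lemma powR_root (R : realType) (k : nat) (x y : R) : 0 <= x -> x ^+ k.+1 = y ->
  y `^ k.+1%:R^-1 = x.
Proof.
by move=> x0 <-; rewrite -powR_mulrn// -powRrM mulfV ?pnatr_eq0// powRr1.
Qed.

(* With [A = L2 Theta n / Delta]: for p = 1, [a = A^(1/3)] and [b = c = A^(1/4)];
   for p = 2, [a = (n A)^(1/3)], [b = (n^2 A)^(1/4)] and [c = (A / n^2)^(1/4)]. *)
Lemma rates_factor (R : realType) (p n : nat) (L2 Theta Delta sigma : R) :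
  (8 <= n)%N -> p \in [:: 1%N; 2%N] -> 0 < L2 -> 0 < Theta -> 0 < Delta ->
  let s := sigma ^+ 2 / (n%:R * L2 * Delta) in
  exists a b c, [/\ [/\ 0 < a, 0 < b & 0 < c],
    [/\ N_Delta p n L2 Theta Delta = Num.min a b,
        m_Delta p n L2 Theta Delta sigma = Num.min s (s / c),
        eps_Delta p n L2 Theta Delta = Num.max (Delta * a) (Delta * (b * c)) &
        calls_Delta p n L2 Theta Delta sigma = Num.min (s * a) (s * (b / c))] &
    [/\ n%:R ^+ 2 * rho p n * L2 * Theta <= 16 * ln n%:R * (Delta * a ^+ 3),
        a ^+ 3 = b ^+ 3 * c & b <= c * (n%:R * rho p n)]].
Proof.
move=> n8 hp L0 T0 D0 s.
have n0 : 0 < n%:R :> R by rewrite ltr0n (leq_trans _ n8).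
have l2 := @ln_dim_ge2 R n n8.
pose A := L2 * Theta * n%:R / Delta.
have A0 : 0 < A by rewrite divr_gt0 ?mulr_gt0.
pose h := A `^ 4^-1; have h0 : 0 < h by rewrite powR_gt0.
have h4 : h ^+ 4 = A by rewrite -powR_mulrn ?ltW// -powRrM mulVf ?pnatr_eq0// powRr1// ltW.
have cub (r : R) : 0 < r -> (r `^ 3^-1) ^+ 3 = r.
  by move=> r0; rewrite -powR_mulrn ?powR_ge0// -powRrM mulVf ?pnatr_eq0// powRr1// ltW.
have sq (r q : R) : 0 <= q -> q ^+ 2 = r -> Num.sqrt r = q.
  by move=> q0 <-; rewrite sqrtr_sqr ger0_norm.
move: hp; rewrite !inE => /orP[/eqP ->|/eqP ->];
  rewrite /N_Delta /m_Delta /eps_Delta /calls_Delta/=.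
- pose a := A `^ 3^-1; have a0 : 0 < a by rewrite powR_gt0.
  have a3 : a ^+ 3 = A by exact: cub.
  exists a, h, h; split => //; split.
  + by [].
  + congr Num.min.
    rewrite (powR_root (x := n%:R * L2 * Delta * h)) ?mulr_ge0 ?ltW//.
      by rewrite /s; field; rewrite !gt_eqF.
    by rewrite exprMn h4 /A; field; rewrite gt_eqF.
  + congr Num.max; first apply: powR_root; rewrite ?mulr_ge0 ?ltW//.
      by rewrite exprMn a3 /A; field; rewrite gt_eqF.
    apply: sq; rewrite ?mulr_ge0 ?ltW//.
    have -> : (Delta * (h * h)) ^+ 2 = Delta ^+ 2 * h ^+ 4 by ring.
    by rewrite h4 /A; field; rewrite gt_eqF.
  + congr Num.min; last by rewrite /s divff ?gt_eqF// mulr1.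
    rewrite (powR_root (x := a / (n%:R * L2 * Delta))) ?divr_ge0 ?mulr_ge0 ?ltW//.
      by rewrite /s; field; rewrite !gt_eqF.
    by rewrite exprMn a3 /A; field; rewrite !gt_eqF.
  + rewrite a3 rho1.
    have -> : n%:R ^+ 2 * ((16 * ln n%:R - 8) / n%:R) * L2 * Theta =
      (16 * ln n%:R - 8) * (Delta * A) by rewrite /A; field; rewrite !gt_eqF.
    apply: ler_wpM2r; first by rewrite mulr_ge0 ?ltW.
    by lra.
  + by rewrite a3 -h4; ring.
  + rewrite rho1 [n%:R * _]mulrC divfK ?gt_eqF//.
    by apply: ler_peMr; [exact: ltW|lra].
pose q := Num.sqrt n%:R : R; have q0 : 0 < q by rewrite sqrtr_gt0.
have q2 : n%:R = q ^+ 2 by rewrite sqr_sqrtr// ltW.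
pose a := (n%:R * A) `^ 3^-1; have a0 : 0 < a by rewrite powR_gt0// mulr_gt0.
have a3 : a ^+ 3 = n%:R * A by rewrite cub// mulr_gt0.
have b0 : 0 < q * h by rewrite mulr_gt0.
have c0 : 0 < h / q by rewrite divr_gt0.
exists a, (q * h), (h / q); split => //; split.
+ congr Num.min; first by congr (_ `^ _); rewrite /A; field; rewrite gt_eqF.
  apply: powR_root; first exact: ltW.
  rewrite exprMn h4 -[4%N]/((2 * 2)%N) exprM -q2 /A; field; rewrite gt_eqF//.
+ congr Num.min.
  rewrite (powR_root (x := n%:R * L2 * Delta * (h / q))) ?mulr_ge0 ?invr_ge0 ?ltW//.
    by rewrite /s; field; rewrite !gt_eqF.
  have -> : (n%:R * L2 * Delta * (h / q)) ^+ 4 =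
      (n%:R * L2 * Delta) ^+ 4 * (h ^+ 4 / (q ^+ 2) ^+ 2) by field; rewrite gt_eqF.
  by rewrite h4 -q2 /A; field; rewrite !gt_eqF.
+ congr Num.max; first apply: powR_root; rewrite ?mulr_ge0 ?invr_ge0 ?ltW//.
    by rewrite exprMn a3 /A; field; rewrite gt_eqF.
  apply: sq; rewrite ?mulr_ge0 ?invr_ge0 ?ltW//.
  have -> : (Delta * (q * h * (h / q))) ^+ 2 = Delta ^+ 2 * h ^+ 4 by field; rewrite gt_eqF.
  by rewrite h4 /A; field; rewrite gt_eqF.
+ congr Num.min.
    rewrite (powR_root (x := a / (n%:R * L2 * Delta))) ?divr_ge0 ?mulr_ge0 ?ltW//.
      by rewrite /s; field; rewrite !gt_eqF.
    by rewrite exprMn a3 /A; field; rewrite !gt_eqF.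
  have -> : q * h / (h / q) = n%:R by rewrite q2; field; rewrite !gt_eqF.
  by rewrite /s; field; rewrite !gt_eqF.
+ rewrite a3 rho2//.
  have -> : n%:R ^+ 2 * 1 * L2 * Theta = 1 * (Delta * (n%:R * A)).
    by rewrite /A; field; rewrite !gt_eqF.
  apply: ler_wpM2r; first by apply: mulr_ge0; [|apply: mulr_ge0]; exact: ltW.
  by lra.
+ rewrite a3 -h4 q2; field; rewrite gt_eqF//.
+ by rewrite rho2// mulr1 q2 le_eqVlt; apply/orP; left; apply/eqP; field; rewrite gt_eqF.
Qed.

(** For the initial-distance term: [Num.min a b] is [N_Delta] and the right-hand side is
    [eps_Delta / Delta]. In each regime the quotient equals one of the two terms of the maximum. *)
Lemma cube_min_le_max (R : realFieldType) (a b c : R) : 0 < a -> 0 < b -> 0 < c ->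
  a ^+ 3 = b ^+ 3 * c -> a ^+ 3 / Num.min a b ^+ 2 <= Num.max a (b * c).
Proof.
move=> a0 b0 c0 abc; rewrite le_max; apply/orP; have [ab|ba] := leP a b; [left|right].
  by rewrite le_eqVlt; apply/orP; left; apply/eqP; field; rewrite gt_eqF.
by rewrite abc le_eqVlt; apply/orP; left; apply/eqP; field; rewrite gt_eqF.
Qed.

(** For the variance term: [Num.max 1 c] is [s / m_Delta], the sampling noise of one iteration in
    units of [Delta], multiplied here by the number of iterations. *)
Lemma min_mul_max_le (R : realFieldType) (a b c : R) : 0 < a -> 0 < b -> 0 < c ->
  Num.min a b * Num.max 1 c <= Num.max a (b * c).
Proof.
move=> a0 b0 c0; have [c1|c1] := leP 1 c.
  by rewrite le_max; apply/orP; right; apply: ler_wpM2r; [exact: ltW|rewrite ge_min lexx orbT].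
by rewrite mulr1 le_max ge_min lexx.
Qed.

(** At [t = t_Delta] the noise part and the smoothness part of the bias are [8 L2 Delta] and
    [2 L2 Delta]; for [t = u t_Delta] they scale by [u^-2] and [u^2]. *)
Lemma theta2_le (R : realType) (L2 Delta t Q : R) : 0 < L2 -> 0 < Delta -> 0 < t -> 0 < Q ->
  Q^-1 <= t / t_Delta L2 Delta <= Q -> theta2 L2 Delta t <= 10 * (Q ^+ 2 * (L2 * Delta)).
Proof.
move=> L0 D0 t0 Q0; set u := t / _.
have r0 : 0 < t_Delta L2 Delta by rewrite sqrtr_gt0 divr_gt0.
have u0 : 0 < u by rewrite divr_gt0.
have t2 : t ^+ 2 = u ^+ 2 * (Delta / L2).
  rewrite /u exprMn exprVn /t_Delta sqr_sqrtr; last by rewrite divr_ge0 ?ltW.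
  by rewrite divfK// gt_eqF// divr_gt0.
case/andP => Qu uQ.
have u2 : u ^+ 2 <= Q ^+ 2 by rewrite lerXn2r ?nnegrE// ltW.
have v2 : (u ^+ 2)^-1 <= Q ^+ 2.
  have : u^-1 <= Q by rewrite -[Q]invrK lef_pV2 ?posrE ?invr_gt0.
  by move=> h; rewrite -exprVn lerXn2r ?nnegrE ?invr_ge0// ltW.
rewrite /theta2 /bias_sqr t2.
have -> : 8 * Delta ^+ 2 / (u ^+ 2 * (Delta / L2)) + 2 * (u ^+ 2 * (Delta / L2)) * L2 ^+ 2 =
   8 * ((u ^+ 2)^-1 * (L2 * Delta)) + 2 * (u ^+ 2 * (L2 * Delta)).
  by field; rewrite !gt_eqF.
have LD : 0 <= L2 * Delta by rewrite mulr_ge0// ltW.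
have := ler_wpM2r LD u2; have := ler_wpM2r LD v2; lra.
Qed.

(** * Balancing the error terms *)

Section rates_bounds.
Context {R : realFieldType}.
Variables (n rh L2 Theta D s sig2 th l Q a b c Nr mr eps : R).
Hypotheses (n0 : 0 < n) (rh0 : 0 < rh) (L0 : 0 < L2) (D0 : 0 < D) (sig0 : 0 < sig2).
Hypotheses (l2 : 2 <= l) (Q1 : 1 <= Q) (a0 : 0 < a) (b0 : 0 < b) (c0 : 0 < c).
Hypotheses (Nr0 : 0 < Nr) (mr0 : 0 < mr) (th0 : 0 <= th).
Hypothesis sE : s = sig2 / (n * L2 * D).
Hypothesis hN : Q^-1 <= Nr / Num.min a b <= Q.
Hypothesis hm : Q^-1 <= mr / Num.min s (s / c) <= Q.
Hypothesis hth : th <= 10 * (Q ^+ 2 * (L2 * D)).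
Hypothesis epsE : eps = Num.max (D * a) (D * (b * c)).
Hypothesis hK : n ^+ 2 * rh * L2 * Theta <= 16 * l * (D * a ^+ 3).
Hypotheses (abc : a ^+ 3 = b ^+ 3 * c) (hb : b <= c * (n * rh)).

Let Q0 : 0 < Q. Proof. exact: lt_le_trans Q1. Qed.
Let l0 : 0 <= l. Proof. exact: le_trans l2. Qed.
Let s0 : 0 < s. Proof. by rewrite sE divr_gt0// !mulr_gt0. Qed.
Let k0 : 0 < Num.min a b. Proof. by rewrite lt_min a0 b0. Qed.
Let v0 : 0 < Nr / Num.min a b. Proof. by rewrite divr_gt0. Qed.
Let NE : Nr = Nr / Num.min a b * Num.min a b. Proof. by rewrite divfK// gt_eqF. Qed.
Let epsE' : eps = D * Num.max a (b * c).
Proof. by rewrite epsE maxr_pMr// ltW. Qed.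
Let eps0 : 0 < eps. Proof. by rewrite epsE lt_max mulr_gt0. Qed.
Let M1 : 1 <= Num.max 1 c. Proof. by rewrite le_max lexx. Qed.
Let mE : Num.min s (s / c) = s / Num.max 1 c.
Proof.
have [c1|c1] := leP 1 c.
  by rewrite min_r// ler_piMr ?invf_le1// ltW.
by rewrite divr1 min_l// ler_peMr ?ltW// invf_gt1.
Qed.

Let inv_close (r : R) : Q^-1 <= r <= Q -> 0 < r -> r^-1 <= Q.
Proof. by case/andP => h _ r0; rewrite -[Q]invrK lef_pV2 ?posrE ?invr_gt0. Qed.

Lemma rate_initial : n ^+ 2 * rh * L2 * Theta / Nr ^+ 2 <= 16 * l * (Q ^+ 2 * eps).
Proof.
have v1 := inv_close hN v0.
rewrite NE exprMn; set v := Nr / _ in v1 *; set k := Num.min a b.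
have k2 : 0 < k ^+ 2 by exact: exprn_gt0.
have v2 : (v ^+ 2)^-1 <= Q ^+ 2.
  by rewrite -exprVn lerXn2r ?nnegrE ?invr_ge0// ltW.
have h1 : n ^+ 2 * rh * L2 * Theta / k ^+ 2 <= 16 * l * eps.
  apply: (@le_trans _ _ (16 * l * (D * a ^+ 3) / k ^+ 2)).
    by rewrite ler_pM2r ?invr_gt0.
  have -> : 16 * l * (D * a ^+ 3) / k ^+ 2 = 16 * l * D * (a ^+ 3 / k ^+ 2).
    by field; rewrite gt_eqF.
  rewrite epsE' [leRHS]mulrA; apply: ler_wpM2l; last exact: cube_min_le_max.
  by apply: mulr_ge0; [exact: mulr_ge0|exact: ltW].
have le0 : 0 <= 16 * l * eps by rewrite !mulr_ge0// ltW.
have w0 : 0 <= (v ^+ 2)^-1 by rewrite invr_ge0 ltW// exprn_gt0.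
have -> : n ^+ 2 * rh * L2 * Theta / (v ^+ 2 * k ^+ 2) =
  (v ^+ 2)^-1 * (n ^+ 2 * rh * L2 * Theta / k ^+ 2) by rewrite invfM; ring.
apply: le_trans (ler_wpM2l w0 h1) _; apply: le_trans (ler_wpM2r le0 v2) _.
by rewrite mulrCA.
Qed.

(** By [hb], the square of [Num.min a b] is at most [b^2 <= b c n rh], which cancels the
    denominator. *)
Lemma rate_bias_mirror : Nr ^+ 2 * th / (n * rh * L2) <= 10 * (Q ^+ 4 * eps).
Proof.
rewrite {1}NE exprMn; set v := Nr / _; set k := Num.min a b.
have v2 : v ^+ 2 <= Q ^+ 2.
  by case/andP : hN => _ ?; rewrite lerXn2r ?nnegrE// ltW.
have nr : 0 < n * rh by rewrite mulr_gt0.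
have k2 : k ^+ 2 <= b * c * (n * rh).
  have kb : k <= b by rewrite ge_min lexx orbT.
  rewrite expr2 -mulrA; apply: ler_pM => //; [exact: ltW|exact: ltW|exact: le_trans hb].
rewrite ler_pdivrMr ?mulr_gt0//.
have -> : 10 * (Q ^+ 4 * eps) * (n * rh * L2) =
    Q ^+ 2 * (eps / D * (n * rh)) * (10 * (Q ^+ 2 * (L2 * D))) by field; rewrite gt_eqF.
have kk0 : 0 <= k ^+ 2 by exact: sqr_ge0.
apply: ler_pM => //; first by rewrite mulr_ge0// sqr_ge0.
apply: ler_pM => //; first exact: sqr_ge0.
apply: le_trans k2 _; rewrite ler_pM2r// epsE' mulrAC mulfV ?gt_eqF// mul1r.
by rewrite le_max lexx orbT.
Qed.

Lemma rate_variance : Nr * (sig2 / (n * mr) + th) / L2 <= 11 * (Q ^+ 3 * eps).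
Proof.
have km := min_mul_max_le a0 b0 c0.
have vQ : Nr / Num.min a b <= Q by case/andP : hN.
move: hm; rewrite mE => hm'; set w := mr / _ in hm'.
have mx0 : 0 < Num.max 1 c by exact: lt_le_trans M1.
have w0 : 0 < w by rewrite !divr_gt0.
have w1 := inv_close hm' w0.
have mrE : mr = w * (s / Num.max 1 c) by rewrite /w divfK// gt_eqF// divr_gt0.
have sigE : sig2 / (n * mr) = w^-1 * (L2 * D * Num.max 1 c).
  by rewrite mrE sE; field; rewrite !gt_eqF.
set mx := Num.max 1 c in km mx0 sigE *.
have LD : 0 < L2 * D by rewrite mulr_gt0.
have h1 : sig2 / (n * mr) + th <= 11 * (Q ^+ 2 * (L2 * D * mx)).
  have e1 : sig2 / (n * mr) <= Q ^+ 2 * (L2 * D * mx).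
    rewrite sigE; apply: ler_wpM2r; first by rewrite mulr_ge0// ltW.
    by apply: le_trans w1 _; rewrite expr2 ler_peMr// ltW.
  have e2 : Q ^+ 2 * (L2 * D) <= Q ^+ 2 * (L2 * D * mx).
    by apply: ler_wpM2l; [exact: sqr_ge0|rewrite ler_peMr// ltW].
  by move: hth; lra.
have h0 : 0 <= sig2 / (n * mr) + th.
  by rewrite addr_ge0// divr_ge0// ?mulr_ge0// ltW.
rewrite ler_pdivrMr//.
have h2 : Nr <= Q * Num.min a b by rewrite -ler_pdivrMr.
apply: le_trans (ler_pM (ltW Nr0) h0 h2 h1) _.
have -> : Q * Num.min a b * (11 * (Q ^+ 2 * (L2 * D * mx))) =
   11 * Q ^+ 3 * (L2 * D) * (Num.min a b * mx) by ring.
have -> : 11 * (Q ^+ 3 * eps) * L2 = 11 * Q ^+ 3 * (L2 * D) * Num.max a (b * c).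
  by rewrite epsE'; ring.
by apply: ler_wpM2l => //; rewrite mulr_ge0// ?mulr_ge0// ?exprn_ge0// ltW.
Qed.

(** The initial term contributes [384 * 16 = 6144] times [l], the other two [10 + 22 * 11 = 252],
    which is at most [126 l] since [l >= 2]. *)
Lemma rate_total : 384 * (n ^+ 2 * rh * L2 * Theta / Nr ^+ 2) +
  Nr ^+ 2 * th / (n * rh * L2) + 22 * (Nr * (sig2 / (n * mr) + th) / L2) <=
  6400 * Q ^+ 4 * l * eps.
Proof.
have q2 : Q ^+ 2 * eps <= Q ^+ 4 * eps.
  by rewrite ler_pM2r//; apply: ler_weXn2l.
have q3 : Q ^+ 3 * eps <= Q ^+ 4 * eps.
  by rewrite ler_pM2r//; apply: ler_weXn2l.
have q4 : 0 < Q ^+ 4 * eps by rewrite mulr_gt0// exprn_gt0.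
have -> : 6400 * Q ^+ 4 * l * eps = 6400 * (l * (Q ^+ 4 * eps)) by ring.
have := ler_wpM2l l0 q2; have := ler_wpM2r (ltW q4) l2.
have := rate_variance; have := rate_bias_mirror.
have := rate_initial; rewrite -[16 * l * _]mulrA.
set x1 := _ / Nr ^+ 2; set x2 := _ / (n * rh * L2); set x3 := _ / L2.
move: q2 q3 q4; set y2 := Q ^+ 2 * eps; set y3 := Q ^+ 3 * eps; set y4 := Q ^+ 4 * eps.
set z2 := l * y2; set z4 := l * y4.
by lra.
Qed.

Lemma calls_bound : Nr * mr <= Q ^+ 2 * Num.min (s * a) (s * (b / c)).
Proof.
have h2 : Nr <= Q * Num.min a b by rewrite -ler_pdivrMr//; case/andP : hN.
have mn0 : 0 < Num.min s (s / c) by rewrite lt_min s0 divr_gt0.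
have h3 : mr <= Q * Num.min s (s / c) by rewrite -ler_pdivrMr//; case/andP : hm.
apply: le_trans (ler_pM (ltW Nr0) (ltW mr0) h2 h3) _.
have -> : Q * Num.min a b * (Q * Num.min s (s / c)) =
  Q ^+ 2 * (Num.min a b * Num.min s (s / c)) by ring.
apply: ler_wpM2l; first exact: sqr_ge0.
rewrite le_min; apply/andP; split.
  rewrite mulrC; apply: ler_pM; rewrite ?(ltW k0) ?(ltW mn0)//; first by rewrite ge_min lexx.
  by rewrite ge_min lexx.
have -> : s * (b / c) = b * (s / c) by ring.
by apply: ler_pM; rewrite ?(ltW k0) ?(ltW mn0)// ge_min lexx orbT.
Qed.

End rates_bounds.

Lemma polylog_bounds (R : realType) (C0 : R) (n : nat) (r : R) : 0 < ln n%:R :> R ->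
  polylog_close C0 n r -> (C0 * ln n%:R `^ C0)^-1 <= r <= C0 * ln n%:R `^ C0.
Proof. by move=> l0; rewrite /polylog_close powRN invfM. Qed.

Lemma polylog_ge1 (R : realType) (C0 l : R) : 1 <= C0 -> 1 <= l -> 1 <= C0 * l `^ C0.
Proof.
move=> C1 l1; rewrite mulr_ege1// -(powRr0 l) ler_powR//.
exact: le_trans C1.
Qed.

(** The left-hand side is at most [C0^4 l^(4 C0 + 1)], and [4 C0 + 1 <= 6400 C0^4]. The final
    constant is thus both a prefactor and an exponent. *)
Lemma polylog_absorb (R : realType) (C0 l : R) (k : nat) : 1 <= C0 -> 2 <= l -> (k <= 4)%N ->
  (C0 * l `^ C0) ^+ k * l <= C0 ^+ 4 * l `^ (6400 * C0 ^+ 4).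
Proof.
move=> C1 l2 k4.
have l1 : 1 <= l by lra.
have l0 : 0 < l by lra.
have C0_0 : 0 < C0 by lra.
have Q1 := polylog_ge1 C1 l1.
apply: (@le_trans _ _ ((C0 * l `^ C0) ^+ 4 * l)).
  by rewrite ler_pM2r//; exact: ler_weXn2l.
rewrite exprMn -mulrA ler_pM2l ?exprn_gt0// -[(l `^ C0) ^+ 4]powR_mulrn ?powR_ge0// -powRrM.
rewrite -{2}(powRr1 (ltW l0)) -powRD; last by rewrite (gt_eqF l0) implybT.
apply: ler_powR => //.
have C2 : C0 <= C0 ^+ 4 by rewrite -[leLHS]expr1; exact: ler_weXn2l.
by lra.
Qed.

Theorem corollary2p4 (R : realType) (C0 : R) (hC0 : 1 <= C0) :
  exists2 C : R, 1 <= C &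
  forall (n p : nat) (hn : (8 <= n)%N) (hp : p \in [:: 1%N; 2%N])
    (d : measure_display) (X : measurableType d) (P : probability X R)
    (F : 'rV[R]_n -> X -> R) (g : 'rV[R]_n -> X -> 'rV[R]_n) (L : X -> R)
    (L2 sigma : R) (hprob : stochastic_problem P F g L L2 sigma)
    (xstar : 'rV[R]_n) (hxstar : is_minimizer (objective P F) xstar)
    (x0 : 'rV[R]_n) (Theta : R) (hTheta : bregman p x0 xstar <= Theta)
    (eta : 'rV[R]_n -> X -> R) (Delta : R) (hnoise : oracle_noise P eta Delta)
    (hDelta0 : 0 < Delta)
    (hDelta : Delta <= L2 * Theta * n%:R ^+ 3 * rho p n ^+ 2 / 2)
    (N m : nat) (t : R) (hN : (0 < N)%N) (hm : (0 < m)%N) (ht : 0 < t)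
    (hmDelta : 0 < m_Delta p n L2 Theta Delta sigma)
    (hNratio : polylog_close C0 n (N%:R / N_Delta p n L2 Theta Delta))
    (hmratio : polylog_close C0 n (m%:R / m_Delta p n L2 Theta Delta sigma))
    (htratio : polylog_close C0 n (t / t_Delta L2 Delta))
    (d' : measure_display) (Omega : measurableType d')
    (Pr : probability Omega R)
    (e : 'I_N -> Omega -> 'rV[R]_n) (xi : 'I_N -> 'I_m -> Omega -> X)
    (hsampling : ardfds_sampling Pr P e xi)
    (x y z : nat -> Omega -> 'rV[R]_n)
    (hrun : ardfds_run p (fun v s => F v s + eta v s) L2 t x0 e xi x y z),
  [/\ ('E_Pr[fun w => objective P F (y N w)] - (objective P F xstar)%:E
         <= (C * ln n%:R `^ C * eps_Delta p n L2 Theta Delta)%:E)%E,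
      forall w, oracle_calls (fun v s => F v s + eta v s) t e xi x w
                  = (N * m)%N
    & (N * m)%:R
        <= C * ln n%:R `^ C * calls_Delta p n L2 Theta Delta sigma].
Proof.
have C40 : 1 <= C0 ^+ 4 by exact: exprn_ege1.
exists (6400 * C0 ^+ 4); first by lra.
move=> n p hn hp d X P F g L L2 sigma hprob xs hxs x0 Theta hTheta eta Delta hnoise D0 hD.
move=> N m t hN hm ht hmD hNr hmr htr d' Omega Pr e xi hs x y z hrun.
set C := 6400 * C0 ^+ 4.
have L0 : 0 < L2 := sp_L2gt0 hprob.
have n0 : 0 < n%:R :> R by rewrite ltr0n (leq_trans _ hn).
have N0 : 0 < N%:R :> R by rewrite ltr0n.
have m0 : 0 < m%:R :> R by rewrite ltr0n.
have rh0 : 0 < rho p n :> R by exact: rho_gt0.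
(* A positive [Delta] below its upper bound forces [Theta] to be positive. *)
have T0 : 0 < Theta.
  rewrite ltNge; apply/negP => T0; have := lt_le_trans D0 hD; apply/negP; rewrite -leNgt.
  have -> : L2 * Theta * n%:R ^+ 3 * rho p n ^+ 2 / 2 =
    Theta * (L2 * n%:R ^+ 3 * rho p n ^+ 2 / 2) by ring.
  apply: mulr_le0_ge0 => //; rewrite divr_ge0//.
  by apply: mulr_ge0; [apply: mulr_ge0|]; rewrite ?exprn_ge0// ltW.
have l2 := @ln_dim_ge2 R n hn.
have l0 : 0 < ln n%:R :> R by exact: lt_le_trans l2.
have Q1 : 1 <= C0 * ln n%:R `^ C0.
  by apply: polylog_ge1 => //; apply: le_trans l2; rewrite ler1n.
have := polylog_bounds l0 htr; have := polylog_bounds l0 hmr; have := polylog_bounds l0 hNr.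
have := polylog_absorb (k := 4) hC0 l2 isT; have := polylog_absorb (k := 2) hC0 l2 isT.
rewrite -/C; set Q := C0 * _ in Q1 *; set l := ln _ in l2 l0 *.
have Q0 : 0 < Q by exact: lt_le_trans Q1.
have [a [b [c [[a0 b0 c0] [NE mE epsE callsE] [hK abc hb]]]]] :=
  @rates_factor R p n L2 Theta Delta sigma hn hp L0 T0 D0.
move: hmD; rewrite NE mE callsE; set s := sigma ^+ 2 / _.
rewrite lt_min => /andP[s0 _] ab2 ab4 hN' hm' ht'.
have sig0 : 0 < sigma ^+ 2.
  by move: s0; rewrite /s pmulr_lgt0// invr_gt0 !mulr_gt0.
have th := theta2_le L0 D0 ht Q0 ht'.
split.
- have rg := run_gap_integrable hn hp hm ht (ltW D0) hprob hxs hnoise hs hrun.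
  have := run_gap_le hn hp hm hN ht (ltW D0) hprob hxs hnoise hs hrun hTheta.
  have th0 : 0 <= theta2 L2 Delta t by exact: bias_sqr_ge0.
  have := @rate_total R n%:R (rho p n) L2 Theta Delta s (sigma ^+ 2) (theta2 L2 Delta t) l Q
    a b c N%:R m%:R (eps_Delta p n L2 Theta Delta)
    n0 rh0 L0 D0 sig0 l2 Q1 a0 b0 c0 N0 m0 th0 erefl hN' hm' th epsE hK abc hb.
  move=> rate gap; have {rate gap} gap := le_trans gap rate.
  (* Integrability makes the extended-valued expectation finite, which turns the claim into an
     inequality of reals. *)
  have rf : rint Pr (fun w => objective P F (y N w)).
    have := rintD rg (rint_cst Pr (objective P F xs)).
    by under eq_fun do rewrite subrK.
  have -> : ('E_Pr[fun w => objective P F (y N w)])%E =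
      (Er Pr (fun w => objective P F (y N w)))%:E by rewrite unlock ErE.
  rewrite -EFinB lee_fin -[X in _ - X](Er_cst Pr) -ErB//; last exact: rint_cst.
  apply: le_trans gap _; apply: ler_wpM2r.
    by rewrite epsE le_max mulr_ge0// ltW.
  rewrite {1}/C -[_ * _ * l]mulrA -[_ * _ * l `^ C]mulrA.
  by move: ab4; apply: ler_wpM2l; rewrite ler0n.
- move=> w; rewrite /oracle_calls (eq_bigr (fun=> m)) => [|k _]; last first.
    by rewrite /oracle_answers size_map size_enum_ord.
  by rewrite sum_nat_const card_ord.
rewrite natrM.
have := @calls_bound R n%:R L2 Delta s (sigma ^+ 2) Q a b c N%:R m%:R
  n0 L0 D0 sig0 a0 b0 c0 N0 m0 erefl hN' hm'.
move=> h; apply: le_trans h _; apply: ler_wpM2r.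
  by rewrite le_min; apply/andP; split; apply: ltW; apply: mulr_gt0 => //; exact: divr_gt0.
have l1 : 1 <= l by apply: le_trans l2; rewrite ler1n.
apply: (@le_trans _ _ (Q ^+ 2 * l)); first by apply: ler_peMr => //; exact: sqr_ge0.
apply: le_trans ab2 _; apply: ler_wpM2r; first exact: powR_ge0.
by rewrite /C; apply: ler_peMl; [exact: le_trans C40|rewrite ler1n].
Qed.
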